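(* Let $k:=0.71$, $L(k)=2K(k)$ and $$a^\star:=\sqrt{\frac{\pi}{K(k)^2-\frac1{k^2}\left(K(k)^2-E(k)K(k)\right)}}=1.41233776\ldots$$ For $a>0$ let $u(s):=a\,\mathrm{cn}(s,k)$ on $[0,L(k)]$, and (with $L=L(k)$) put $$LHS:=\left(\int_0^{L}u^2\,ds\right)\left(-\int_0^{L}(u')^2\,ds+\frac12\int_0^{L}u^4\,ds\right)-2L\int_0^{L}\left(u''+\frac12u^3\right)^2ds .$$ (1) For $a=a^\star$ one has $\int_0^{L(k)}u\,ds=0$, $L(k)\int_0^{L(k)}u^2\,ds=4\pi$ and $LHS=0.00307904\ldots>0$. In particular, it is false that $LHS\le0$ holds whenever $\int_0^Lu\,ds=0$ and $L\int_0^Lu^2\,ds\le4\pi$. (2) Now take for $a$ a truncated value of (the decimal expansion of) $a^\star=1.41233776\ldots$; this slightly decreases the scale-invariant energy below $2\pi$ while still keeping $LHS>0$. With this $a$, define the arclength parametrised curve with curvature function $u$, $$\tilde\gamma(s)=\begin{pmatrix}\tilde\gamma^1(s)\\ \tilde\gamma^2(s)\end{pmatrix}=\begin{pmatrix}\int_0^s\cos\left(\int_0^\sigma u(\varrho)\,d\varrho\right)d\sigma\\ \int_0^s\sin\left(\int_0^\sigma u(\varrho)\,d\varrho\right)d\sigma\end{pmatrix},\qquad s\in[0,L(k)],$$ and rescale and reparametrise it to $$\gamma_c(\rho)=\frac{2}{\tilde\gamma^1(L(k))}\begin{pmatrix}\tilde\gamma^1\big((\rho+1)L(k)/2\big)\\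 \tilde\gamma^2\big((\rho+1)L(k)/2\big)\end{pmatrix}-\begin{pmatrix}1\\0\end{pmatrix},\qquad\rho\in[-1,1],$$ so that $\gamma_c$ fits between the lines $\eta_{\pm1}$ and satisfies the boundary conditions, i.e. $\gamma_c\in\mathcal X$. Then $\gamma_c$, and hence its whole evolution $\gamma(\cdot,t)$ under the free boundary free elastic flow with $\gamma(\cdot,0)=\gamma_c$, has turning number zero, and $$\hat{\mathcal E}[\gamma(\cdot,0)]<2\pi,\qquad \frac{d}{dt}\hat{\mathcal E}[\gamma(\cdot,t)]\Big|_{t=0}>0 .$$
   Context: $K(k)=\int_0^{\pi/2}(1-k^2\sin^2\psi)^{-1/2}d\psi$ and $E(k)=\int_0^{\pi/2}(1-k^2\sin^2\psi)^{1/2}d\psi$ are the complete elliptic integrals with modulus $k$, and $\mathrm{cn}(\cdot,k)$ is the Jacobi elliptic function of modulus $k$: $\mathrm{cn}(s,k)=\cos(\mathrm{AM}(s,k))$ with $\mathrm{AM}(\cdot,k)$ the inverse of $\varphi\mapsto\int_0^\varphi(1-k^2\sin^2\psi)^{-1/2}d\psi$. For a smooth immersed curve $\gamma:[-1,1]\to\mathbb R^2$ let $s$ be arclength, $ds=|\gamma'(\rho)|\,d\rho$, $\partial_s=|\gamma'(\rho)|^{-1}\partial_\rho$, $\tau=\partial_s\gamma$ the unit tangent, $\nu$ the unit normal obtained by rotating $\tau$ by $(X,Y)\mapsto(-Y,X)$, and $\kappa=\partial_s^2\gamma\cdot\nu$. The turning number is $\frac1{2\pi}\int\kappa\,ds$.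 Put $\mathcal L[\gamma]=\int_{-1}^1ds$, $\mathcal E[\gamma]=\frac12\int_{-1}^1\kappa^2\,ds$, and let $\hat{\mathcal E}[\gamma]=\mathcal L[\gamma]\,\mathcal E[\gamma]$ be the scale-invariant energy. Let $\eta_{\pm1}(\rho)=(\pm1,\rho)$, $\rho\in\mathbb R$, $e_1=(1,0)$, and $$\mathcal X=\{\gamma:[-1,1]\to\mathbb R^2:\ \gamma\text{ smooth, immersed},\ \gamma(\pm1)\in\eta_{\pm1}(\mathbb R),\ \nu(\pm1)\cdot e_1=0,\ \kappa_s(\pm1)=0\}.$$ A free boundary free elastic flow is a one-parameter family $\gamma:[-1,1]\times[0,T)\to\mathbb R^2$ with $\partial_t\gamma=-(\kappa_{ss}+\frac12\kappa^3)\nu$ in $(-1,1)\times(0,T)$ and $\gamma(\cdot,t)\in\mathcal X$ for all $t\in[0,T)$. Along it, $$\frac{d}{dt}\hat{\mathcal E}[\gamma(\cdot,t)]=-\mathcal E[\gamma(\cdot,t)]\left(\int\kappa_s^2\,ds-\frac12\int\kappa^4\,ds\right)-\mathcal L[\gamma(\cdot,t)]\int\left(\kappa_{ss}+\frac12\kappa^3\right)^2ds .$$ *)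

(* Defs.v *)
(* Stdlib reals with Coquelicot. *)
From Stdlib Require Import Reals List.
From Coquelicot Require Import Coquelicot.

Open Scope R_scope.

(** * Elliptic integrals and the Jacobi function cn (modulus k) *)

Definition ellF (phi k : R) : R :=
  RInt (fun psi => / sqrt (1 - k ^ 2 * sin psi ^ 2)) 0 phi.

Definition ellK (k : R) : R := ellF (PI / 2) k.

Definition ellE (k : R) : R :=
  RInt (fun psi => sqrt (1 - k ^ 2 * sin psi ^ 2)) 0 (PI / 2).

(* [iota] is Coquelicot's definite description; for 0 <= k < 1 the map
   [fun phi => ellF phi k] is a bijection of the real line. *)
Definition AM (s k : R) : R := iota (T := R_CompleteSpace) (fun phi => ellF phi k = s).

Definition cn (s k : R) : R := cos (AM s k).

(** * Calculus on intervals

    Derivatives are taken relative to a set [D] (an interval), hence one-sided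
    at end points belonging to [D]; only the values on [D] of the function
    matter. *)

Definition Icc (a b x : R) : Prop := a <= x <= b.

Definition is_derive_in (D : R -> Prop) (f : R -> R) (x l : R) : Prop :=
  D_in f (fun _ => l) D x.

Definition derive_in (D : R -> Prop) (f : R -> R) (x : R) : R :=
  iota (T := R_CompleteSpace) (is_derive_in D f x).

Definition ex_derive_in (D : R -> Prop) (f : R -> R) (x : R) : Prop :=
  exists l, is_derive_in D f x l.

Fixpoint derive_n_in (D : R -> Prop) (f : R -> R) (n : nat) : R -> R :=
  match n with
  | O => f
  | S m => derive_in D (derive_n_in D f m)
  end.

Definition smooth_in (D : R -> Prop) (f : R -> R) : Prop :=
  forall n x, D x -> ex_derive_in D (derive_n_in D f n) x.

(* Iterated partial derivatives on [I x J]: [true] stands for the first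
   variable, [false] for the second one. *)
Fixpoint partials (I J : R -> Prop) (w : list bool) (f : R -> R -> R)
    : R -> R -> R :=
  match w with
  | nil => f
  | true :: w' => fun x t => derive_in I (fun y => partials I J w' f y t) x
  | false :: w' => fun x t => derive_in J (fun r => partials I J w' f x r) t
  end.

Definition continuous_in2 (I J : R -> Prop) (f : R -> R -> R) (x t : R) : Prop :=
  filterlim (fun p : R * R => f (fst p) (snd p))
    (within (fun p : R * R => I (fst p) /\ J (snd p)) (locally (x, t)))
    (locally (f x t)).

Definition smooth_in2 (I J : R -> Prop) (f : R -> R -> R) : Prop :=
  forall w x t, I x -> J t ->
    continuous_in2 I J (partials I J w f) x t /\
    ex_derive_in I (fun y => partials I J w f y t) x /\
    ex_derive_in J (fun r => partials I J w f x r) t.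

(** * Geometry of a plane curve parametrised on an interval [D] *)

Definition dot (v w : R * R) : R := fst v * fst w + snd v * snd w.

Definition speed (D : R -> Prop) (g : R -> R * R) (x : R) : R :=
  sqrt (derive_in D (fun y => fst (g y)) x ^ 2
        + derive_in D (fun y => snd (g y)) x ^ 2).

(* the arclength derivative of [f] along [g] *)
Definition d_s (D : R -> Prop) (g : R -> R * R) (f : R -> R) (x : R) : R :=
  derive_in D f x / speed D g x.

Definition tangent (D : R -> Prop) (g : R -> R * R) (x : R) : R * R :=
  (d_s D g (fun y => fst (g y)) x, d_s D g (fun y => snd (g y)) x).

Definition normal (D : R -> Prop) (g : R -> R * R) (x : R) : R * R :=
  (- snd (tangent D g x), fst (tangent D g x)).

Definition curvature (D : R -> Prop) (g : R -> R * R) (x : R) : R :=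
  dot (d_s D g (fun y => fst (tangent D g y)) x,
       d_s D g (fun y => snd (tangent D g y)) x)
      (normal D g x).

Definition curvature_s (D : R -> Prop) (g : R -> R * R) : R -> R :=
  d_s D g (curvature D g).

Definition curvature_ss (D : R -> Prop) (g : R -> R * R) : R -> R :=
  d_s D g (curvature_s D g).

(** * Curves on [-1,1] and their energies *)

Definition I11 : R -> Prop := Icc (-1) 1.

Definition int_ds (g : R -> R * R) (f : R -> R) : R :=
  RInt (fun x => f x * speed I11 g x) (-1) 1.

Definition turning_number (g : R -> R * R) : R :=
  1 / (2 * PI) * int_ds g (curvature I11 g).

Definition length_of (g : R -> R * R) : R := int_ds g (fun _ => 1).

Definition energy (g : R -> R * R) : R :=
  1 / 2 * int_ds g (fun x => curvature I11 g x ^ 2).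

Definition energy_hat (g : R -> R * R) : R := length_of g * energy g.

(* the right-hand side of the evolution law of [energy_hat] *)
Definition energy_hat_rate (g : R -> R * R) : R :=
  - energy g * (int_ds g (fun x => curvature_s I11 g x ^ 2)
                - 1 / 2 * int_ds g (fun x => curvature I11 g x ^ 4))
  - length_of g *
    int_ds g (fun x => (curvature_ss I11 g x
                        + 1 / 2 * curvature I11 g x ^ 3) ^ 2).

Definition e1 : R * R := (1, 0).

Definition eta (c r : R) : R * R := (c, r).

Definition class_X (g : R -> R * R) : Prop :=
  (smooth_in I11 (fun x => fst (g x)) /\ smooth_in I11 (fun x => snd (g x))) /\
  (forall x, I11 x -> speed I11 g x <> 0) /\
  (exists r, g (-1) = eta (-1) r) /\
  (exists r, g 1 = eta 1 r) /\
  dot (normal I11 g (-1)) e1 = 0 /\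
  dot (normal I11 g 1) e1 = 0 /\
  curvature_s I11 g (-1) = 0 /\
  curvature_s I11 g 1 = 0.

(** * The free boundary free elastic flow *)

Definition time_dom (T : Rbar) (t : R) : Prop := 0 <= t /\ Rbar_lt t T.

(* [g x t] is the position at parameter x and time t; [T] may be infinite.
   The family is smooth in (x,t) up to the boundary and the initial time. *)
Definition elastic_flow (T : Rbar) (g : R -> R -> R * R) : Prop :=
  Rbar_lt 0 T /\
  smooth_in2 I11 (time_dom T) (fun x t => fst (g x t)) /\
  smooth_in2 I11 (time_dom T) (fun x t => snd (g x t)) /\
  (forall x t, -1 < x < 1 -> 0 < t -> Rbar_lt t T ->
     let c := fun y => g y t in
     let F := curvature_ss I11 c x + 1 / 2 * curvature I11 c x ^ 3 in
     is_derive (fun r => fst (g x r)) t (- F * fst (normal I11 c x)) /\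
     is_derive (fun r => snd (g x r)) t (- F * snd (normal I11 c x))) /\
  (forall t, time_dom T t -> class_X (fun y => g y t)).

(** * The example *)

(* [Derive] differs from the derivative relative to [0,L] at the end points at
   most, which does not affect the integrals. *)
Definition LHS (L : R) (u : R -> R) : R :=
  RInt (fun s => u s ^ 2) 0 L *
    (- RInt (fun s => Derive u s ^ 2) 0 L
     + 1 / 2 * RInt (fun s => u s ^ 4) 0 L)
  - 2 * L * RInt (fun s => (Derive_n u 2 s + 1 / 2 * u s ^ 3) ^ 2) 0 L.

Definition k0 : R := 71 / 100.

Definition L0 : R := 2 * ellK k0.

Definition a_star : R :=
  sqrt (PI / (ellK k0 ^ 2 - 1 / k0 ^ 2 * (ellK k0 ^ 2 - ellE k0 * ellK k0))).

Definition u_cn (a s : R) : R := a * cn s k0.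

(* x >= 0 truncated after n decimal places *)
Definition trunc_dec (n : nat) (x : R) : R := IZR (Int_part (x * 10 ^ n)) / 10 ^ n.

Definition angle (a s : R) : R := RInt (u_cn a) 0 s.

Definition gamma_tilde (a s : R) : R * R :=
  (RInt (fun r => cos (angle a r)) 0 s, RInt (fun r => sin (angle a r)) 0 s).

Definition gamma_c (a rho : R) : R * R :=
  let c := 2 / fst (gamma_tilde a L0) in
  let p := gamma_tilde a ((rho + 1) * L0 / 2) in
  (c * fst p - 1, c * snd p).

(* Main.v *)
(** Every integral of the example reduces to K(k) and E(k).  The derivatives of sn cn dn and
    sn cn^3 dn express the integrals of cn^4, cn^6 and (sn dn)^2 over a half period through those
    of 1 and cn^2, so that LHS is an explicit polynomial in a^2, K and E; its sign is then a
    numerical question, and so is the value of a_star.  K and E are computed to twelve digits by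
    writing 1 - k^2 sin^2 t = c (1 + q cos 2t) with q about 0.337 and integrating the binomial
    series termwise against the Wallis moments of cos 2t.

    The curve closes up at horizontal tangents because its angle is (a/k) asin (k sn), which
    vanishes at both ends, and its horizontal extent is at least the integral of 1 - 2 k^2 sn^2,
    that is 4E - 2K > 0.  Its evolution rate is LHS / (2 c^4) with c the scaling factor.

    For a flow, the tangent is horizontal at both ends at all times, so the total curvature
    stays in pi Z; being continuous in time it is constant.  The derivative of the energy at time
    zero is obtained by differentiating under the integral sign.  The flow equation, assumed only
    for interior parameters and positive times, and the symmetry of mixed partial derivatives
    both extend to time zero by continuity.  Since the initial curve has constant speed, the
    first variation reduces to integrations by parts in arclength. *)
Require Import Defs.
From Stdlib Require Import Reals.
From Coquelicot Require Import Coquelicot.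
From Stdlib Require Import Lra Lia Classical Machin Ratan ZArith QArith Qpower Qreals.

Open Scope R_scope.

(** The example is a perturbation of a borderline case. For [u = a cn] one has [u'' + u^3/2 = a ((2
    k^2 - 1) cn + (a^2/2 - 2 k^2) cn^3)]. At k^2 = 1/2 and a^2 = 2 both coefficients vanish: u is
    the curvature of a free elastica, L times the integral of u^2 is 4 pi by Legendre's relation,
    and both terms of [LHS] are zero, the first because integration by parts turns its bracket into
    the integral of [u (u'' + u^3/2)]. The modulus 0.71 is slightly larger than 1/sqrt 2 and a is
    readjusted to the constraint. The bracket is linear in the two small coefficients and comes out
    positive, while the negative term of [LHS] is quadratic in them and too small to compensate. The
    price is cancellation: two quantities near 4.17 differ by about 0.0016, so six digits of [LHS]
    require K and E to about twelve. A second obstacle is that all derivatives are one-sided at the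
    ends of closed domains, whereas the mean value theorem, Schwarz's theorem and uniform continuity
    are used on open sets or on the whole line. Retractions onto the domain and density of its
    interior bridge the gap. *)

(** * Exact rational summation and bounds for pi *)

(** Index n is included, as in [sum_f_R0]. Reducing after every addition keeps the fractions small
    enough for [vm_compute]. *)
Fixpoint sumQ (f : nat -> Q) (n : nat) : Q :=
  match n with O => f O | S m => Qred (sumQ f m + f n) end.

Lemma sumQ_sum_f_R0 (f : nat -> Q) (g : nat -> R) (n : nat) :
  (forall j, Q2R (f j) = g j) -> Q2R (sumQ f n) = sum_f_R0 g n.
Proof.
  intros H; induction n as [|n IH]; cbn [sumQ sum_f_R0]; [apply H|].
  now rewrite (Qeq_eqR _ _ (Qred_correct _)), Q2R_plus, IH, H.
Qed.

Lemma Q2R_nat (n : nat) : Q2R (inject_Z (Z.of_nat n)) = INR n.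
Proof. unfold Q2R; simpl; rewrite Rinv_1, Rmult_1_r; symmetry; apply INR_IZR_INZ. Qed.

Lemma Q2R_pow (q : Q) (n : nat) : Q2R (Qpower q (Z.of_nat n)) = Q2R q ^ n.
Proof.
  induction n as [|n IH].
  - simpl; unfold Q2R; simpl; lra.
  - rewrite Nat2Z.inj_succ, <- Z.add_1_r.
    rewrite (Qeq_eqR _ _ (Qpower_plus' q (Z.of_nat n) 1 ltac:(lia))).
    rewrite Q2R_mult, IH; simpl; lra.
Qed.

Lemma INR_succ_pos (n : nat) : 0 < INR n + 1.
Proof. pose proof (pos_INR n); lra. Qed.

(** Rational copy of the alternating terms of pi/4 = 2 atan (1/3) + atan (1/7). *)
Definition machinQ (n : nat) : Q :=
  ((if Nat.even n then 1 else -1) / inject_Z (Z.of_nat (2 * n + 1))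
   * (2 * Qpower (1 # 3) (Z.of_nat (2 * n + 1)) + Qpower (1 # 7) (Z.of_nat (2 * n + 1))))%Q.

Lemma machinQ_tg_alt (n : nat) : Q2R (machinQ n) = tg_alt PI_2_3_7_tg n.
Proof.
  unfold machinQ, tg_alt, PI_2_3_7_tg, Ratan_seq.
  assert (Hn : INR (2 * n + 1) <> 0) by (apply not_0_INR; lia).
  unfold Qdiv.
  rewrite !Q2R_mult, Q2R_inv, Q2R_nat, Q2R_plus, Q2R_mult, !Q2R_pow.
  - replace (Q2R (1 # 3)) with (/ 3) by (unfold Q2R; simpl; lra).
    replace (Q2R (1 # 7)) with (/ 7) by (unfold Q2R; simpl; lra).
    replace (Q2R 2) with 2 by (unfold Q2R; simpl; lra).
    assert (Hs : Q2R (if Nat.even n then 1 else -1) = (-1) ^ n).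
    { destruct (Nat.even n) eqn:He.
      - apply Nat.even_spec in He; destruct He as [p ->].
        rewrite pow_1_even; unfold Q2R; simpl; lra.
      - assert (Ho : Nat.Odd n) by (apply Nat.odd_spec; unfold Nat.odd; now rewrite He).
        destruct Ho as [p ->]; rewrite Nat.add_1_r, pow_1_odd; unfold Q2R; simpl; lra. }
    rewrite Hs; field; auto.
  - intros H; apply Qeq_eqR in H; rewrite Q2R_nat in H; apply Hn; rewrite H.
    unfold Q2R; simpl; lra.
Qed.

Lemma PI_bounds : 31415926535897 / 10 ^ 13 < PI < 31415926535898 / 10 ^ 13.
Proof.
  destruct (PI_2_3_7_ineq 7) as [Hl Hu].
  rewrite <- (sumQ_sum_f_R0 machinQ _ _ machinQ_tg_alt) in Hl.
  rewrite <- (sumQ_sum_f_R0 machinQ _ _ machinQ_tg_alt) in Hu.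
  (* Consecutive partial sums of the alternating series enclose pi/4, hence the denominators 4 *
     10^13. *)
  assert (Hl' : Q2R (31415926535897 # 40000000000000) < Q2R (sumQ machinQ (S (2 * 7)))).
  { apply Qlt_Rlt; unfold Qlt; vm_compute; reflexivity. }
  assert (Hu' : Q2R (sumQ machinQ (2 * 7)) < Q2R (31415926535898 # 40000000000000)).
  { apply Qlt_Rlt; unfold Qlt; vm_compute; reflexivity. }
  set (x := sumQ machinQ (S (2 * 7))) in *; set (y := sumQ machinQ (2 * 7)) in *.
  unfold Q2R at 1 in Hl'; unfold Q2R at 2 in Hu'; cbn [Qnum Qden] in Hl', Hu'.
  split; lra.
Qed.

(** * Binomial series of (1+x)^(-1/2) *)

Fixpoint binQ (n : nat) : Q :=
  match n with
  | O => 1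
  | S m => (- (2 * inject_Z (Z.of_nat m) + 1) / (2 * inject_Z (Z.of_nat n)) * binQ m)%Q
  end.

Definition bin (n : nat) : R := Q2R (binQ n).

Lemma bin_0 : bin 0 = 1.
Proof. unfold bin, Q2R; simpl; lra. Qed.

Lemma bin_S (n : nat) : bin (S n) = - (2 * INR n + 1) / (2 * (INR n + 1)) * bin n.
Proof.
  unfold bin; change (binQ (S n)) with
   (- (2 * inject_Z (Z.of_nat n) + 1) / (2 * inject_Z (Z.of_nat (S n))) * binQ n)%Q.
  pose proof (INR_succ_pos n).
  unfold Qdiv; rewrite !Q2R_mult, Q2R_inv, Q2R_mult, Q2R_opp, Q2R_plus, Q2R_mult, !Q2R_nat, S_INR.
  - replace (Q2R 2) with 2 by (unfold Q2R; simpl; lra).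
    replace (Q2R 1) with 1 by (unfold Q2R; simpl; lra).
    field; lra.
  - intros E; apply Qeq_eqR in E; rewrite Q2R_mult, Q2R_nat, S_INR in E.
    unfold Q2R in E; simpl in E; lra.
Qed.

Lemma Rabs_bin_le_1 (n : nat) : Rabs (bin n) <= 1.
Proof.
  induction n as [|n IH]; [rewrite bin_0, Rabs_R1; lra|].
  rewrite bin_S, Rabs_mult; pose proof (pos_INR n).
  replace (- (2 * INR n + 1) / (2 * (INR n + 1))) with (- ((2 * INR n + 1) / (2 * (INR n + 1)))) by (field; lra).
  rewrite Rabs_Ropp, Rabs_pos_eq.
  - rewrite <- (Rmult_1_l 1); apply Rmult_le_compat; auto; try apply Rabs_pos.
    + apply Rcomplements.Rdiv_le_0_compat; lra.
    + apply Rcomplements.Rle_div_l; lra.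
  - apply Rcomplements.Rdiv_le_0_compat; lra.
Qed.

Definition binP (N : nat) (x : R) : R := sum_f_R0 (fun j => bin j * x ^ j) N.

Fixpoint binP' (N : nat) (x : R) : R :=
  match N with
  | O => 0
  | S n => binP' n x + bin N * (INR N * x ^ n)
  end.

Lemma is_derive_binP (N : nat) (x : R) : is_derive (binP N) x (binP' N x).
Proof.
  induction N as [|n IH]; unfold binP; simpl sum_f_R0.
  - simpl; auto_derive; auto; ring.
  - apply (is_derive_plus (binP n) (fun x => bin (S n) * x ^ S n)); [exact IH|].
    auto_derive; auto. rewrite Rmult_1_l; reflexivity.
Qed.

(** The function (1 + x)^(-1/2) solves (1 + x) y' + y/2 = 0. For the truncated series the recurrence
    of the coefficients cancels every power except the top one. *)
Lemma binP_ode (N : nat) (x : R) :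
  (1 + x) * binP' N x + binP N x / 2 = (INR N + 1 / 2) * bin N * x ^ N.
Proof.
  induction N as [|n IH].
  - unfold binP; simpl; rewrite bin_0; lra.
  - unfold binP; cbn [sum_f_R0 binP']; fold (binP n x).
    replace ((1 + x) * (binP' n x + bin (S n) * (INR (S n) * x ^ n)) +
      (binP n x + bin (S n) * x ^ S n) / 2) with
     (((1 + x) * binP' n x + binP n x / 2) + bin (S n) * ((1 + x) * INR (S n) * x ^ n + x ^ S n / 2))
     by field.
    rewrite IH, bin_S, S_INR; pose proof (INR_succ_pos n); simpl pow; field; lra.
Qed.

(* [1 - binP N x * sqrt (1 + x)] vanishes at 0 and, by [binP_ode], has derivative
   [- (N + 1/2) * bin N * x^N / sqrt (1 + x)]. *)
Lemma binP_error (N : nat) (q x : R) : 0 <= q < 1 -> Rabs x <= q ->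
  Rabs (binP N x - / sqrt (1 + x)) <= (INR N + 1 / 2) * q ^ S N / (1 - q).
Proof.
  intros Hq Hx.
  assert (Hp : forall y, Rabs y <= q -> 0 < 1 + y) by (intros y Hy; apply Rabs_le_between in Hy; lra).
  pose (dg := fun y => - ((INR N + 1 / 2) * bin N * y ^ N / sqrt (1 + y))).
  assert (Hd : forall y, Rabs y <= q ->
     is_derive (fun y => 1 - binP N y * sqrt (1 + y)) y (dg y)).
  { intros y Hy; pose proof (Hp y Hy) as Hy'; pose proof (sqrt_lt_R0 _ Hy') as Hs.
    evar_last.
    - apply (is_derive_minus (fun _ => 1) (fun y => binP N y * sqrt (1 + y))); [apply is_derive_const|].
      apply (is_derive_mult (binP N) (fun y => sqrt (1 + y))).
      + apply is_derive_binP.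
      + instantiate (1 := / (2 * sqrt (1 + y))). auto_derive; auto; field; lra.
      + intros; apply Rmult_comm.
    - unfold dg; rewrite <- binP_ode; unfold minus, plus, opp, mult, zero; simpl.
      replace ((1 + y)) with (sqrt (1 + y) * sqrt (1 + y)) at 3 by (apply sqrt_sqrt; lra).
      field; lra. }
  assert (Hg : Rabs (1 - binP N x * sqrt (1 + x)) <= (INR N + 1 / 2) * q ^ S N / sqrt (1 - q)).
  { destruct (MVT_gen (fun y => 1 - binP N y * sqrt (1 + y)) 0 x dg) as [c [Hc Heq]].
    - intros y Hy; apply Hd; apply Rabs_le_between; apply Rabs_le_between in Hx.
      unfold Rmin, Rmax in Hy; destruct (Rle_dec 0 x); lra.
    - intros y Hy; apply continuity_pt_filterlim.
      apply (ex_derive_continuous (fun y => 1 - binP N y * sqrt (1 + y))).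
      eexists; apply Hd; apply Rabs_le_between; apply Rabs_le_between in Hx.
      unfold Rmin, Rmax in Hy; destruct (Rle_dec 0 x); lra.
    - assert (Hc' : Rabs c <= q).
      { apply Rabs_le_between; apply Rabs_le_between in Hx.
        unfold Rmin, Rmax in Hc; destruct (Rle_dec 0 x); lra. }
      assert (H0 : binP N 0 = 1).
      { clear; induction N as [|n IH]; unfold binP; simpl; [rewrite bin_0; ring|].
        fold (binP n 0); rewrite IH; ring. }
      rewrite H0, Rplus_0_r, sqrt_1 in Heq.
      replace (1 - binP N x * sqrt (1 + x)) with (dg c * (x - 0)) by lra.
      rewrite Rminus_0_r; unfold dg; rewrite Rabs_mult, Rabs_Ropp; unfold Rdiv.
      rewrite !Rabs_mult.
      pose proof (pos_INR N).
      rewrite (Rabs_pos_eq (INR N + 1 * / 2)) by lra.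
      pose proof (Hp c Hc') as Hc1; pose proof (sqrt_lt_R0 _ Hc1) as Hc2.
      rewrite Rabs_inv, (Rabs_pos_eq (sqrt _)) by lra.
      assert (Hs : 0 < sqrt (1 - q)) by (apply sqrt_lt_R0; lra).
      assert (Hi : / sqrt (1 + c) <= / sqrt (1 - q)).
      { apply Rinv_le_contravar; auto; apply sqrt_le_1; try lra.
        apply Rabs_le_between in Hc'; lra. }
      assert (Hpw : Rabs (c ^ N) <= q ^ N).
      { rewrite <- RPow_abs; apply pow_incr; split; auto using Rabs_pos. }
      pose proof (Rabs_bin_le_1 N) as Hb.
      pose proof (Rabs_pos c); pose proof (Rabs_pos (c ^ N)); pose proof (Rabs_pos (bin N)).
      pose proof (Rinv_0_lt_compat _ Hc2).
      simpl pow; replace ((INR N + 1 * / 2) * (q * q ^ N) * / sqrt (1 - q)) with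
        ((INR N + 1 * / 2) * 1 * q ^ N * / sqrt (1 - q) * q) by ring.
      repeat (apply Rmult_le_compat; try lra; try apply Rabs_pos; repeat apply Rmult_le_pos; try lra; try apply Rabs_pos). }
  (* Dividing the error by sqrt (1 + x) costs a second factor 1 / sqrt (1 - q), which completes the
     denominator 1 - q. *)
  pose proof (Hp x Hx) as Hx1; pose proof (sqrt_lt_R0 _ Hx1) as Hx2.
  assert (Hs : 0 < sqrt (1 - q)) by (apply sqrt_lt_R0; lra).
  replace (binP N x - / sqrt (1 + x)) with (- ((1 - binP N x * sqrt (1 + x)) * / sqrt (1 + x)))
    by (field; lra).
  rewrite Rabs_Ropp, Rabs_mult, Rabs_inv, (Rabs_pos_eq (sqrt _)) by lra.
  replace ((INR N + 1 / 2) * q ^ S N / (1 - q)) with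
    ((INR N + 1 / 2) * q ^ S N / sqrt (1 - q) * / sqrt (1 - q))
    by (rewrite <- (sqrt_sqrt (1 - q)) at 3 by lra; field; lra).
  apply Rmult_le_compat; auto using Rabs_pos.
  - left; now apply Rinv_0_lt_compat.
  - apply Rinv_le_contravar; auto; apply sqrt_le_1; try lra.
    apply Rabs_le_between in Hx; lra.
Qed.

(** * Wallis moments *)

(** Mean value of [cos (2t)^n] over [0, pi/2]; taking the factor pi/2 out keeps the moments
    rational. *)
Fixpoint wallisQ (n : nat) : Q :=
  match n with
  | O => 1
  | S O => 0
  | S (S m) => (inject_Z (Z.of_nat (S m)) / inject_Z (Z.of_nat n) * wallisQ m)%Q
  end.

Lemma wallisQ_SS (n : nat) :
  Q2R (wallisQ (S (S n))) = (INR n + 1) / (INR n + 2) * Q2R (wallisQ n).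
Proof.
  change (wallisQ (S (S n))) with
    (inject_Z (Z.of_nat (S n)) / inject_Z (Z.of_nat (S (S n))) * wallisQ n)%Q.
  pose proof (pos_INR n).
  unfold Qdiv; rewrite !Q2R_mult, Q2R_inv, !Q2R_nat, !S_INR.
  - replace (INR n + 1 + 1) with (INR n + 2) by ring; reflexivity.
  - intros E; apply Qeq_eqR in E; rewrite Q2R_nat, !S_INR in E.
    unfold Q2R in E; simpl in E; lra.
Qed.

Lemma is_RInt_cos2_pow (n : nat) :
  is_RInt (fun t => cos (2 * t) ^ n) 0 (PI / 2) (PI / 2 * Q2R (wallisQ n)).
Proof.
  assert (E2 : 2 * (PI / 2) = PI) by field.
  (* The recurrence has step two, so the induction carries two consecutive exponents. *)
  enough (H : forall n, is_RInt (fun t => cos (2 * t) ^ n) 0 (PI / 2) (PI / 2 * Q2R (wallisQ n)) /\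
      is_RInt (fun t => cos (2 * t) ^ S n) 0 (PI / 2) (PI / 2 * Q2R (wallisQ (S n)))) by exact (proj1 (H n)).
  clear n; induction n as [|n [IH1 IH2]]; split; auto.
  - simpl; evar_last; [apply (is_RInt_const 0 (PI / 2) 1)|].
    unfold scal; simpl; unfold mult, Q2R; simpl; field.
  - evar_last.
    + apply (is_RInt_derive (fun t => sin (2 * t) / 2) (fun t => cos (2 * t) ^ 1)).
      * intros x _; auto_derive; auto; field.
      * intros x _; apply (ex_derive_continuous (fun t => cos (2 * t) ^ 1)); auto_derive; auto.
    + unfold minus, plus, opp; simpl; rewrite E2, sin_PI, Rmult_0_r, sin_0.
      unfold Q2R; simpl; field.
  - pose proof (pos_INR n) as Hn.
    set (I := PI / 2 * Q2R (wallisQ n)) in IH1.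
    (* The integrand is the derivative of [sin (2t) * cos (2t)^(n+1)], which vanishes at 0 and
       pi/2. *)
    assert (Hd : is_RInt (fun t => 2 * (INR n + 2) * cos (2 * t) ^ S (S n) - 2 * (INR n + 1) * cos (2 * t) ^ n)
                   0 (PI / 2) 0).
    { evar_last.
      - apply (is_RInt_derive (fun t => sin (2 * t) * cos (2 * t) ^ S n)).
        + intros x _; auto_derive; auto.
          replace (match n with 0%nat => 1 | S _ => INR n + 1 end) with (INR n + 1)
            by (destruct n; simpl; lra).
          pose proof (sin2_cos2 (2 * x)) as Hsc; unfold Rsqr in Hsc.
          simpl pow. transitivity (2 * (cos (2 * x) * (cos (2 * x) * cos (2 * x) ^ n)) -
             2 * (INR n + 1) * (sin (2 * x) * sin (2 * x)) * cos (2 * x) ^ n); [ring|].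
          replace (sin (2 * x) * sin (2 * x)) with (1 - cos (2 * x) * cos (2 * x)) by lra; ring.
        + intros x _.
          apply (ex_derive_continuous (fun t => 2 * (INR n + 2) * cos (2 * t) ^ S (S n) - 2 * (INR n + 1) * cos (2 * t) ^ n)).
          auto_derive; auto.
      - unfold minus, plus, opp; simpl; rewrite E2, sin_PI, Rmult_0_r, sin_0; ring. }
    evar_last.
    + apply (is_RInt_ext (fun t => plus (scal (/ (2 * (INR n + 2)))
          (2 * (INR n + 2) * cos (2 * t) ^ S (S n) - 2 * (INR n + 1) * cos (2 * t) ^ n))
          (scal ((INR n + 1) / (INR n + 2)) (cos (2 * t) ^ n)))).
      * intros x _; unfold plus, scal; simpl; unfold mult; simpl; field; lra.
      * apply (is_RInt_plus (V := R_NormedModule)).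
        -- apply (is_RInt_scal (V := R_NormedModule)); exact Hd.
        -- apply (is_RInt_scal (V := R_NormedModule)); exact IH1.
    + change (/ (2 * (INR n + 2)) * 0 + (INR n + 1) / (INR n + 2) * I = PI / 2 * Q2R (wallisQ (S (S n)))).
      rewrite wallisQ_SS; unfold I; ring.
Qed.

(** * Numerical values of the elliptic integrals *)

(** This is k^2 / (2 - k^2), obtained by writing sin^2 through cos 2t. Expanding about the mean of
    the radicand lowers the convergence ratio from k^2, about 0.504, to about 0.337. *)
Definition modQ : Q := (25205 # 74795)%Q.

Lemma ellip_radicand (t : R) :
  1 - k0 ^ 2 * sin t ^ 2 = 74795 / 100000 * (1 + Q2R modQ * cos (2 * t)).
Proof.
  unfold k0, modQ, Q2R; cbn [Qnum Qden]; rewrite cos_2a_sin; field.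
Qed.

Lemma is_RInt_binP (a : nat -> Q) (N : nat) :
  is_RInt (fun t => sum_f_R0 (fun j => Q2R (a j) * cos (2 * t) ^ j) N) 0 (PI / 2)
    (PI / 2 * Q2R (sumQ (fun j => a j * wallisQ j)%Q N)).
Proof.
  induction N as [|N IH]; cbn [sumQ sum_f_R0].
  - rewrite Q2R_mult, <- Rmult_assoc, (Rmult_comm (PI / 2)), Rmult_assoc.
    apply (is_RInt_scal (V := R_NormedModule)), (is_RInt_cos2_pow 0).
  - rewrite (Qeq_eqR _ _ (Qred_correct _)), Q2R_plus, Q2R_mult, Rmult_plus_distr_l.
    apply (is_RInt_plus (V := R_NormedModule)); [exact IH|].
    rewrite <- Rmult_assoc, (Rmult_comm (PI / 2) (Q2R (a _))), Rmult_assoc.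
    apply (is_RInt_scal (V := R_NormedModule)), (is_RInt_cos2_pow (S N)).
Qed.

Lemma RInt_near (f g : R -> R) (a b e v : R) : a <= b ->
  (forall x, a <= x <= b -> continuous f x) -> is_RInt g a b v ->
  (forall x, a <= x <= b -> Rabs (g x - f x) <= e) -> Rabs (RInt f a b - v) <= (b - a) * e.
Proof.
  intros Hab Hf Hg H.
  assert (If : ex_RInt f a b) by (apply (ex_RInt_continuous (V := R_CompleteNormedModule)); rewrite Rmin_left, Rmax_right; auto).
  apply (RInt_correct (V := R_CompleteNormedModule)) in If.
  apply (norm_RInt_le_const (fun x => minus (f x) (g x)) a b (minus (RInt f a b) v) e); auto.
  - intros x Hx; change (Rabs (f x - g x) <= e); rewrite Rabs_minus_sym; auto.
  - apply (is_RInt_minus (V := R_NormedModule)); auto.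
Qed.

(** Degree 32 brings the bound of [binP_error] at q = [modQ] below 10^(-13). *)
Definition ellK_sumQ : Q := sumQ (fun j => binQ j * Qpower modQ (Z.of_nat j) * wallisQ j)%Q 32.

(* From sqrt (1 + x) = (1 + x) / sqrt (1 + x), the second sum being the part multiplied by x. *)
Definition ellE_sumQ : Q :=
  (ellK_sumQ + sumQ (fun j => match j with O => 0 | S i => binQ i * Qpower modQ (Z.of_nat j) end * wallisQ j)%Q 33)%Q.

Lemma modQ_range : 0 <= Q2R modQ < 1.
Proof. unfold modQ, Q2R; cbn [Qnum Qden]; lra. Qed.

Lemma modQ_cos (t : R) : Rabs (Q2R modQ * cos (2 * t)) <= Q2R modQ.
Proof.
  pose proof modQ_range; rewrite Rabs_mult, Rabs_pos_eq by lra.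
  rewrite <- (Rmult_1_r (Q2R modQ)) at 2; apply Rmult_le_compat_l; [lra|].
  apply Rabs_le, COS_bound.
Qed.

Lemma modQ_cos_pos (t : R) : 0 < 1 + Q2R modQ * cos (2 * t).
Proof.
  pose proof modQ_range; pose proof (modQ_cos t) as H1; apply Rabs_le_between in H1; lra.
Qed.

Lemma binP_error_32 (t : R) :
  Rabs (binP 32 (Q2R modQ * cos (2 * t)) - / sqrt (1 + Q2R modQ * cos (2 * t))) <= / 10 ^ 13.
Proof.
  eapply Rle_trans; [apply (binP_error 32 (Q2R modQ)); [apply modQ_range|apply modQ_cos]|].
  unfold modQ, Q2R; cbn [Qnum Qden]; rewrite INR_IZR_INZ; cbn [Z.of_nat Pos.of_succ_nat Pos.succ]; lra.
Qed.

Lemma continuous_inv_sqrt_mod (t : R) : continuous (fun t => / sqrt (1 + Q2R modQ * cos (2 * t))) t.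
Proof.
  pose proof (modQ_cos_pos t) as Hp.
  apply (ex_derive_continuous (fun t => / sqrt (1 + Q2R modQ * cos (2 * t)))).
  auto_derive; repeat split; auto.
  apply Rgt_not_eq, sqrt_lt_R0, Hp.
Qed.

Lemma continuous_sqrt_mod (t : R) : continuous (fun t => sqrt (1 + Q2R modQ * cos (2 * t))) t.
Proof.
  pose proof (modQ_cos_pos t) as Hp.
  apply (ex_derive_continuous (fun t => sqrt (1 + Q2R modQ * cos (2 * t)))).
  auto_derive; repeat split; auto.
Qed.

Lemma binP_sum (t : R) (N : nat) : binP N (Q2R modQ * cos (2 * t)) =
  sum_f_R0 (fun j => Q2R (binQ j * Qpower modQ (Z.of_nat j)) * cos (2 * t) ^ j) N.
Proof.
  apply sum_eq; intros j _; unfold bin; rewrite Q2R_mult, Q2R_pow, Rpow_mult_distr; ring.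
Qed.

Lemma ellK_sum_error :
  Rabs (RInt (fun t => / sqrt (1 + Q2R modQ * cos (2 * t))) 0 (PI / 2) - PI / 2 * Q2R ellK_sumQ)
    <= PI / 2 * / 10 ^ 13.
Proof.
  pose proof PI_RGT_0.
  rewrite <- (Rminus_0_r (PI / 2)) at 3; apply RInt_near with
   (g := fun t => sum_f_R0 (fun j => Q2R (binQ j * Qpower modQ (Z.of_nat j)) * cos (2 * t) ^ j) 32); try lra.
  - intros; apply continuous_inv_sqrt_mod.
  - apply is_RInt_binP.
  - intros t _; rewrite <- binP_sum; apply binP_error_32.
Qed.

Lemma ellE_sum_error :
  Rabs (RInt (fun t => sqrt (1 + Q2R modQ * cos (2 * t))) 0 (PI / 2) - PI / 2 * Q2R ellE_sumQ)
    <= PI / 2 * (2 * / 10 ^ 13).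
Proof.
  pose proof PI_RGT_0.
  rewrite <- (Rminus_0_r (PI / 2)) at 3; apply RInt_near with
   (g := fun t => plus (sum_f_R0 (fun j => Q2R (binQ j * Qpower modQ (Z.of_nat j)) * cos (2 * t) ^ j) 32)
     (sum_f_R0 (fun j => Q2R (match j with O => 0 | S i => binQ i * Qpower modQ (Z.of_nat j) end)%Q * cos (2 * t) ^ j) 33)); try lra.
  - intros; apply continuous_sqrt_mod.
  - unfold ellE_sumQ; rewrite Q2R_plus, Rmult_plus_distr_l.
    apply (is_RInt_plus (V := R_NormedModule)); [|apply is_RInt_binP].
    apply is_RInt_binP.
  - intros t _. lazymatch goal with |- Rabs (plus ?x ?y - ?z) <= _ => change (Rabs (x + y - z) <= 2 * / 10 ^ 13) end.
    rewrite <- binP_sum.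
    rewrite decomp_sum by lia; cbn [Init.Nat.pred].
    rewrite (sum_eq _ (fun j => (bin j * (Q2R modQ * cos (2 * t)) ^ j) * (Q2R modQ * cos (2 * t)))).
    2:{ intros j _; unfold bin; rewrite Q2R_mult, Q2R_pow, Rpow_mult_distr; simpl; ring. }
    rewrite <- scal_sum; fold (binP 32 (Q2R modQ * cos (2 * t))).
    pose proof (binP_error_32 t) as He; pose proof (modQ_cos_pos t) as Hp.
    set (x := Q2R modQ * cos (2 * t)) in *.
    replace (Q2R 0) with 0 by (unfold Q2R; simpl; lra).
    pose proof (sqrt_lt_R0 _ Hp) as Hs.
    (* Multiplied by 1 + x, the approximation of the inverse root becomes one of the root. As 1 + x
       < 2, the error at most doubles. *)
    replace (_ - sqrt (1 + x)) with ((1 + x) * (binP 32 x - / sqrt (1 + x))).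
    2:{ rewrite <- (sqrt_sqrt (1 + x)) at 1 by lra.
        transitivity (sqrt (1 + x) * sqrt (1 + x) * binP 32 x - sqrt (1 + x)); [field; lra|].
        rewrite sqrt_sqrt by lra; ring. }
    rewrite Rabs_mult; apply Rmult_le_compat; try apply Rabs_pos; auto.
    pose proof (modQ_cos t) as H1; fold x in H1; apply Rabs_le_between in H1; pose proof modQ_range.
    rewrite Rabs_pos_eq; lra.
Qed.

Lemma sqrt_c_bounds : 8648410258538 / 10 ^ 13 < sqrt (74795 / 100000) < 8648410258539 / 10 ^ 13.
Proof.
  split.
  - rewrite <- (sqrt_pow2 (8648410258538 / 10 ^ 13)) by lra; apply sqrt_lt_1; lra.
  - rewrite <- (sqrt_pow2 (8648410258539 / 10 ^ 13)) by lra; apply sqrt_lt_1; lra.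
Qed.

Lemma ellK_eq : ellK k0 = / sqrt (74795 / 100000) * RInt (fun t => / sqrt (1 + Q2R modQ * cos (2 * t))) 0 (PI / 2).
Proof.
  etransitivity; [|apply (RInt_scal (V := R_CompleteNormedModule))].
  - apply (RInt_ext (V := R_CompleteNormedModule)); intros t _.
    rewrite ellip_radicand, sqrt_mult, Rinv_mult; try lra; [reflexivity|].
    left; apply modQ_cos_pos.
  - apply (ex_RInt_continuous (V := R_CompleteNormedModule)); intros; apply continuous_inv_sqrt_mod.
Qed.

Lemma ellE_eq : ellE k0 = sqrt (74795 / 100000) * RInt (fun t => sqrt (1 + Q2R modQ * cos (2 * t))) 0 (PI / 2).
Proof.
  etransitivity; [|apply (RInt_scal (V := R_CompleteNormedModule))].
  - apply (RInt_ext (V := R_CompleteNormedModule)); intros t _.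
    rewrite ellip_radicand, sqrt_mult; try lra; [reflexivity|].
    left; apply modQ_cos_pos.
  - apply (ex_RInt_continuous (V := R_CompleteNormedModule)); intros; apply continuous_sqrt_mod.
Qed.

Lemma ellK_sumQ_bounds :
  1022728065371231 / 10 ^ 15 <= Q2R ellK_sumQ <= 1022728065371232 / 10 ^ 15.
Proof.
  assert (H1 : Q2R (1022728065371231 # 1000000000000000) <= Q2R ellK_sumQ)
    by (apply Qle_Rle; unfold Qle; vm_compute; discriminate).
  assert (H2 : Q2R ellK_sumQ <= Q2R (1022728065371232 # 1000000000000000))
    by (apply Qle_Rle; unfold Qle; vm_compute; discriminate).
  unfold Q2R at 1 in H1; unfold Q2R at 2 in H2; cbn [Qnum Qden] in H1, H2; lra.
Qed.

Lemma ellE_sumQ_bounds :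
  992703518325384 / 10 ^ 15 <= Q2R ellE_sumQ <= 992703518325385 / 10 ^ 15.
Proof.
  assert (H1 : Q2R (992703518325384 # 1000000000000000) <= Q2R ellE_sumQ)
    by (apply Qle_Rle; unfold Qle; vm_compute; discriminate).
  assert (H2 : Q2R ellE_sumQ <= Q2R (992703518325385 # 1000000000000000))
    by (apply Qle_Rle; unfold Qle; vm_compute; discriminate).
  unfold Q2R at 1 in H1; unfold Q2R at 2 in H2; cbn [Qnum Qden] in H1, H2; lra.
Qed.

(** * Interval arithmetic for K, E, the moments of cn and the sign of LHS *)

(** Each product of two uncertain quantities is enclosed by this rule, which leaves goals linear in
    the products for [lra]. *)
Lemma Rmult_itv (x y a b c d : R) : 0 <= a -> a <= x <= b -> 0 <= c -> c <= y <= d ->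
  a * c <= x * y <= b * d.
Proof. intros; split; apply Rmult_le_compat; lra. Qed.

Lemma ellK_ellE_bounds :
  1857563922581 / 10 ^ 12 < ellK k0 < 1857563922584 / 10 ^ 12 /\
  1348576915799 / 10 ^ 12 < ellE k0 < 1348576915802 / 10 ^ 12.
Proof.
  rewrite ellK_eq, ellE_eq.
  pose proof ellK_sum_error as HK; pose proof ellE_sum_error as HE.
  set (IK := RInt (fun t => / sqrt (1 + Q2R modQ * cos (2 * t))) 0 (PI / 2)) in *.
  set (IE := RInt (fun t => sqrt (1 + Q2R modQ * cos (2 * t))) 0 (PI / 2)) in *.
  pose proof PI_bounds as Hpi; pose proof sqrt_c_bounds as Hs.
  set (r := sqrt (74795 / 100000)) in *.
  set (SK := Q2R ellK_sumQ) in *; set (SE := Q2R ellE_sumQ) in *.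
  pose proof ellK_sumQ_bounds as [HK1 HK2]; pose proof ellE_sumQ_bounds as [HE1 HE2].
  apply Rabs_le_between in HK; apply Rabs_le_between in HE.
  fold SK in HK1, HK2; fold SE in HE1, HE2.
  clearbody IK IE r SK SE.
  destruct (Rmult_itv PI SK (31415926535897 / 10 ^ 13) (31415926535898 / 10 ^ 13)
    (1022728065371231 / 10 ^ 15) (1022728065371232 / 10 ^ 15)
    ltac:(lra) ltac:(lra) ltac:(lra) (conj HK1 HK2)) as [P1 P2].
  destruct (Rmult_itv PI SE (31415926535897 / 10 ^ 13) (31415926535898 / 10 ^ 13)
    (992703518325384 / 10 ^ 15) (992703518325385 / 10 ^ 15)
    ltac:(lra) ltac:(lra) ltac:(lra) (conj HE1 HE2)) as [P3 P4].
  assert (HIK : 16064974883946 / 10 ^ 13 < IK < 16064974883958 / 10 ^ 13) by lra.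
  assert (HIE : 15593350401810 / 10 ^ 13 < IE < 15593350401826 / 10 ^ 13) by lra.
  assert (Hr : 10 ^ 13 / 8648410258539 < / r < 10 ^ 13 / 8648410258538).
  { split; apply (Rmult_lt_reg_l r); try lra; rewrite Rinv_r by lra; lra. }
  destruct (Rmult_itv (/ r) IK (10 ^ 13 / 8648410258539) (10 ^ 13 / 8648410258538)
    (16064974883946 / 10 ^ 13) (16064974883958 / 10 ^ 13)
    ltac:(lra) ltac:(lra) ltac:(lra) ltac:(lra)) as [P5 P6].
  destruct (Rmult_itv r IE (8648410258538 / 10 ^ 13) (8648410258539 / 10 ^ 13)
    (15593350401810 / 10 ^ 13) (15593350401826 / 10 ^ 13)
    ltac:(lra) ltac:(lra) ltac:(lra) ltac:(lra)) as [P7 P8].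
  lra.
Qed.

(* Integrals over [0, 2K] of cn^2, cn^4, cn^6 and sn^2 dn^2 at k^2 = 0.5041. *)
Definition C2 : R := (2 * ellE k0 - (1 - k0 ^ 2) * (2 * ellK k0)) / k0 ^ 2.
Definition C4 : R := (2 * (2 * k0 ^ 2 - 1) * C2 + (1 - k0 ^ 2) * (2 * ellK k0)) / (3 * k0 ^ 2).
Definition C6 : R := (4 * (2 * k0 ^ 2 - 1) * C4 + 3 * (1 - k0 ^ 2) * C2) / (5 * k0 ^ 2).
Definition D22 : R := (1 - k0 ^ 2) * (2 * ellK k0) + (2 * k0 ^ 2 - 1) * C2 - k0 ^ 2 * C4.

(** [LHS] of [a cn] divided by a^2, as a polynomial in A = a^2. The factors 2 k^2 - 1 and A/2 - 2
    k^2 are the coefficients of cn and cn^3 in (u'' + u^3/2) / a. *)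
Definition lhs_over (A : R) : R :=
  C2 * (- A * D22 + A ^ 2 * C4 / 2)
  - 4 * ellK k0 * ((2 * k0 ^ 2 - 1) ^ 2 * C2
      + 2 * (2 * k0 ^ 2 - 1) * (A / 2 - 2 * k0 ^ 2) * C4 + (A / 2 - 2 * k0 ^ 2) ^ 2 * C6).

(** Since [k0] is a fixed rational, the four moments are linear in K and E, and the enclosures
    propagate by linear arithmetic. *)
Lemma moment_bounds :
  1695738808120 / 10 ^ 12 < C2 < 1695738808165 / 10 ^ 12 /\
  1236621050602 / 10 ^ 12 < C4 < 1236621050662 / 10 ^ 12 /\
  1016985437495 / 10 ^ 12 < C6 < 1016985437595 / 10 ^ 12 /\
  1232856284970 / 10 ^ 12 < D22 < 1232856285070 / 10 ^ 12.
Proof.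
  unfold D22, C6, C4, C2; destruct ellK_ellE_bounds as [HK HE].
  generalize dependent (ellK k0); generalize dependent (ellE k0); intros E HE K HK; unfold k0.
  repeat split; lra.
Qed.

(** In this form [a_star] is visibly the solution of [L0 * a^2 * C2 = 4 * PI], the constraint on the
    integral of u^2. *)
Lemma a_star_eq : a_star = sqrt (2 * PI / (ellK k0 * C2)).
Proof.
  unfold a_star; f_equal.
  pose proof ellK_ellE_bounds as [HK HE]; pose proof moment_bounds as [H2 _].
  replace (ellK k0 ^ 2 - 1 / k0 ^ 2 * (ellK k0 ^ 2 - ellE k0 * ellK k0)) with (ellK k0 * C2 / 2)
    by (unfold C2; field; unfold k0; lra).
  field; split; lra.
Qed.

Lemma a_star_sq : a_star ^ 2 = 2 * PI / (ellK k0 * C2).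
Proof.
  pose proof ellK_ellE_bounds as [HK HE]; pose proof moment_bounds as [H2 _]; pose proof PI_RGT_0.
  rewrite a_star_eq, pow2_sqrt; auto.
  apply Rcomplements.Rdiv_le_0_compat; [lra|].
  apply Rmult_lt_0_compat; lra.
Qed.

Lemma a_star_sq_bounds : 1994697949760 / 10 ^ 12 < a_star ^ 2 < 1994697949885 / 10 ^ 12.
Proof.
  rewrite a_star_sq.
  pose proof ellK_ellE_bounds as [HK HE]; pose proof moment_bounds as [H2 _]; pose proof PI_bounds.
  destruct (Rmult_itv (ellK k0) C2 (1857563922581 / 10 ^ 12) (1857563922584 / 10 ^ 12)
    (1695738808120 / 10 ^ 12) (1695738808165 / 10 ^ 12)) as [H3 H4]; try lra.
  split; [apply (Rcomplements.Rlt_div_r (1994697949760 / 10 ^ 12))|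
    apply Rcomplements.Rlt_div_l]; lra.
Qed.

Lemma a_star_bounds : 141233776 / 10 ^ 8 < a_star < 141233777 / 10 ^ 8.
Proof.
  pose proof a_star_sq_bounds.
  assert (0 <= a_star) by (rewrite a_star_eq; apply sqrt_pos).
  split; apply Rnot_le_lt; intros Hc; nra.
Qed.

Lemma lhs_star_bounds :
  307904 / 10 ^ 8 <= a_star ^ 2 * lhs_over (a_star ^ 2) < 307905 / 10 ^ 8.
Proof.
  pose proof a_star_sq_bounds as HA; set (A := a_star ^ 2) in *; clearbody A.
  pose proof ellK_ellE_bounds as [HK _]; pose proof moment_bounds as (H2 & H4 & H6 & HD).
  unfold lhs_over; set (K := ellK k0) in *; clearbody K.
  generalize dependent C2; generalize dependent C4; generalize dependent C6; generalize dependent D22.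
  intros D HD c6 H6 c4 H4 c2 H2; unfold k0.
  (* The coefficient of cn^3 is negative here; its opposite [B] is used because [Rmult_itv] needs
     nonnegative bounds. *)
  assert (HB : 10851025055 / 10 ^ 12 <= 2 * (71 / 100) ^ 2 - A / 2 <= 10851025125 / 10 ^ 12) by lra.
  set (B := 2 * (71 / 100) ^ 2 - A / 2) in *.
  replace (A / 2 - 2 * (71 / 100) ^ 2) with (- B) by (unfold B; ring); clearbody B.
  destruct (Rmult_itv c2 D (1695738808120 / 10 ^ 12) (1695738808165 / 10 ^ 12)
    (1232856284970 / 10 ^ 12) (1232856285070 / 10 ^ 12)) as [P1 P1']; try lra.
  destruct (Rmult_itv c2 c4 (1695738808120 / 10 ^ 12) (1695738808165 / 10 ^ 12)
    (1236621050602 / 10 ^ 12) (1236621050662 / 10 ^ 12)) as [P2 P2']; try lra.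
  set (c2D := c2 * D) in *; set (c2c4 := c2 * c4) in *.
  destruct (Rmult_itv A c2D (1994697949760 / 10 ^ 12) (1994697949885 / 10 ^ 12)
    (2090602247230 / 10 ^ 12) (2090602247510 / 10 ^ 12)) as [P3 P3']; try lra.
  destruct (Rmult_itv A A (1994697949760 / 10 ^ 12) (1994697949885 / 10 ^ 12)
    (1994697949760 / 10 ^ 12) (1994697949885 / 10 ^ 12)) as [P4 P4']; try lra.
  destruct (Rmult_itv (A * A) c2c4 (3978819910765 / 10 ^ 12) (3978819911285 / 10 ^ 12)
    (2096986306435 / 10 ^ 12) (2096986306610 / 10 ^ 12)) as [P5 P5']; try lra.
  destruct (Rmult_itv B c4 (10851025055 / 10 ^ 12) (10851025125 / 10 ^ 12)
    (1236621050602 / 10 ^ 12) (1236621050662 / 10 ^ 12)) as [P6 P6']; try lra.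
  destruct (Rmult_itv B B (10851025055 / 10 ^ 12) (10851025125 / 10 ^ 12)
    (10851025055 / 10 ^ 12) (10851025125 / 10 ^ 12)) as [P7 P7']; try lra.
  destruct (Rmult_itv (B * B) c6 (1177447440 / 10 ^ 13) (1177447470 / 10 ^ 13)
    (1016985437495 / 10 ^ 12) (1016985437595 / 10 ^ 12)) as [P8 P8']; try lra.
  (* The integral of (u'' + u^3/2)^2 divided by a^2: three terms of order 10^(-4) that cancel to
     about 1.37 * 10^(-5). *)
  set (Q := (2 * (71 / 100) ^ 2 - 1) ^ 2 * c2 - 2 * (2 * (71 / 100) ^ 2 - 1) * (B * c4) + B * B * c6).
  assert (HQ : 13701020 / 10 ^ 12 <= Q <= 13701040 / 10 ^ 12) by (unfold Q; lra).
  destruct (Rmult_itv K Q (1857563922581 / 10 ^ 12) (1857563922584 / 10 ^ 12)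
    (13701020 / 10 ^ 12) (13701040 / 10 ^ 12)) as [P9 P9']; try lra.
  match goal with |- _ <= _ * ?g < _ => set (G := g) end.
  assert (HG : 1543614 / 10 ^ 9 <= G <= 1543617 / 10 ^ 9).
  { replace G with (- (A * c2D) + A * A * c2c4 / 2 - 4 * (K * Q))
      by (unfold G, Q, c2D, c2c4; field).
    lra. }
  destruct (Rmult_itv A G (1994697949760 / 10 ^ 12) (1994697949885 / 10 ^ 12)
    (1543614 / 10 ^ 9) (1543617 / 10 ^ 9)) as [P10 P10']; lra.
Qed.

(* The quadratic [lhs_over] is increasing between the two points: its difference
   quotient is bounded below by a positive number. *)
Lemma lhs_trunc_pos (a : R) : a_star - 1 / 10 ^ 4 <= a -> a <= a_star ->
  0 < a ^ 2 * lhs_over (a ^ 2).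
Proof.
  intros Ha1 Ha2; pose proof a_star_bounds as Hs.
  apply Rmult_lt_0_compat; [nra|].
  assert (HA : 199441549 / 10 ^ 8 <= a ^ 2 <= 19947 / 10 ^ 4) by nra.
  set (A := a ^ 2) in *; clearbody A.
  pose proof ellK_ellE_bounds as [HK _]; pose proof moment_bounds as (H2 & H4 & H6 & HD).
  unfold lhs_over; set (K := ellK k0) in *; clearbody K.
  generalize dependent C2; generalize dependent C4; generalize dependent C6; generalize dependent D22.
  intros D HD c6 H6 c4 H4 c2 H2; unfold k0.
  destruct (Rmult_itv c2 D (1695738808120 / 10 ^ 12) (1695738808165 / 10 ^ 12)
    (1232856284970 / 10 ^ 12) (1232856285070 / 10 ^ 12)) as [P1 P1']; try lra.
  destruct (Rmult_itv c2 c4 (1695738808120 / 10 ^ 12) (1695738808165 / 10 ^ 12)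
    (1236621050602 / 10 ^ 12) (1236621050662 / 10 ^ 12)) as [P2 P2']; try lra.
  set (c2D := c2 * D) in *; set (c2c4 := c2 * c4) in *.
  (* [A1] lies just below (a_star - 10^(-4))^2, the least value of A to be covered. The quadratic is
     expanded as its value at [A1] plus (A - A1) times [slope]. *)
  pose (A1 := 199441549 / 10 ^ 8).
  pose (Q1 := (2 * (71 / 100) ^ 2 - 1) ^ 2 * c2 + 2 * (2 * (71 / 100) ^ 2 - 1) * (A1 / 2 - 2 * (71 / 100) ^ 2) * c4
      + (A1 / 2 - 2 * (71 / 100) ^ 2) ^ 2 * c6).
  pose (slope := - c2D + (A + A1) * c2c4 / 2
    - 4 * K * ((2 * (71 / 100) ^ 2 - 1) * c4 + (A / 4 + A1 / 4 - 2 * (71 / 100) ^ 2) * c6)).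
  replace (c2 * _ - _) with
    (- A1 * c2D + A1 ^ 2 * c2c4 / 2 - 4 * (K * Q1) + (A - A1) * slope)
    by (unfold slope, Q1, c2D, c2c4; field).
  destruct (Rmult_itv K Q1 (1857563922581 / 10 ^ 12) (1857563922584 / 10 ^ 12)
    (13 / 10 ^ 6) (14 / 10 ^ 6)) as [P9 P9']; try lra.
  { unfold Q1, A1; lra. }
  assert (Hsl : 0 < slope).
  { set (B := - (A / 4 + A1 / 4 - 2 * (71 / 100) ^ 2)).
    assert (HB : 0 <= B <= 12 / 10 ^ 3) by (unfold B, A1; lra).
    destruct (Rmult_itv (A + A1) c2c4 (398 / 100) (399 / 100) (2096 / 1000) (2097 / 1000)) as [P3 P3'];
      try (unfold A1; lra).
    destruct (Rmult_itv B c6 0 (12 / 10 ^ 3) 1 2) as [P4 P4']; try lra.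
    destruct (Rmult_itv K ((2 * (71 / 100) ^ 2 - 1) * c4) 1 2 (1 / 100) (2 / 100)) as [P5 P5']; try lra.
    destruct (Rmult_itv K (B * c6) 1 2 0 (24 / 1000)) as [P6 P6']; try lra.
    replace slope with (- c2D + (A + A1) * c2c4 / 2 - 4 * (K * ((2 * (71 / 100) ^ 2 - 1) * c4))
       + 4 * (K * (B * c6))) by (unfold slope, B; field).
    lra. }
  assert (0 <= (A - A1) * slope) by (apply Rmult_le_pos; [unfold A1|]; lra).
  enough (0 < - A1 * c2D + A1 ^ 2 * c2c4 / 2 - 4 * (K * Q1)) by lra.
  unfold A1; lra.
Qed.

Lemma four_E_sub_two_K_pos : 0 < 4 * ellE k0 - 2 * ellK k0.
Proof. pose proof ellK_ellE_bounds; lra. Qed.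

(** * Jacobi elliptic functions *)

Definition delta (k t : R) : R := sqrt (1 - k ^ 2 * sin t ^ 2).

Lemma delta_radicand (k t : R) : k ^ 2 < 1 -> 0 < 1 - k ^ 2 * sin t ^ 2 <= 1.
Proof.
  intros Hk; pose proof (sin2_cos2 t) as H; unfold Rsqr in H; pose proof (pow2_ge_0 (cos t)); nra.
Qed.

Lemma delta_sq (k t : R) : k ^ 2 < 1 -> delta k t ^ 2 = 1 - k ^ 2 * sin t ^ 2.
Proof. intros Hk; apply pow2_sqrt; pose proof (delta_radicand k t Hk); lra. Qed.

Lemma delta_pos (k t : R) : k ^ 2 < 1 -> 0 < delta k t.
Proof. intros Hk; apply sqrt_lt_R0; pose proof (delta_radicand k t Hk); lra. Qed.

Lemma delta_le_1 (k t : R) : k ^ 2 < 1 -> delta k t <= 1.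
Proof.
  intros Hk; rewrite <- sqrt_1; apply sqrt_le_1; pose proof (delta_radicand k t Hk); lra.
Qed.

Lemma is_derive_delta (k t : R) : k ^ 2 < 1 ->
  is_derive (delta k) t (- k ^ 2 * sin t * cos t / delta k t).
Proof.
  intros Hk; pose proof (delta_radicand k t Hk); pose proof (delta_pos k t Hk) as Hd.
  unfold delta in *; auto_derive; [lra|].
  replace (1 + - (k * (k * 1) * (sin t * (sin t * 1)))) with (1 - k ^ 2 * sin t ^ 2) by ring.
  field; lra.
Qed.

Lemma continuous_delta (k t : R) : k ^ 2 < 1 -> continuous (delta k) t.
Proof. intros Hk; apply (ex_derive_continuous (delta k)); eexists; now apply is_derive_delta. Qed.

Lemma continuous_inv_delta (k t : R) : k ^ 2 < 1 -> continuous (fun t => / delta k t) t.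
Proof.
  intros Hk; apply (ex_derive_continuous (fun t => / delta k t)); eexists.
  apply is_derive_inv; [now apply is_derive_delta|apply Rgt_not_eq, delta_pos, Hk].
Qed.

Lemma is_derive_ellF (k t : R) : k ^ 2 < 1 -> is_derive (fun t => ellF t k) t (/ delta k t).
Proof.
  intros Hk; apply (is_derive_RInt (V := R_NormedModule) (fun t => / delta k t) (fun t => ellF t k) 0).
  - exists (mkposreal 1 Rlt_0_1); intros y _.
    apply (RInt_correct (V := R_CompleteNormedModule)).
    apply (ex_RInt_continuous (V := R_CompleteNormedModule)); intros; now apply continuous_inv_delta.
  - now apply continuous_inv_delta.
Qed.

Lemma ellF_0 (k : R) : ellF 0 k = 0.
Proof. apply (RInt_point (V := R_CompleteNormedModule)). Qed.

(** The integrand is at least 1. This inequality gives injectivity and surjectivity of [ellF], and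
    then the Lipschitz bound for [AM]. *)
Lemma ellF_expanding (k x y : R) : k ^ 2 < 1 -> x <= y -> y - x <= ellF y k - ellF x k.
Proof.
  intros Hk Hxy.
  destruct (MVT_gen (fun t => ellF t k) x y (fun t => / delta k t)) as [c [_ ->]].
  - intros; now apply is_derive_ellF.
  - intros t _; apply continuity_pt_filterlim.
    apply (ex_derive_continuous (fun t => ellF t k)); eexists; now apply is_derive_ellF.
  - rewrite <- (Rmult_1_l (y - x)) at 1; apply Rmult_le_compat_r; [lra|].
    rewrite <- Rinv_1; apply Rinv_le_contravar; [now apply delta_pos|now apply delta_le_1].
Qed.

Lemma ellF_inj (k x y : R) : k ^ 2 < 1 -> ellF x k = ellF y k -> x = y.
Proof.
  intros Hk H; destruct (Rle_dec x y) as [Hxy|Hxy].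
  - pose proof (ellF_expanding k x y Hk Hxy); lra.
  - pose proof (ellF_expanding k y x Hk); lra.
Qed.

Lemma ellF_surj (k s : R) : k ^ 2 < 1 -> exists t, ellF t k = s.
Proof.
  intros Hk; pose proof (Rabs_pos s) as Hs; pose proof (Rle_abs s) as Hs'; pose proof (Rle_abs (- s)) as Hs2.
  rewrite Rabs_Ropp in Hs2.
  destruct (IVT_gen (fun t => ellF t k) (- Rabs s) (Rabs s) s) as [t [_ Ht]]; [| |now exists t].
  - intros t; apply continuity_pt_filterlim.
    apply (ex_derive_continuous (fun t => ellF t k)); eexists; now apply is_derive_ellF.
  - pose proof (ellF_expanding k 0 (Rabs s) Hk Hs) as H1.
    pose proof (ellF_expanding k (- Rabs s) 0 Hk) as H2.
    rewrite ellF_0 in H1, H2; rewrite Rmin_left, Rmax_right; lra.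
Qed.

(** The description operator is determined up to [close], which on R is equality; uniqueness of the
    solution is injectivity of [ellF]. *)
Lemma AM_spec (k s t : R) : k ^ 2 < 1 -> ellF t k = s -> AM s k = t.
Proof.
  intros Hk Ht; unfold AM.
  apply (eq_close (iota (T := R_CompleteSpace) _)).
  apply (iota_correct_weak (T := R_CompleteSpace) (fun phi => ellF phi k = s)); auto.
  intros x y Hx Hy; replace y with x; [apply close_refl|].
  apply (ellF_inj k); auto; congruence.
Qed.

Lemma AM_ellF (k t : R) : k ^ 2 < 1 -> AM (ellF t k) k = t.
Proof. intros Hk; now apply AM_spec. Qed.

Lemma ellF_AM (k s : R) : k ^ 2 < 1 -> ellF (AM s k) k = s.
Proof. intros Hk; destruct (ellF_surj k s Hk) as [t Ht]; now rewrite (AM_spec k s t). Qed.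

(* [AM] is 1-Lipschitz because [ellF] is expanding, so the increments e of [AM] and h of s
   satisfy |e| <= |h| and 1 <= h/e; this inverts the derivative of [ellF]. *)
Lemma is_derive_AM (k s : R) : k ^ 2 < 1 -> is_derive (fun s => AM s k) s (delta k (AM s k)).
Proof.
  intros Hk; apply is_derive_Reals; intros eps Heps.
  pose proof (is_derive_ellF k (AM s k) Hk) as HF; apply is_derive_Reals in HF.
  destruct (HF eps Heps) as [d Hd].
  exists d; intros h Hh Hhd; set (p := AM s k) in *.
  set (e := AM (s + h) k - p).
  assert (Hp : ellF p k = s) by now apply ellF_AM.
  assert (Hpe : ellF (p + e) k = s + h).
  { unfold e; replace (p + (AM (s + h) k - p)) with (AM (s + h) k) by ring; now apply ellF_AM. }
  assert (He0 : e <> 0) by (intros E; rewrite E, Rplus_0_r in Hpe; lra).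
  assert (Hy : 1 <= h / e /\ Rabs e <= Rabs h).
  { destruct (Rle_dec 0 e).
    - pose proof (ellF_expanding k p (p + e) Hk) as H.
      split; [apply Rcomplements.Rle_div_r|rewrite !Rabs_pos_eq]; lra.
    - pose proof (ellF_expanding k (p + e) p Hk) as H.
      split; [|rewrite !Rabs_left1; lra].
      replace (h / e) with (- h / - e) by (field; lra); apply Rcomplements.Rle_div_r; lra. }
  destruct Hy as [Hy Heh].
  specialize (Hd e He0 ltac:(lra)); rewrite Hpe, Hp in Hd.
  replace (s + h - s) with h in Hd by ring.
  fold e; pose proof (delta_pos k p Hk) as Dp; pose proof (delta_le_1 k p Hk) as D1.
  (* The prefactor has absolute value at most 1, since delta <= 1 <= h/e, so the error of the
     difference quotient of [ellF] controls that of [AM]. *)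
  replace (e / h - delta k p) with (- (delta k p / (h / e)) * (h / e - / delta k p))
    by (field; repeat split; lra).
  rewrite Rabs_mult, Rabs_Ropp, (Rabs_pos_eq (_ / _)) by (apply Rcomplements.Rdiv_le_0_compat; lra).
  apply Rle_lt_trans with (1 * Rabs (h / e - / delta k p)); [|lra].
  apply Rmult_le_compat_r; [apply Rabs_pos|].
  apply Rcomplements.Rle_div_l; lra.
Qed.

Definition sn (s k : R) : R := sin (AM s k).
Definition dn (s k : R) : R := delta k (AM s k).

Lemma sn_sq (s k : R) : sn s k ^ 2 = 1 - cn s k ^ 2.
Proof. unfold sn, cn; pose proof (sin2_cos2 (AM s k)) as H; unfold Rsqr in H; nra. Qed.

Lemma dn_sq (s k : R) : k ^ 2 < 1 -> dn s k ^ 2 = 1 - k ^ 2 + k ^ 2 * cn s k ^ 2.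
Proof. intros Hk; unfold dn; rewrite delta_sq by auto; fold (sn s k); rewrite sn_sq; ring. Qed.

Lemma dn_pos (s k : R) : k ^ 2 < 1 -> 0 < dn s k.
Proof. intros Hk; now apply delta_pos. Qed.

Lemma is_derive_sn (s k : R) : k ^ 2 < 1 -> is_derive (fun s => sn s k) s (cn s k * dn s k).
Proof.
  intros Hk; evar_last.
  - apply (is_derive_comp sin (fun s => AM s k)); [apply is_derive_sin|now apply is_derive_AM].
  - unfold scal; simpl; unfold mult; simpl; unfold cn, dn; ring.
Qed.

Lemma is_derive_cn (s k : R) : k ^ 2 < 1 -> is_derive (fun s => cn s k) s (- sn s k * dn s k).
Proof.
  intros Hk; evar_last.
  - apply (is_derive_comp cos (fun s => AM s k)); [apply is_derive_cos|now apply is_derive_AM].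
  - unfold scal; simpl; unfold mult; simpl; unfold sn, dn; ring.
Qed.

Lemma is_derive_dn (s k : R) : k ^ 2 < 1 -> is_derive (fun s => dn s k) s (- k ^ 2 * sn s k * cn s k).
Proof.
  intros Hk; evar_last.
  - apply (is_derive_comp (delta k) (fun s => AM s k)); [now apply is_derive_delta|now apply is_derive_AM].
  - unfold scal; simpl; unfold mult; simpl; unfold sn, cn, dn; field.
    apply Rgt_not_eq; now apply delta_pos.
Qed.

Lemma RInt_sym_PI (f : R -> R) : (forall t, continuous f t) -> (forall t, f (PI - t) = f t) ->
  RInt f 0 PI = 2 * RInt f 0 (PI / 2).
Proof.
  intros Hc Hs.
  assert (Hi : forall a b, ex_RInt f a b)
    by (intros; apply (ex_RInt_continuous (V := R_CompleteNormedModule)); auto).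
  rewrite <- (RInt_Chasles (V := R_CompleteNormedModule) f 0 (PI / 2) PI) by auto.
  assert (H : RInt f (PI / 2) PI = RInt f 0 (PI / 2)).
  { rewrite <- (opp_RInt_swap (V := R_CompleteNormedModule)) by auto.
    replace PI with ((-1) * 0 + PI) at 1 by ring.
    replace (PI / 2) with ((-1) * (PI / 2) + PI) at 1 by field.
    rewrite <- (RInt_comp_lin (V := R_CompleteNormedModule)) by auto.
    rewrite <- (RInt_opp (V := R_CompleteNormedModule)).
    - apply (RInt_ext (V := R_CompleteNormedModule)); intros t _.
      unfold opp, scal; simpl; unfold mult; simpl.
      replace (-1 * t + PI) with (PI - t) by ring; rewrite Hs; ring.
    - apply (ex_RInt_continuous (V := R_CompleteNormedModule)); intros t _.
      apply (continuous_scal_r (V := R_NormedModule)).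
      apply (continuous_ext f); auto.
      intros x; rewrite <- (Hs x); f_equal; ring. }
  rewrite H; unfold plus; simpl; ring.
Qed.

Lemma delta_PI_sub (k t : R) : delta k (PI - t) = delta k t.
Proof. unfold delta; now rewrite sin_PI_x. Qed.

Lemma ellF_PI (k : R) : k ^ 2 < 1 -> ellF PI k = 2 * ellK k.
Proof.
  intros Hk; apply (RInt_sym_PI (fun t => / delta k t)).
  - intros; now apply continuous_inv_delta.
  - intros; now rewrite delta_PI_sub.
Qed.

Lemma AM_0 (k : R) : k ^ 2 < 1 -> AM 0 k = 0.
Proof. intros Hk; apply AM_spec; auto using ellF_0. Qed.

Lemma AM_2K (k : R) : k ^ 2 < 1 -> AM (2 * ellK k) k = PI.
Proof. intros Hk; apply AM_spec; auto using ellF_PI. Qed.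

(** Substituting s = [ellF t k] turns dn^2 ds into delta dt on [0, pi], and the reflection t -> pi -
    t halves the interval. *)
Lemma is_RInt_dn_sq (k : R) : k ^ 2 < 1 ->
  is_RInt (fun s => dn s k ^ 2) 0 (2 * ellK k) (2 * ellE k).
Proof.
  intros Hk.
  assert (Hc : forall s, continuous (fun s => dn s k ^ 2) s).
  { intros s; apply (ex_derive_continuous (fun s => dn s k ^ 2)); eexists.
    apply (is_derive_pow (fun s => dn s k)); now apply is_derive_dn. }
  assert (E : RInt (fun s => dn s k ^ 2) 0 (2 * ellK k) = 2 * ellE k).
  { rewrite <- (ellF_0 k), <- ellF_PI by auto.
    rewrite <- (RInt_comp (V := R_CompleteNormedModule) _ (fun t => ellF t k) (fun t => / delta k t)).
    - etransitivity; [|apply (RInt_sym_PI (delta k))].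
      + apply (RInt_ext (V := R_CompleteNormedModule)); intros t _.
        unfold scal; simpl; unfold mult; simpl; unfold dn; rewrite AM_ellF by auto.
        field; apply Rgt_not_eq; now apply delta_pos.
      + intros; now apply continuous_delta.
      + intros; apply delta_PI_sub.
    - intros; apply Hc.
    - intros; split; [now apply is_derive_ellF|now apply continuous_inv_delta]. }
  rewrite <- E; apply (RInt_correct (V := R_CompleteNormedModule)).
  apply (ex_RInt_continuous (V := R_CompleteNormedModule)); intros; apply Hc.
Qed.

(** * Integrals of powers of cn and of the elastic operator over a half period *)

Lemma is_RInt_lin (f g : R -> R) (a b x y p q : R) :
  is_RInt f a b x -> is_RInt g a b y ->
  is_RInt (fun t => p * f t + q * g t) a b (p * x + q * y).
Proof.
  intros Hf Hg; apply (is_RInt_plus (V := R_NormedModule)); apply (is_RInt_scal (V := R_NormedModule)); auto.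
Qed.

Lemma is_RInt_one (a b : R) : is_RInt (fun _ => 1) a b (b - a).
Proof.
  evar_last; [apply (is_RInt_const (V := R_NormedModule) a b 1)|].
  unfold scal; simpl; unfold mult; simpl; ring.
Qed.

Lemma is_RInt_congr (f g : R -> R) (a b x y : R) :
  (forall t, f t = g t) -> x = y -> is_RInt f a b x -> is_RInt g a b y.
Proof. intros Hfg <- H; apply (is_RInt_ext (V := R_NormedModule) f); auto. Qed.

Lemma is_RInt_FTC (f df : R -> R) (a b : R) :
  (forall t, is_derive f t (df t)) -> (forall t, ex_derive df t) -> is_RInt df a b (f b - f a).
Proof.
  intros Hf Hdf; apply (is_RInt_derive f df); intros t _; auto.
  apply (ex_derive_continuous df); auto.
Qed.

Lemma k0_sq : k0 ^ 2 < 1.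
Proof. unfold k0; lra. Qed.

Lemma k0_neq_0 : k0 <> 0.
Proof. unfold k0; lra. Qed.

Lemma Derive_sn (s k : R) : k ^ 2 < 1 -> Derive (fun s => sn s k) s = cn s k * dn s k.
Proof. intros Hk; apply is_derive_unique; now apply is_derive_sn. Qed.

Lemma Derive_cn (s k : R) : k ^ 2 < 1 -> Derive (fun s => cn s k) s = - sn s k * dn s k.
Proof. intros Hk; apply is_derive_unique; now apply is_derive_cn. Qed.

Lemma Derive_dn (s k : R) : k ^ 2 < 1 -> Derive (fun s => dn s k) s = - k ^ 2 * sn s k * cn s k.
Proof. intros Hk; apply is_derive_unique; now apply is_derive_dn. Qed.

Ltac jacobi_ex := repeat split;
  lazymatch goal with
  | |- ex_derive (fun s => sn s _) _ => eexists; apply is_derive_sn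
  | |- ex_derive (fun s => cn s _) _ => eexists; apply is_derive_cn
  | |- ex_derive (fun s => dn s _) _ => eexists; apply is_derive_dn
  | |- True => exact I
  | _ => idtac
  end; auto using k0_sq.

Ltac jacobi_derive := auto_derive; [jacobi_ex|
  rewrite ?Derive_sn, ?Derive_cn, ?Derive_dn by auto using k0_sq].

Lemma sn_0 : sn 0 k0 = 0.
Proof. unfold sn; rewrite AM_0 by apply k0_sq; apply sin_0. Qed.

Lemma sn_L0 : sn L0 k0 = 0.
Proof. unfold sn, L0; rewrite AM_2K by apply k0_sq; apply sin_PI. Qed.

Lemma L0_pos : 0 < L0.
Proof. unfold L0; pose proof ellK_ellE_bounds; lra. Qed.

Lemma is_RInt_cn2 : is_RInt (fun s => cn s k0 ^ 2) 0 L0 C2.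
Proof.
  eapply is_RInt_congr; [| |apply (is_RInt_lin _ _ 0 L0 _ _ (/ k0 ^ 2) (- (1 - k0 ^ 2) / k0 ^ 2)
    (is_RInt_dn_sq k0 k0_sq) (is_RInt_one 0 L0))].
  - intros t; cbv beta; rewrite dn_sq by apply k0_sq; field; apply k0_neq_0.
  - unfold C2, L0; field; apply k0_neq_0.
Qed.

Lemma is_RInt_cn4 : is_RInt (fun s => cn s k0 ^ 4) 0 L0 C4.
Proof.
  assert (H : is_RInt (fun s => (cn s k0 ^ 2 - sn s k0 ^ 2) * dn s k0 ^ 2 - k0 ^ 2 * sn s k0 ^ 2 * cn s k0 ^ 2)
    0 L0 0).
  { eapply is_RInt_congr; [| |apply (is_RInt_FTC (fun s => sn s k0 * cn s k0 * dn s k0)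
      (fun s => (cn s k0 ^ 2 - sn s k0 ^ 2) * dn s k0 ^ 2 - k0 ^ 2 * sn s k0 ^ 2 * cn s k0 ^ 2))]; auto.
    - rewrite sn_0, sn_L0; ring.
    - intros t; jacobi_derive; ring.
    - intros t; auto_derive; jacobi_ex. }
  eapply is_RInt_congr; [| |apply (is_RInt_lin _ _ 0 L0 _ _ (/ (3 * k0 ^ 2)) 1 H
    (is_RInt_lin _ _ 0 L0 _ _ (2 * (2 * k0 ^ 2 - 1) / (3 * k0 ^ 2)) ((1 - k0 ^ 2) / (3 * k0 ^ 2)) is_RInt_cn2 (is_RInt_one 0 L0)))].
  - intros t; cbv beta; rewrite sn_sq, dn_sq by apply k0_sq; field; apply k0_neq_0.
  - unfold C4, L0; field; apply k0_neq_0.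
Qed.

Lemma is_RInt_cn6 : is_RInt (fun s => cn s k0 ^ 6) 0 L0 C6.
Proof.
  pose (h := fun s => cn s k0 ^ 4 * dn s k0 ^ 2 - 3 * sn s k0 ^ 2 * cn s k0 ^ 2 * dn s k0 ^ 2
     - k0 ^ 2 * sn s k0 ^ 2 * cn s k0 ^ 4).
  assert (H : is_RInt h 0 L0 0).
  { eapply is_RInt_congr; [| |apply (is_RInt_FTC (fun s => sn s k0 * cn s k0 ^ 3 * dn s k0) h)]; auto.
    - rewrite sn_0, sn_L0; ring.
    - intros t; unfold h; jacobi_derive; ring.
    - intros t; unfold h; auto_derive; jacobi_ex. }
  eapply is_RInt_congr; [| |apply (is_RInt_lin _ _ 0 L0 _ _ (/ (5 * k0 ^ 2)) 1 H
    (is_RInt_lin _ _ 0 L0 _ _ (4 * (2 * k0 ^ 2 - 1) / (5 * k0 ^ 2)) (3 * (1 - k0 ^ 2) / (5 * k0 ^ 2)) is_RInt_cn4 is_RInt_cn2))].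
  - intros t; unfold h; cbv beta; rewrite sn_sq, dn_sq by apply k0_sq; field; apply k0_neq_0.
  - unfold C6, L0; field; apply k0_neq_0.
Qed.

Lemma is_RInt_sn2dn2 : is_RInt (fun s => (sn s k0 * dn s k0) ^ 2) 0 L0 D22.
Proof.
  eapply is_RInt_congr; [| |apply (is_RInt_lin _ _ 0 L0 _ _ 1 (2 * k0 ^ 2 - 1)
    (is_RInt_lin _ _ 0 L0 _ _ (1 - k0 ^ 2) (- k0 ^ 2) (is_RInt_one 0 L0) is_RInt_cn4) is_RInt_cn2)].
  - intros t; cbv beta.
    replace ((sn t k0 * dn t k0) ^ 2) with (sn t k0 ^ 2 * dn t k0 ^ 2) by ring.
    rewrite sn_sq, dn_sq by apply k0_sq; ring.
  - unfold D22, L0; ring.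
Qed.

Lemma is_derive_u_cn (a s : R) : is_derive (u_cn a) s (- a * sn s k0 * dn s k0).
Proof. unfold u_cn; jacobi_derive; ring. Qed.

Lemma is_derive2_u_cn (a s : R) : is_derive (fun s => - a * sn s k0 * dn s k0) s
  (a * ((2 * k0 ^ 2 - 1) * cn s k0 - 2 * k0 ^ 2 * cn s k0 ^ 3)).
Proof.
  jacobi_derive.
  transitivity (- a * cn s k0 * dn s k0 ^ 2 + a * k0 ^ 2 * sn s k0 ^ 2 * cn s k0); [ring|].
  rewrite sn_sq, dn_sq by apply k0_sq; ring.
Qed.

Lemma is_RInt_u2 (a : R) : is_RInt (fun s => u_cn a s ^ 2) 0 L0 (a ^ 2 * C2).
Proof.
  eapply is_RInt_congr; [| |apply (is_RInt_lin _ _ 0 L0 _ _ (a ^ 2) 0 is_RInt_cn2 (is_RInt_one 0 L0))];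
   intros; unfold u_cn; ring.
Qed.

Lemma is_RInt_u4 (a : R) : is_RInt (fun s => u_cn a s ^ 4) 0 L0 (a ^ 4 * C4).
Proof.
  eapply is_RInt_congr; [| |apply (is_RInt_lin _ _ 0 L0 _ _ (a ^ 4) 0 is_RInt_cn4 (is_RInt_one 0 L0))];
   intros; unfold u_cn; ring.
Qed.

Lemma is_RInt_du2 (a : R) : is_RInt (fun s => (- a * sn s k0 * dn s k0) ^ 2) 0 L0 (a ^ 2 * D22).
Proof.
  eapply is_RInt_congr; [| |apply (is_RInt_lin _ _ 0 L0 _ _ (a ^ 2) 0 is_RInt_sn2dn2 (is_RInt_one 0 L0))];
   intros; cbv beta; ring.
Qed.

(** This is u'' + u^3/2 for u = [u_cn a], with the second derivative in closed form. It is the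
    normal speed of the flow up to sign and scaling. *)
Definition elastic_u (a s : R) : R :=
  a * ((2 * k0 ^ 2 - 1) * cn s k0 - 2 * k0 ^ 2 * cn s k0 ^ 3) + 1 / 2 * u_cn a s ^ 3.

Lemma is_RInt_elastic2 (a : R) : is_RInt (fun s => elastic_u a s ^ 2) 0 L0
  (a ^ 2 * ((2 * k0 ^ 2 - 1) ^ 2 * C2
      + 2 * (2 * k0 ^ 2 - 1) * (a ^ 2 / 2 - 2 * k0 ^ 2) * C4 + (a ^ 2 / 2 - 2 * k0 ^ 2) ^ 2 * C6)).
Proof.
  eapply is_RInt_congr; [| |apply (is_RInt_lin _ _ 0 L0 _ _ (a ^ 2) (a ^ 2 * (a ^ 2 / 2 - 2 * k0 ^ 2) ^ 2)
   (is_RInt_lin _ _ 0 L0 _ _ ((2 * k0 ^ 2 - 1) ^ 2) (2 * (2 * k0 ^ 2 - 1) * (a ^ 2 / 2 - 2 * k0 ^ 2)) is_RInt_cn2 is_RInt_cn4)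
   is_RInt_cn6)].
  - intros; unfold elastic_u, u_cn; field.
  - ring.
Qed.

Lemma Derive_u_cn (a s : R) : Derive (u_cn a) s = - a * sn s k0 * dn s k0.
Proof. apply is_derive_unique, is_derive_u_cn. Qed.

Lemma LHS_u_cn (a : R) : LHS L0 (u_cn a) = a ^ 2 * lhs_over (a ^ 2).
Proof.
  unfold LHS, lhs_over.
  rewrite (is_RInt_unique (V := R_CompleteNormedModule) _ _ _ _ (is_RInt_u2 a)), (is_RInt_unique (V := R_CompleteNormedModule) _ _ _ _ (is_RInt_u4 a)).
  rewrite (RInt_ext (V := R_CompleteNormedModule) (fun s => Derive (u_cn a) s ^ 2) (fun s => (- a * sn s k0 * dn s k0) ^ 2))
    by (intros; now rewrite Derive_u_cn).
  rewrite (is_RInt_unique (V := R_CompleteNormedModule) _ _ _ _ (is_RInt_du2 a)).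
  rewrite (RInt_ext (V := R_CompleteNormedModule) (fun s => (Derive_n (u_cn a) 2 s + _) ^ 2) (fun s => elastic_u a s ^ 2)).
  - rewrite (is_RInt_unique (V := R_CompleteNormedModule) _ _ _ _ (is_RInt_elastic2 a)); unfold L0; field.
  - intros s _; f_equal; unfold elastic_u; f_equal; simpl.
    rewrite (Derive_ext _ (fun s => - a * sn s k0 * dn s k0)) by (intros; apply Derive_u_cn).
    apply is_derive_unique, is_derive2_u_cn.
Qed.

(** * The angle function *)

Lemma is_derive_angle (a s : R) : is_derive (angle a) s (u_cn a s).
Proof.
  assert (Hc : forall s, continuous (u_cn a) s)
    by (intros; apply (ex_derive_continuous (u_cn a)); eexists; apply is_derive_u_cn).
  apply (is_derive_RInt (V := R_NormedModule) (u_cn a) (angle a) 0); auto.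
  exists (mkposreal 1 Rlt_0_1); intros y _.
  apply (RInt_correct (V := R_CompleteNormedModule)), (ex_RInt_continuous (V := R_CompleteNormedModule)); auto.
Qed.

(** As dn^2 + k^2 sn^2 = 1, the arctangent equals asin (k sn). It is smooth on the whole line, so dn
    > 0 is the only condition met when differentiating. *)
Lemma angle_eq (a s : R) : angle a s = a / k0 * atan (k0 * sn s k0 / dn s k0).
Proof.
  apply (is_RInt_unique (V := R_CompleteNormedModule)).
  eapply is_RInt_congr; [| |apply (is_RInt_FTC (fun s => a / k0 * atan (k0 * sn s k0 / dn s k0)) (u_cn a))].
  - reflexivity.
  - rewrite sn_0; unfold Rdiv; rewrite Rmult_0_r, Rmult_0_l, atan_0; ring.
  - intros t; pose proof (dn_pos t k0 k0_sq) as Hd; unfold u_cn; jacobi_derive; [lra|].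
    pose proof (sn_sq t k0) as Hs; pose proof (dn_sq t k0 k0_sq) as Hd2.
    replace (1 + k0 * sn t k0 * / dn t k0 * (k0 * sn t k0 * / dn t k0 * 1)) with (/ dn t k0 ^ 2).
    + transitivity (a * cn t k0 * (dn t k0 ^ 2 + k0 ^ 2 * sn t k0 ^ 2)).
      * field; pose proof k0_neq_0; repeat split; auto; lra.
      * rewrite Hs, Hd2; ring.
    + transitivity ((dn t k0 ^ 2 + k0 ^ 2 * sn t k0 ^ 2) / dn t k0 ^ 2); [|field; lra].
      rewrite Hs, Hd2; unfold Rdiv; rewrite <- (Rmult_1_l (/ _)) at 1; f_equal; ring.
  - intros t; eexists; apply is_derive_u_cn.
Qed.

Lemma angle_0 (a : R) : angle a 0 = 0.
Proof. apply (RInt_point (V := R_CompleteNormedModule)). Qed.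

Lemma angle_L0 (a : R) : angle a L0 = 0.
Proof. rewrite angle_eq, sn_L0; unfold Rdiv; rewrite !Rmult_0_r, Rmult_0_l, atan_0; ring. Qed.

(* For a <= 2 k0 the angle is dominated by 2 asin (k sn), whose cosine is 1 - 2 k^2 sn^2. *)
Lemma cos_angle_ge (a s : R) : 0 <= a <= 2 * k0 -> 2 * dn s k0 ^ 2 - 1 <= cos (angle a s).
Proof.
  intros Ha; rewrite angle_eq.
  pose proof (dn_pos s k0 k0_sq) as Hd.
  set (y := k0 * sn s k0 / dn s k0).
  assert (Hc : cos (2 * Rabs (atan y)) = 2 * dn s k0 ^ 2 - 1).
  { rewrite cos_2a_cos.
    assert (E : cos (Rabs (atan y)) = dn s k0).
    { replace (cos (Rabs (atan y))) with (cos (atan y))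
        by (unfold Rabs; destruct (Rcase_abs (atan y)); [now rewrite cos_neg|reflexivity]).
      rewrite cos_atan.
      replace (1 + y²) with (/ dn s k0 ^ 2).
      - rewrite sqrt_inv, sqrt_pow2 by lra; field; lra.
      - unfold y, Rsqr; pose proof (sn_sq s k0) as Hs; pose proof (dn_sq s k0 k0_sq) as Hd2.
        transitivity ((dn s k0 ^ 2 + k0 ^ 2 * sn s k0 ^ 2) / dn s k0 ^ 2); [|field; lra].
        rewrite Hs, Hd2; unfold Rdiv; rewrite <- (Rmult_1_l (/ _)) at 1; f_equal; ring. }
    rewrite E; ring. }
  rewrite <- Hc.
  assert (Hk : 0 < k0) by (unfold k0; lra).
  assert (Hr : 0 <= a / k0 <= 2).
  { split; [apply Rcomplements.Rdiv_le_0_compat; lra|apply Rcomplements.Rle_div_l; lra]. }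
  replace (cos (a / k0 * atan y)) with (cos (a / k0 * Rabs (atan y))).
  2:{ unfold Rabs; destruct (Rcase_abs (atan y)); [|reflexivity].
      rewrite <- cos_neg; f_equal; ring. }
  pose proof (Rabs_pos (atan y)).
  assert (Hb : Rabs (atan y) <= PI / 2) by (pose proof (atan_bound y); apply Rabs_le; lra).
  pose proof PI_RGT_0.
  (* The cosine decreases on [0, pi], which contains both angles because 2 |atan y| <= pi and a/k <=
     2. *)
  apply cos_decr_1; try nra.
Qed.

Lemma is_derive_cos_angle (a s : R) : is_derive (fun s => cos (angle a s)) s (- u_cn a s * sin (angle a s)).
Proof.
  evar_last.
  - apply (is_derive_comp cos (angle a)); [apply is_derive_cos|apply is_derive_angle].
  - unfold scal; simpl; unfold mult; simpl; ring.
Qed.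

Lemma is_derive_sin_angle (a s : R) : is_derive (fun s => sin (angle a s)) s (u_cn a s * cos (angle a s)).
Proof.
  evar_last.
  - apply (is_derive_comp sin (angle a)); [apply is_derive_sin|apply is_derive_angle].
  - reflexivity.
Qed.

(** This makes the scaling factor of [gamma_c] positive. The range a <= 2 k0 = 1.42 contains
    [a_star] and its truncations. *)
Lemma gamma_tilde_end_pos (a : R) : 0 <= a <= 2 * k0 -> 0 < fst (gamma_tilde a L0).
Proof.
  intros Ha; unfold gamma_tilde; simpl.
  assert (H : is_RInt (fun s => 2 * dn s k0 ^ 2 + -1 * 1) 0 L0 (2 * (2 * ellE k0) + -1 * (L0 - 0)))
    by apply (is_RInt_lin _ _ 0 L0 _ _ 2 (-1) (is_RInt_dn_sq k0 k0_sq) (is_RInt_one 0 L0)).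
  apply Rlt_le_trans with (RInt (fun s => 2 * dn s k0 ^ 2 + -1 * 1) 0 L0).
  - rewrite (is_RInt_unique (V := R_CompleteNormedModule) _ _ _ _ H); unfold L0.
    pose proof four_E_sub_two_K_pos; lra.
  - apply RInt_le.
    + left; apply L0_pos.
    + now exists (2 * (2 * ellE k0) + -1 * (L0 - 0)).
    + apply (ex_RInt_continuous (V := R_CompleteNormedModule)); intros t _.
      apply (ex_derive_continuous (fun t => cos (angle a t))); eexists; apply is_derive_cos_angle.
    + intros t _; pose proof (cos_angle_ge a t Ha); lra.
Qed.

(** * Relative derivatives *)

(** No point of [D] is isolated: exactly what makes derivatives relative to [D] unique, so that
    [derive_in] is not an arbitrary choice. *)
Definition perfect (D : R -> Prop) : Prop := forall x, D x -> adhDa (D_x D x) x.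

Lemma perfect_Icc (a b : R) : a < b -> perfect (Icc a b).
Proof.
  intros Hab x Hx e He.
  destruct (Rlt_dec x b) as [H|H].
  - exists (x + Rmin (e / 2) (b - x)).
    assert (0 < Rmin (e / 2) (b - x)) by (apply Rmin_glb_lt; lra).
    pose proof (Rmin_l (e / 2) (b - x)); pose proof (Rmin_r (e / 2) (b - x)).
    unfold D_x, Icc in *; unfold Rdist; repeat split; try lra.
    rewrite Rabs_pos_eq; lra.
  - exists (x - Rmin (e / 2) (x - a)).
    unfold Icc in Hx.
    assert (0 < Rmin (e / 2) (x - a)) by (apply Rmin_glb_lt; lra).
    pose proof (Rmin_l (e / 2) (x - a)); pose proof (Rmin_r (e / 2) (x - a)).
    unfold D_x, Icc in *; unfold Rdist; repeat split; try lra.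
    rewrite Rabs_left; lra.
Qed.

Lemma perfect_I11 : perfect I11.
Proof. apply perfect_Icc; lra. Qed.

Lemma perfect_time_dom (T : Rbar) : Rbar_lt 0 T -> perfect (time_dom T).
Proof.
  intros HT t [Ht0 HtT] e He.
  assert (H : exists d, 0 < d /\ Rbar_lt (t + d) T /\ d < e).
  { destruct T as [T| |]; simpl in *; try contradiction.
    - exists (Rmin (e / 2) ((T - t) / 2)).
      assert (0 < Rmin (e / 2) ((T - t) / 2)) by (apply Rmin_glb_lt; lra).
      pose proof (Rmin_l (e / 2) ((T - t) / 2)); pose proof (Rmin_r (e / 2) ((T - t) / 2)); lra.
    - exists (e / 2); repeat split; lra. }
  destruct H as (d & Hd & HdT & Hde); exists (t + d); unfold D_x, time_dom, Rdist.
  repeat split; try lra; auto.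
  replace (t + d - t) with d by ring; rewrite Rabs_pos_eq; lra.
Qed.

Lemma is_derive_in_ext (D : R -> Prop) (f g : R -> R) (x l : R) :
  D x -> (forall y, D y -> f y = g y) -> is_derive_in D f x l -> is_derive_in D g x l.
Proof.
  intros Hx Hfg H e He; destruct (H e He) as (a & Ha & Hd); exists a; split; auto.
  intros y Hy; specialize (Hd y Hy); destruct Hy as [[HyD _] _].
  rewrite <- !Hfg; auto.
Qed.

Lemma derive_in_ext (D : R -> Prop) (f g : R -> R) (x : R) :
  D x -> (forall y, D y -> f y = g y) -> derive_in D f x = derive_in D g x.
Proof.
  intros Hx Hfg; unfold derive_in.
  apply (eq_close (iota (T := R_CompleteSpace) _)).
  apply (close_iota (T := R_CompleteSpace)); intros l; split; apply is_derive_in_ext; auto.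
  intros; symmetry; auto.
Qed.

Lemma derive_n_in_ext (D : R -> Prop) (f g : R -> R) (n : nat) (x : R) :
  D x -> (forall y, D y -> f y = g y) -> derive_n_in D f n x = derive_n_in D g n x.
Proof.
  intros Hx Hfg; revert x Hx; induction n as [|n IH]; intros x Hx; simpl; auto.
  now apply derive_in_ext.
Qed.

Lemma is_derive_in_unique (D : R -> Prop) (f : R -> R) (x l l' : R) :
  adhDa (D_x D x) x -> is_derive_in D f x l -> is_derive_in D f x l' -> l = l'.
Proof.
  intros Hx H H'; unfold is_derive_in, D_in in H, H'.
  eapply single_limit; [exact Hx|exact H|exact H'].
Qed.

Lemma derive_in_eq (D : R -> Prop) (f : R -> R) (x l : R) :
  perfect D -> D x -> is_derive_in D f x l -> derive_in D f x = l.
Proof.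
  intros HD Hx H; unfold derive_in.
  apply (eq_close (iota (T := R_CompleteSpace) _)).
  apply (iota_correct_weak (T := R_CompleteSpace) (is_derive_in D f x)); auto.
  intros y z Hy Hz; replace z with y; [apply close_refl|].
  eapply is_derive_in_unique; eauto.
Qed.

Lemma derive_in_correct (D : R -> Prop) (f : R -> R) (x : R) :
  perfect D -> D x -> ex_derive_in D f x -> is_derive_in D f x (derive_in D f x).
Proof. intros HD Hx [l Hl]; now rewrite (derive_in_eq D f x l). Qed.

Lemma is_derive_in_of_is_derive (D : R -> Prop) (f : R -> R) (x l : R) :
  is_derive f x l -> is_derive_in D f x l.
Proof.
  intros H; apply is_derive_Reals in H.
  apply (derivable_pt_lim_D_in f (fun _ => l) x) in H.
  now apply (D_in_imp f (fun _ => l) no_cond D).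
Qed.

Lemma is_derive_of_is_derive_in (D : R -> Prop) (f : R -> R) (x l : R) :
  locally x D -> is_derive_in D f x l -> is_derive f x l.
Proof.
  intros [d Hd] H; apply is_derive_Reals; apply (derivable_pt_lim_D_in f (fun _ => l) x).
  intros e He; destruct (H e He) as (a & Ha & H').
  exists (Rmin a d); split; [apply Rmin_glb_lt; [exact Ha|apply cond_pos]|].
  intros y [[_ Hyx] Hy]; apply H'.
  change (Rdist y x < Rmin a d) in Hy; pose proof (Rmin_l a d); pose proof (Rmin_r a d).
  split; [split; [apply Hd|exact Hyx]|].
  - change (Rdist y x < d); lra.
  - change (Rdist y x < a); lra.
Qed.

Lemma is_derive_in_const (D : R -> Prop) (c x : R) : is_derive_in D (fun _ => c) x 0.
Proof. apply (Dconst D c x). Qed.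

Lemma is_derive_in_plus (D : R -> Prop) (f g : R -> R) (x lf lg : R) :
  is_derive_in D f x lf -> is_derive_in D g x lg -> is_derive_in D (fun y => f y + g y) x (lf + lg).
Proof. apply (Dadd D (fun _ => lf) (fun _ => lg) f g x). Qed.

Lemma is_derive_in_mult (D : R -> Prop) (f g : R -> R) (x lf lg : R) :
  is_derive_in D f x lf -> is_derive_in D g x lg ->
  is_derive_in D (fun y => f y * g y) x (lf * g x + f x * lg).
Proof. apply (Dmult D (fun _ => lf) (fun _ => lg) f g x). Qed.

Lemma is_derive_in_comp (D : R -> Prop) (f h : R -> R) (x l m : R) :
  is_derive_in D f x l -> is_derive h (f x) m -> is_derive_in D (fun y => h (f y)) x (l * m).
Proof.
  intros Hf Hh; apply is_derive_Reals in Hh.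
  apply (derivable_pt_lim_D_in h (fun _ => m) (f x)) in Hh.
  apply (D_in_imp _ _ (Dgf D no_cond f)).
  - intros y Hy; split; [exact Hy|exact I].
  - apply (Dcomp D no_cond (fun _ => l) (fun _ => m) f h x Hf Hh).
Qed.

Lemma is_derive_in_eq (D : R -> Prop) (f : R -> R) (x l l' : R) :
  is_derive_in D f x l -> l = l' -> is_derive_in D f x l'.
Proof. now intros H <-. Qed.

Lemma is_derive_in_inv (D : R -> Prop) (f : R -> R) (x l : R) :
  f x <> 0 -> is_derive_in D f x l -> is_derive_in D (fun y => / f y) x (- l / f x ^ 2).
Proof.
  intros H0 Hf; eapply is_derive_in_eq.
  - apply (is_derive_in_comp D f Rinv x l (- / f x ^ 2) Hf).
    auto_derive; auto; field; auto.
  - field; auto.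
Qed.

Lemma is_derive_in_div (D : R -> Prop) (f g : R -> R) (x lf lg : R) :
  g x <> 0 -> is_derive_in D f x lf -> is_derive_in D g x lg ->
  is_derive_in D (fun y => f y / g y) x ((lf * g x - f x * lg) / g x ^ 2).
Proof.
  intros H0 Hf Hg; eapply is_derive_in_eq.
  - apply (is_derive_in_mult D f (fun y => / g y)); [exact Hf|apply is_derive_in_inv; [exact H0|exact Hg]].
  - field; auto.
Qed.

Lemma is_derive_in_sqrt (D : R -> Prop) (f : R -> R) (x l : R) :
  0 < f x -> is_derive_in D f x l -> is_derive_in D (fun y => sqrt (f y)) x (l / (2 * sqrt (f x))).
Proof.
  intros H0 Hf; pose proof (sqrt_lt_R0 _ H0); eapply is_derive_in_eq.
  - apply (is_derive_in_comp D f sqrt x l (/ (2 * sqrt (f x))) Hf).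
    auto_derive; auto; field; lra.
  - field; lra.
Qed.

(** * Algebras of functions stable under differentiation *)

(** If every generator has its derivative in the algebra, so does every element, and derivatives of
    all orders follow from one check per generator. The domain [X] is R for single curves and R * R
    for families in (x, t). *)
Inductive falg {X : Type} (G : (X -> R) -> Prop) : (X -> R) -> Prop :=
| falg_gen f : G f -> falg G f
| falg_const c : falg G (fun _ => c)
| falg_plus f g : falg G f -> falg G g -> falg G (fun x => f x + g x)
| falg_mult f g : falg G f -> falg G g -> falg G (fun x => f x * g x).

(** [Der] stays abstract so that one induction serves the derivative on an interval, the space
    derivative and the time derivative. *)
Lemma falg_derivation {X : Type} (G : (X -> R) -> Prop) (Der : (X -> R) -> (X -> R) -> Prop) :
  (forall c, Der (fun _ => c) (fun _ => 0)) ->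
  (forall f f' g g', Der f f' -> Der g g' -> Der (fun x => f x + g x) (fun x => f' x + g' x)) ->
  (forall f f' g g', Der f f' -> Der g g' ->
     Der (fun x => f x * g x) (fun x => f' x * g x + f x * g' x)) ->
  (forall f, G f -> exists f', falg G f' /\ Der f f') ->
  forall f, falg G f -> exists f', falg G f' /\ Der f f'.
Proof.
  intros Hc Hp Hm Hg f Hf; induction Hf as [f Hf|c|f g Hf [f' [If If']] Hg' [g' [Ig Ig']]|f g Hf [f' [If If']] Hg' [g' [Ig Ig']]].
  - auto.
  - exists (fun _ => 0); split; [apply falg_const|auto].
  - exists (fun x => f' x + g' x); split; [now apply falg_plus|auto].
  - exists (fun x => f' x * g x + f x * g' x); split; [|auto].
    apply falg_plus; now apply falg_mult.
Qed.

Definition derives_in (D : R -> Prop) (f f' : R -> R) : Prop :=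
  forall x, D x -> is_derive_in D f x (f' x).

Lemma smooth_in_of_falg (D : R -> Prop) (G : (R -> R) -> Prop) (f : R -> R) :
  perfect D ->
  (forall g, G g -> exists g', falg G g' /\ derives_in D g g') ->
  falg G f -> smooth_in D f.
Proof.
  intros HD HG Hf.
  assert (Hder : forall g, falg G g -> exists g', falg G g' /\ derives_in D g g').
  { apply falg_derivation; auto.
    - intros c x _; apply is_derive_in_const.
    - intros g g' h h' H1 H2 x Hx; apply is_derive_in_plus; auto.
    - intros g g' h h' H1 H2 x Hx; apply is_derive_in_mult; auto. }
  (* Iterated relative derivatives are controlled on [D] only, so they are identified with elements
     of the algebra there. *)
  assert (Hn : forall n, exists g, falg G g /\ forall x, D x -> g x = derive_n_in D f n x).
  { induction n as [|n [g [Hg Hgn]]]; [now exists f|].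
    destruct (Hder g Hg) as [g' [Hg' Hd]]; exists g'; split; auto.
    intros x Hx; simpl; symmetry; apply derive_in_eq; auto.
    apply (is_derive_in_ext D g); auto. }
  intros n x Hx; destruct (Hn n) as [g [Hg Hgn]].
  destruct (Hder g Hg) as [g' [_ Hd]]; exists (g' x).
  apply (is_derive_in_ext D g); auto.
Qed.

(** * Curvature in coordinates *)

Lemma speed_eq (D : R -> Prop) (g : R -> R * R) (x1 y1 : R -> R) (x : R) :
  perfect D -> derives_in D (fun y => fst (g y)) x1 -> derives_in D (fun y => snd (g y)) y1 ->
  D x -> speed D g x = sqrt (x1 x ^ 2 + y1 x ^ 2).
Proof.
  intros HD H1 H2 Hx; unfold speed.
  now rewrite (derive_in_eq D _ x _ HD Hx (H1 x Hx)), (derive_in_eq D _ x _ HD Hx (H2 x Hx)).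
Qed.

Lemma tangent_eq (D : R -> Prop) (g : R -> R * R) (x1 y1 : R -> R) (x : R) :
  perfect D -> derives_in D (fun y => fst (g y)) x1 -> derives_in D (fun y => snd (g y)) y1 ->
  D x -> tangent D g x = (x1 x / sqrt (x1 x ^ 2 + y1 x ^ 2), y1 x / sqrt (x1 x ^ 2 + y1 x ^ 2)).
Proof.
  intros HD H1 H2 Hx; unfold tangent, d_s; rewrite (speed_eq D g x1 y1); auto.
  now rewrite (derive_in_eq D _ x _ HD Hx (H1 x Hx)), (derive_in_eq D _ x _ HD Hx (H2 x Hx)).
Qed.

(** Differentiating the reciprocal speed produces a multiple of the tangent, which drops out against
    the normal; the second derivatives alone survive. *)
Lemma curvature_eq (D : R -> Prop) (g : R -> R * R) (x1 y1 x2 y2 : R -> R) (x : R) :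
  perfect D -> derives_in D (fun y => fst (g y)) x1 -> derives_in D (fun y => snd (g y)) y1 ->
  derives_in D x1 x2 -> derives_in D y1 y2 ->
  D x -> 0 < x1 x ^ 2 + y1 x ^ 2 ->
  curvature D g x = (x1 x * y2 x - y1 x * x2 x) / sqrt (x1 x ^ 2 + y1 x ^ 2) ^ 3.
Proof.
  intros HD H1 H2 H3 H4 Hx Hp; unfold curvature, normal, dot; cbn [fst snd].
  unfold d_s; rewrite (speed_eq D g x1 y1), (tangent_eq D g x1 y1) by auto; cbn [fst snd].
  pose proof (sqrt_lt_R0 _ Hp) as Hs.
  pose (S' := 2 * x1 x * x2 x + 2 * y1 x * y2 x).
  assert (HS : is_derive_in D (fun y => sqrt (x1 y ^ 2 + y1 y ^ 2)) x (S' / (2 * sqrt (x1 x ^ 2 + y1 x ^ 2)))).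
  { apply (is_derive_in_sqrt D (fun y => x1 y ^ 2 + y1 y ^ 2)); auto.
    eapply is_derive_in_eq.
    - apply (is_derive_in_ext D (fun y => x1 y * x1 y + y1 y * y1 y)); auto; [intros; ring|].
      apply is_derive_in_plus; apply is_derive_in_mult; auto.
    - unfold S'; ring. }
  rewrite (derive_in_ext D (fun y => fst (tangent D g y)) (fun y => x1 y / sqrt (x1 y ^ 2 + y1 y ^ 2)))
    by (auto; intros; now rewrite (tangent_eq D g x1 y1)).
  rewrite (derive_in_ext D (fun y => snd (tangent D g y)) (fun y => y1 y / sqrt (x1 y ^ 2 + y1 y ^ 2)))
    by (auto; intros; now rewrite (tangent_eq D g x1 y1)).
  erewrite (derive_in_eq D (fun y => x1 y / _)); auto.
  2:{ apply is_derive_in_div; [lra|apply H3; auto|exact HS]. }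
  erewrite (derive_in_eq D (fun y => y1 y / _)); auto.
  2:{ apply is_derive_in_div; [lra|apply H4; auto|exact HS]. }
  set (r := sqrt (x1 x ^ 2 + y1 x ^ 2)) in *.
  field; lra.
Qed.

Lemma d_s_eq (D : R -> Prop) (g : R -> R * R) (f : R -> R) (x l : R) :
  perfect D -> D x -> is_derive_in D f x l -> d_s D g f x = l / speed D g x.
Proof. intros HD Hx H; unfold d_s; now rewrite (derive_in_eq D f x l). Qed.

(** * The curve *)

Lemma smooth_in_ext (D : R -> Prop) (f g : R -> R) :
  (forall x, D x -> f x = g x) -> smooth_in D f -> smooth_in D g.
Proof.
  intros Hfg Hf n x Hx; destruct (Hf n x Hx) as [l Hl]; exists l.
  apply (is_derive_in_ext D (derive_n_in D f n)); auto.
  intros y Hy; now apply derive_n_in_ext.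
Qed.

Lemma is_derive_affine (f : R -> R) (p q x l : R) :
  is_derive f (p * x + q) l -> is_derive (fun r => f (p * r + q)) x (p * l).
Proof.
  intros H; evar_last.
  - apply (is_derive_comp f (fun r => p * r + q)); [exact H|auto_derive; auto].
  - unfold scal; simpl; unfold mult; simpl; ring.
Qed.

Lemma is_derive_gamma_tilde_1 (a s : R) : is_derive (fun s => fst (gamma_tilde a s)) s (cos (angle a s)).
Proof.
  assert (Hc : forall s, continuous (fun s => cos (angle a s)) s)
    by (intros t; apply (ex_derive_continuous (fun s => cos (angle a s))); eexists; apply is_derive_cos_angle).
  apply (is_derive_RInt (V := R_NormedModule) (fun s => cos (angle a s)) (fun s => fst (gamma_tilde a s)) 0); auto.
  exists (mkposreal 1 Rlt_0_1); intros y _.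
  apply (RInt_correct (V := R_CompleteNormedModule)), (ex_RInt_continuous (V := R_CompleteNormedModule)); auto.
Qed.

Lemma is_derive_gamma_tilde_2 (a s : R) : is_derive (fun s => snd (gamma_tilde a s)) s (sin (angle a s)).
Proof.
  assert (Hc : forall s, continuous (fun s => sin (angle a s)) s)
    by (intros t; apply (ex_derive_continuous (fun s => sin (angle a s))); eexists; apply is_derive_sin_angle).
  apply (is_derive_RInt (V := R_NormedModule) (fun s => sin (angle a s)) (fun s => snd (gamma_tilde a s)) 0); auto.
  exists (mkposreal 1 Rlt_0_1); intros y _.
  apply (RInt_correct (V := R_CompleteNormedModule)), (ex_RInt_continuous (V := R_CompleteNormedModule)); auto.
Qed.

(** The affine argument lets one algebra handle [u_cn] in arclength and [gamma_c] in its own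
    parameter. *)
Inductive jac_gen (a p q : R) : (R -> R) -> Prop :=
| jac_sn : jac_gen a p q (fun r => sn (p * r + q) k0)
| jac_cn : jac_gen a p q (fun r => cn (p * r + q) k0)
| jac_dn : jac_gen a p q (fun r => dn (p * r + q) k0)
| jac_cos : jac_gen a p q (fun r => cos (angle a (p * r + q)))
| jac_sin : jac_gen a p q (fun r => sin (angle a (p * r + q)))
| jac_gamma1 : jac_gen a p q (fun r => fst (gamma_tilde a (p * r + q)))
| jac_gamma2 : jac_gen a p q (fun r => snd (gamma_tilde a (p * r + q))).

Ltac falg_tac := repeat first
  [ apply falg_const | apply falg_gen; now constructor | apply falg_mult | apply falg_plus ].

Lemma jac_gen_derive (a p q : R) (D : R -> Prop) (f : R -> R) :
  jac_gen a p q f -> exists f', falg (jac_gen a p q) f' /\ derives_in D f f'.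
Proof.
  intros H; destruct H.
  - exists (fun r => p * (cn (p * r + q) k0 * dn (p * r + q) k0)); split; [falg_tac|].
    intros x _; apply is_derive_in_of_is_derive, (is_derive_affine (fun s => sn s k0)), is_derive_sn, k0_sq.
  - exists (fun r => p * ((-1) * sn (p * r + q) k0 * dn (p * r + q) k0)); split; [falg_tac|].
    intros x _; apply is_derive_in_of_is_derive, (is_derive_affine (fun s => cn s k0)).
    evar_last; [apply is_derive_cn, k0_sq|ring].
  - exists (fun r => p * ((- k0 ^ 2) * sn (p * r + q) k0 * cn (p * r + q) k0)); split; [falg_tac|].
    intros x _; apply is_derive_in_of_is_derive, (is_derive_affine (fun s => dn s k0)), is_derive_dn, k0_sq.
  - exists (fun r => p * ((- a) * cn (p * r + q) k0 * sin (angle a (p * r + q)))); split; [falg_tac|].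
    intros x _; apply is_derive_in_of_is_derive, (is_derive_affine (fun s => cos (angle a s))).
    evar_last; [apply is_derive_cos_angle|unfold u_cn; ring].
  - exists (fun r => p * (a * cn (p * r + q) k0 * cos (angle a (p * r + q)))); split; [falg_tac|].
    intros x _; apply is_derive_in_of_is_derive, (is_derive_affine (fun s => sin (angle a s))), is_derive_sin_angle.
  - exists (fun r => p * cos (angle a (p * r + q))); split; [falg_tac|].
    intros x _; apply is_derive_in_of_is_derive, (is_derive_affine (fun s => fst (gamma_tilde a s))), is_derive_gamma_tilde_1.
  - exists (fun r => p * sin (angle a (p * r + q))); split; [falg_tac|].
    intros x _; apply is_derive_in_of_is_derive, (is_derive_affine (fun s => snd (gamma_tilde a s))), is_derive_gamma_tilde_2.
Qed.

Lemma smooth_in_jac (a p q : R) (D : R -> Prop) (f : R -> R) :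
  perfect D -> falg (jac_gen a p q) f -> smooth_in D f.
Proof.
  intros HD; apply smooth_in_of_falg; auto; intros g; apply jac_gen_derive.
Qed.

Lemma smooth_u_cn (a : R) : smooth_in (Icc 0 L0) (u_cn a).
Proof.
  apply (smooth_in_ext _ (fun r => a * cn (1 * r + 0) k0)).
  - intros x _; unfold u_cn; do 2 f_equal; ring.
  - apply (smooth_in_jac a 1 0); [apply perfect_Icc, L0_pos|falg_tac].
Qed.

Lemma RInt_u_cn (a : R) : RInt (u_cn a) 0 L0 = 0.
Proof. apply angle_L0. Qed.

Lemma gamma_tilde_unit_curvature (a s : R) : Icc 0 L0 s ->
  speed (Icc 0 L0) (gamma_tilde a) s = 1 /\ curvature (Icc 0 L0) (gamma_tilde a) s = u_cn a s.
Proof.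
  intros Hs.
  assert (HP : perfect (Icc 0 L0)) by apply perfect_Icc, L0_pos.
  assert (E : forall s, cos (angle a s) ^ 2 + sin (angle a s) ^ 2 = 1)
    by (intros; rewrite Rplus_comm, <- !Rsqr_pow2; apply sin2_cos2).
  assert (H1 : derives_in (Icc 0 L0) (fun s => fst (gamma_tilde a s)) (fun s => cos (angle a s)))
    by (intros x _; apply is_derive_in_of_is_derive, is_derive_gamma_tilde_1).
  assert (H2 : derives_in (Icc 0 L0) (fun s => snd (gamma_tilde a s)) (fun s => sin (angle a s)))
    by (intros x _; apply is_derive_in_of_is_derive, is_derive_gamma_tilde_2).
  split.
  - rewrite (speed_eq _ _ _ _ s HP H1 H2), E by auto; apply sqrt_1.
  - rewrite (curvature_eq (Icc 0 L0) (gamma_tilde a) (fun s => cos (angle a s)) (fun s => sin (angle a s))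
      (fun s => - u_cn a s * sin (angle a s)) (fun s => u_cn a s * cos (angle a s))); auto.
    + rewrite E, sqrt_1; transitivity (u_cn a s * (cos (angle a s) ^ 2 + sin (angle a s) ^ 2)); [field|].
      rewrite E; ring.
    + intros x _; apply is_derive_in_of_is_derive, is_derive_cos_angle.
    + intros x _; apply is_derive_in_of_is_derive, is_derive_sin_angle.
    + rewrite E; lra.
Qed.

(** Arclength on [gamma_tilde] of the point with parameter r in [-1, 1]. *)
Definition arc (r : R) : R := (r + 1) * L0 / 2.

Definition scale (a : R) : R := 2 / fst (gamma_tilde a L0).

Definition speed_c (a : R) : R := scale a * L0 / 2.

Lemma scale_pos (a : R) : 0 <= a <= 2 * k0 -> 0 < scale a.
Proof. intros Ha; apply Rdiv_lt_0_compat; [lra|now apply gamma_tilde_end_pos]. Qed.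

Lemma speed_c_pos (a : R) : 0 <= a <= 2 * k0 -> 0 < speed_c a.
Proof.
  intros Ha; unfold speed_c; pose proof (scale_pos a Ha); pose proof L0_pos.
  apply Rdiv_lt_0_compat; [apply Rmult_lt_0_compat|]; lra.
Qed.

Lemma is_derive_arc (f : R -> R) (r l : R) :
  is_derive f (arc r) l -> is_derive (fun r => f (arc r)) r (L0 / 2 * l).
Proof.
  intros H.
  apply (is_derive_ext (fun r => f (L0 / 2 * r + L0 / 2))).
  - intros t; f_equal; unfold arc; field.
  - apply is_derive_affine; replace (L0 / 2 * r + L0 / 2) with (arc r) by (unfold arc; field); exact H.
Qed.

Lemma is_derive_lin_arc (f : R -> R) (m r l : R) :
  is_derive f (arc r) l -> is_derive (fun r => m * f (arc r)) r (m * (L0 / 2 * l)).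
Proof. intros H; apply (is_derive_scal (fun r => f (arc r))), is_derive_arc, H. Qed.

Definition gc_x1 (a r : R) : R := speed_c a * cos (angle a (arc r)).
Definition gc_y1 (a r : R) : R := speed_c a * sin (angle a (arc r)).
Definition gc_x2 (a r : R) : R := speed_c a * (L0 / 2 * (- u_cn a (arc r) * sin (angle a (arc r)))).
Definition gc_y2 (a r : R) : R := speed_c a * (L0 / 2 * (u_cn a (arc r) * cos (angle a (arc r)))).

Lemma gamma_c_x1 (a : R) : derives_in I11 (fun r => fst (gamma_c a r)) (gc_x1 a).
Proof.
  intros x _; apply is_derive_in_of_is_derive; evar_last.
  - apply (is_derive_minus (fun r => scale a * fst (gamma_tilde a (arc r))) (fun _ => 1)).
    + apply (is_derive_lin_arc (fun s => fst (gamma_tilde a s))), is_derive_gamma_tilde_1.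
    + apply is_derive_const.
  - unfold minus, plus, opp, zero; simpl; unfold gc_x1, speed_c; field.
Qed.

Lemma gamma_c_y1 (a : R) : derives_in I11 (fun r => snd (gamma_c a r)) (gc_y1 a).
Proof.
  intros x _; apply is_derive_in_of_is_derive; evar_last.
  - apply (is_derive_lin_arc (fun s => snd (gamma_tilde a s)) (scale a)), is_derive_gamma_tilde_2.
  - unfold gc_y1, speed_c; field.
Qed.

Lemma gamma_c_x2 (a : R) : derives_in I11 (gc_x1 a) (gc_x2 a).
Proof.
  intros x _; apply is_derive_in_of_is_derive, (is_derive_lin_arc (fun s => cos (angle a s))), is_derive_cos_angle.
Qed.

Lemma gamma_c_y2 (a : R) : derives_in I11 (gc_y1 a) (gc_y2 a).
Proof.
  intros x _; apply is_derive_in_of_is_derive, (is_derive_lin_arc (fun s => sin (angle a s))), is_derive_sin_angle.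
Qed.

Lemma gc_speed_sq (a r : R) : gc_x1 a r ^ 2 + gc_y1 a r ^ 2 = speed_c a ^ 2.
Proof.
  unfold gc_x1, gc_y1; transitivity (speed_c a ^ 2 * ((sin (angle a (arc r)))² + (cos (angle a (arc r)))²)).
  - unfold Rsqr; ring.
  - rewrite sin2_cos2; ring.
Qed.

Lemma gamma_c_speed (a r : R) : 0 <= a <= 2 * k0 -> I11 r -> speed I11 (gamma_c a) r = speed_c a.
Proof.
  intros Ha Hr; rewrite (speed_eq _ _ _ _ r perfect_I11 (gamma_c_x1 a) (gamma_c_y1 a) Hr), gc_speed_sq.
  apply sqrt_pow2; pose proof (speed_c_pos a Ha); lra.
Qed.

(** Scaling a curve by c divides its curvature by c; in the next two lemmas each arclength
    derivative brings one more factor 1/c. *)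
Lemma gamma_c_curvature (a r : R) : 0 <= a <= 2 * k0 -> I11 r ->
  curvature I11 (gamma_c a) r = / scale a * u_cn a (arc r).
Proof.
  intros Ha Hr; pose proof (speed_c_pos a Ha) as Hs; pose proof (scale_pos a Ha) as Hc.
  rewrite (curvature_eq I11 (gamma_c a) (gc_x1 a) (gc_y1 a) (gc_x2 a) (gc_y2 a));
    auto using perfect_I11, gamma_c_x1, gamma_c_y1, gamma_c_x2, gamma_c_y2;
    rewrite ?gc_speed_sq; [|apply pow_lt; lra].
  rewrite sqrt_pow2 by lra.
  replace (gc_x1 a r * gc_y2 a r - gc_y1 a r * gc_x2 a r) with
    ((gc_x1 a r ^ 2 + gc_y1 a r ^ 2) * (L0 / 2) * u_cn a (arc r))
    by (unfold gc_x1, gc_y1, gc_x2, gc_y2; ring).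
  rewrite gc_speed_sq; unfold speed_c in *; pose proof L0_pos; field; lra.
Qed.

Lemma gamma_c_curvature_s (a r : R) : 0 <= a <= 2 * k0 -> I11 r ->
  curvature_s I11 (gamma_c a) r = / scale a ^ 2 * (- a * sn (arc r) k0 * dn (arc r) k0).
Proof.
  intros Ha Hr; pose proof (scale_pos a Ha) as Hc; unfold curvature_s.
  erewrite (d_s_eq I11 _ _ r _ perfect_I11 Hr).
  2:{ apply (is_derive_in_ext I11 (fun r => / scale a * u_cn a (arc r))); auto.
      - intros; symmetry; now apply gamma_c_curvature.
      - apply is_derive_in_of_is_derive, (is_derive_lin_arc (u_cn a)), is_derive_u_cn. }
  rewrite gamma_c_speed by auto; unfold speed_c; pose proof L0_pos; field; lra.
Qed.

Lemma gamma_c_curvature_ss (a r : R) : 0 <= a <= 2 * k0 -> I11 r ->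
  curvature_ss I11 (gamma_c a) r =
    / scale a ^ 3 * (a * ((2 * k0 ^ 2 - 1) * cn (arc r) k0 - 2 * k0 ^ 2 * cn (arc r) k0 ^ 3)).
Proof.
  intros Ha Hr; pose proof (scale_pos a Ha) as Hc; unfold curvature_ss.
  erewrite (d_s_eq I11 _ _ r _ perfect_I11 Hr).
  2:{ apply (is_derive_in_ext I11 (fun r => / scale a ^ 2 * (- a * sn (arc r) k0 * dn (arc r) k0))); auto.
      - intros; symmetry; now apply gamma_c_curvature_s.
      - apply is_derive_in_of_is_derive, (is_derive_lin_arc (fun s => - a * sn s k0 * dn s k0)), is_derive2_u_cn. }
  rewrite gamma_c_speed by auto; unfold speed_c; pose proof L0_pos; field; lra.
Qed.

Lemma arc_m1 : arc (-1) = 0.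
Proof. unfold arc; field. Qed.

Lemma arc_1 : arc 1 = L0.
Proof. unfold arc; field. Qed.

Lemma is_RInt_arc (f : R -> R) (v : R) : (forall s, continuous f s) -> is_RInt f 0 L0 v ->
  is_RInt (fun r => f (arc r)) (-1) 1 (2 / L0 * v).
Proof.
  intros Hc Hf; pose proof L0_pos.
  assert (H1 : is_RInt f (L0 / 2 * -1 + L0 / 2) (L0 / 2 * 1 + L0 / 2) v).
  { replace (L0 / 2 * -1 + L0 / 2) with 0 by field; replace (L0 / 2 * 1 + L0 / 2) with L0 by field; exact Hf. }
  apply (is_RInt_comp_lin (V := R_NormedModule)) in H1.
  eapply is_RInt_congr; [| |apply (is_RInt_scal (V := R_NormedModule) _ _ _ (2 / L0) _ H1)].
  - intros t; unfold scal; simpl; unfold mult; simpl.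
    replace (L0 / 2 * t + L0 / 2) with (arc t) by (unfold arc; field); field; lra.
  - reflexivity.
Qed.

(** The arclength element of [gamma_c] is [scale a] times that of [gamma_tilde], so geometric
    integrals reduce to integrals over [0, L0]; [m] collects the powers of the scaling factor. *)
Lemma int_ds_gamma_c (a m v : R) (f : R -> R) (h : R -> R) : 0 <= a <= 2 * k0 ->
  (forall r, I11 r -> f r = m * h (arc r)) -> (forall s, continuous h s) -> is_RInt h 0 L0 v ->
  int_ds (gamma_c a) f = m * scale a * v.
Proof.
  intros Ha Hf Hc Hv; unfold int_ds; apply (is_RInt_unique (V := R_CompleteNormedModule)).
  apply (is_RInt_ext (V := R_NormedModule) (fun r => (m * speed_c a) * h (arc r))).
  - intros r Hr; rewrite Rmin_left, Rmax_right in Hr by lra.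
    assert (Hr' : I11 r) by (unfold I11, Icc; lra).
    change (@eq R (m * speed_c a * h (arc r)) (f r * speed I11 (gamma_c a) r)).
    rewrite Hf, gamma_c_speed by auto; ring.
  - eapply is_RInt_congr; [| |apply (is_RInt_scal (V := R_NormedModule) _ _ _ (m * speed_c a) _ (is_RInt_arc h v Hc Hv))].
    + intros t; reflexivity.
    + unfold scal; simpl; unfold mult; simpl; unfold speed_c; pose proof L0_pos; field; lra.
Qed.

Lemma continuous_u_cn_pow (a s : R) (n : nat) : continuous (fun s => u_cn a s ^ n) s.
Proof.
  apply (ex_derive_continuous (fun s => u_cn a s ^ n)); unfold u_cn; auto_derive; jacobi_ex.
Qed.

Lemma gamma_c_class_X (a : R) : 0 <= a <= 2 * k0 -> class_X (gamma_c a).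
Proof.
  intros Ha.
  assert (Hm : I11 (-1)) by (unfold I11, Icc; lra).
  assert (H1 : I11 1) by (unfold I11, Icc; lra).
  assert (N : forall r, I11 r -> sin (angle a (arc r)) = 0 -> dot (normal I11 (gamma_c a) r) e1 = 0).
  { intros r Hr E; unfold dot, normal, e1.
    rewrite (tangent_eq _ _ _ _ r perfect_I11 (gamma_c_x1 a) (gamma_c_y1 a) Hr).
    cbn [fst snd]; unfold gc_y1; rewrite E; unfold Rdiv; ring. }
  repeat split.
  - apply (smooth_in_ext _ (fun r => scale a * fst (gamma_tilde a (L0 / 2 * r + L0 / 2)) + (-1))).
    + intros x _; replace (L0 / 2 * x + L0 / 2) with ((x + 1) * L0 / 2) by field; reflexivity.
    + apply (smooth_in_jac a (L0 / 2) (L0 / 2)); [apply perfect_I11|falg_tac].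
  - apply (smooth_in_ext _ (fun r => scale a * snd (gamma_tilde a (L0 / 2 * r + L0 / 2)))).
    + intros x _; replace (L0 / 2 * x + L0 / 2) with ((x + 1) * L0 / 2) by field; reflexivity.
    + apply (smooth_in_jac a (L0 / 2) (L0 / 2)); [apply perfect_I11|falg_tac].
  - intros x Hx; rewrite gamma_c_speed by auto; apply Rgt_not_eq, speed_c_pos, Ha.
  - exists 0; unfold gamma_c, eta; fold (arc (-1)); rewrite arc_m1; unfold gamma_tilde; cbn [fst snd].
    rewrite !(RInt_point (V := R_CompleteNormedModule)); f_equal; unfold zero; simpl; ring.
  - exists (scale a * snd (gamma_tilde a L0)); unfold gamma_c, eta; fold (arc 1); rewrite arc_1; cbn [fst snd].
    f_equal; pose proof (gamma_tilde_end_pos a Ha); field; lra.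
  - apply N; auto; rewrite arc_m1, angle_0; apply sin_0.
  - apply N; auto; rewrite arc_1, angle_L0; apply sin_0.
  - rewrite gamma_c_curvature_s, arc_m1, sn_0 by auto; ring.
  - rewrite gamma_c_curvature_s, arc_1, sn_L0 by auto; ring.
Qed.

Lemma turning_gamma_c (a : R) : 0 <= a <= 2 * k0 -> turning_number (gamma_c a) = 0.
Proof.
  intros Ha; unfold turning_number.
  rewrite (int_ds_gamma_c a (/ scale a) 0 _ (u_cn a)); auto.
  - ring.
  - intros; now apply gamma_c_curvature.
  - intros s; apply (ex_derive_continuous (u_cn a)); eexists; apply is_derive_u_cn.
  - eapply is_RInt_congr; [| |apply (is_RInt_FTC (angle a) (u_cn a))]; auto.
    + rewrite angle_L0, angle_0; ring.
    + apply is_derive_angle.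
    + intros; eexists; apply is_derive_u_cn.
Qed.

Lemma length_gamma_c (a : R) : 0 <= a <= 2 * k0 -> length_of (gamma_c a) = scale a * L0.
Proof.
  intros Ha; unfold length_of.
  rewrite (int_ds_gamma_c a 1 (L0 - 0) _ (fun _ => 1)); auto; [ring|intros; ring| |apply is_RInt_one].
  intros; apply continuous_const.
Qed.

Lemma energy_gamma_c (a : R) : 0 <= a <= 2 * k0 ->
  energy (gamma_c a) = / scale a * (1 / 2 * (a ^ 2 * C2)).
Proof.
  intros Ha; unfold energy; pose proof (scale_pos a Ha).
  rewrite (int_ds_gamma_c a (/ scale a ^ 2) (a ^ 2 * C2) _ (fun s => u_cn a s ^ 2)); auto.
  - field; lra.
  - intros; rewrite gamma_c_curvature by auto; field; lra.
  - intros; apply continuous_u_cn_pow.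
  - apply is_RInt_u2.
Qed.

(** The scaling factor cancels and leaves a^2 K C2, which is increasing in a and equals 2 pi at
    [a_star]. *)
Lemma energy_hat_gamma_c (a : R) : 0 <= a < a_star -> a <= 2 * k0 -> energy_hat (gamma_c a) < 2 * PI.
Proof.
  intros Ha Hk; unfold energy_hat; rewrite length_gamma_c, energy_gamma_c by lra.
  pose proof (scale_pos a ltac:(lra)).
  pose proof ellK_ellE_bounds as [HK _]; pose proof moment_bounds as [HC _].
  assert (HKC : 0 < ellK k0 * C2) by (apply Rmult_lt_0_compat; lra).
  replace (scale a * L0 * (/ scale a * (1 / 2 * (a ^ 2 * C2)))) with (a ^ 2 * (ellK k0 * C2))
    by (unfold L0; field; lra).
  replace (2 * PI) with (a_star ^ 2 * (ellK k0 * C2)) by (rewrite a_star_sq; field; split; lra).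
  apply Rmult_lt_compat_r; auto; nra.
Qed.

Lemma energy_hat_rate_gamma_c (a : R) : 0 <= a <= 2 * k0 ->
  energy_hat_rate (gamma_c a) = / 2 * / scale a ^ 4 * LHS L0 (u_cn a).
Proof.
  intros Ha; pose proof (scale_pos a Ha); unfold energy_hat_rate.
  rewrite length_gamma_c, energy_gamma_c by auto.
  rewrite (int_ds_gamma_c a (/ scale a ^ 4) (a ^ 2 * D22) _ (fun s => (- a * sn s k0 * dn s k0) ^ 2)); auto.
  rewrite (int_ds_gamma_c a (/ scale a ^ 4) (a ^ 4 * C4) _ (fun s => u_cn a s ^ 4)); auto.
  rewrite (int_ds_gamma_c a (/ scale a ^ 6) (a ^ 2 * ((2 * k0 ^ 2 - 1) ^ 2 * C2
      + 2 * (2 * k0 ^ 2 - 1) * (a ^ 2 / 2 - 2 * k0 ^ 2) * C4 + (a ^ 2 / 2 - 2 * k0 ^ 2) ^ 2 * C6)) _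
      (fun s => elastic_u a s ^ 2)); auto.
  - rewrite LHS_u_cn; unfold lhs_over, L0; field; lra.
  - intros; rewrite gamma_c_curvature, gamma_c_curvature_ss by auto; unfold elastic_u; field; lra.
  - intros s; apply (ex_derive_continuous (fun s => elastic_u a s ^ 2)); unfold elastic_u, u_cn; auto_derive; jacobi_ex.
  - apply is_RInt_elastic2.
  - intros; rewrite gamma_c_curvature by auto; field; lra.
  - intros; apply continuous_u_cn_pow.
  - apply is_RInt_u4.
  - intros; rewrite gamma_c_curvature_s by auto; field; lra.
  - intros s; apply (ex_derive_continuous (fun s => (- a * sn s k0 * dn s k0) ^ 2)); auto_derive; jacobi_ex.
  - apply is_RInt_du2.
Qed.

(** * Smooth families of curves *)

Lemma time_dom_room (T : Rbar) (t : R) : time_dom T t ->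
  exists d : posreal, forall t', 0 <= t' -> t' < t + d -> time_dom T t'.
Proof.
  intros [H0 HT]; destruct T as [T| |]; simpl in HT; try contradiction.
  - assert (Hd : 0 < T - t) by lra; exists (mkposreal _ Hd); intros t' H1 H2; simpl in H2.
    split; simpl; lra.
  - exists (mkposreal 1 Rlt_0_1); intros; split; simpl; auto.
Qed.

Lemma locally_time_dom (T : Rbar) (t : R) : time_dom T t -> 0 < t -> locally t (time_dom T).
Proof.
  intros Ht H0; destruct (time_dom_room T t Ht) as [d Hd].
  assert (Hm : 0 < Rmin d t) by (apply Rmin_glb_lt; [apply cond_pos|auto]).
  exists (mkposreal _ Hm); intros y Hy; change (Rabs (y - t) < Rmin d t) in Hy.
  pose proof (Rmin_l d t); pose proof (Rmin_r d t); apply Rabs_lt_between in Hy.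
  apply Hd; lra.
Qed.

Lemma locally_I11 (x : R) : -1 < x < 1 -> locally x I11.
Proof.
  intros Hx; assert (Hm : 0 < Rmin (x + 1) (1 - x)) by (apply Rmin_glb_lt; lra).
  exists (mkposreal _ Hm); intros y Hy; change (Rabs (y - x) < Rmin (x + 1) (1 - x)) in Hy.
  pose proof (Rmin_l (x + 1) (1 - x)); pose proof (Rmin_r (x + 1) (1 - x)); apply Rabs_lt_between in Hy.
  unfold I11, Icc; lra.
Qed.

Definition cont2 (I J : R -> Prop) (f : R * R -> R) : Prop :=
  forall x t, I x -> J t -> continuous_in2 I J (fun x t => f (x, t)) x t.

Lemma continuous_in2_eps (I J : R -> Prop) (f : R * R -> R) (x t : R) :
  continuous_in2 I J (fun x t => f (x, t)) x t <->
  forall eps : posreal, exists d : posreal, forall x' t', I x' -> J t' ->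
    Rabs (x' - x) < d -> Rabs (t' - t) < d -> Rabs (f (x', t') - f (x, t)) < eps.
Proof.
  unfold continuous_in2; rewrite filterlim_locally; split; intros H eps.
  - destruct (H eps) as [d Hd]; exists d; intros x' t' Hx Ht Hx' Ht'.
    apply (Hd (x', t')); simpl; auto; split; auto.
  - destruct (H eps) as [d Hd]; exists d; intros [x' t'] [Hx' Ht'] [Hx Ht].
    apply Hd; auto.
Qed.

Lemma cont2_const (I J : R -> Prop) (c : R) : cont2 I J (fun _ => c).
Proof.
  intros x t _ _; apply (continuous_in2_eps I J (fun _ => c)); intros eps; exists eps.
  intros; rewrite Rminus_diag, Rabs_R0; apply cond_pos.
Qed.

Lemma cont2_plus (I J : R -> Prop) (f g : R * R -> R) :
  cont2 I J f -> cont2 I J g -> cont2 I J (fun p => f p + g p).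
Proof.
  intros Hf Hg x t Hx Ht.
  apply (filterlim_comp_2 (fun p : R * R => f (fst p, snd p)) (fun p => g (fst p, snd p)) Rplus (Hf x t Hx Ht) (Hg x t Hx Ht)).
  apply (filterlim_plus (V := R_NormedModule)).
Qed.

Lemma cont2_mult (I J : R -> Prop) (f g : R * R -> R) :
  cont2 I J f -> cont2 I J g -> cont2 I J (fun p => f p * g p).
Proof.
  intros Hf Hg x t Hx Ht.
  apply (filterlim_comp_2 (fun p : R * R => f (fst p, snd p)) (fun p => g (fst p, snd p)) Rmult (Hf x t Hx Ht) (Hg x t Hx Ht)).
  apply (filterlim_mult (K := R_AbsRing)).
Qed.

Lemma cont2_comp (I J : R -> Prop) (f : R * R -> R) (h : R -> R) :
  cont2 I J f -> (forall x t, I x -> J t -> continuous h (f (x, t))) -> cont2 I J (fun p => h (f p)).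
Proof.
  intros Hf Hh x t Hx Ht.
  apply (filterlim_comp _ _ _ (fun p : R * R => f (fst p, snd p)) h _ _ _ (Hf x t Hx Ht) (Hh x t Hx Ht)).
Qed.

Lemma cont2_dense (T : Rbar) (f g : R * R -> R) :
  cont2 I11 (time_dom T) f -> cont2 I11 (time_dom T) g ->
  (forall x t, -1 < x < 1 -> 0 < t -> time_dom T t -> f (x, t) = g (x, t)) ->
  forall x t, I11 x -> time_dom T t -> f (x, t) = g (x, t).
Proof.
  intros Hf Hg Hfg x t Hx Ht; apply NNPP; intros Hne.
  assert (He : 0 < Rabs (f (x, t) - g (x, t)) / 2).
  { pose proof (Rabs_pos_lt (f (x, t) - g (x, t)) ltac:(lra)); lra. }
  set (eps := mkposreal _ He).
  destruct (proj1 (continuous_in2_eps _ _ f x t) (Hf x t Hx Ht) eps) as [d1 H1].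
  destruct (proj1 (continuous_in2_eps _ _ g x t) (Hg x t Hx Ht) eps) as [d2 H2].
  destruct (time_dom_room T t Ht) as [d3 H3].
  set (d := Rmin d1 (Rmin d2 (Rmin d3 1))).
  assert (Hd : 0 < d) by (repeat apply Rmin_glb_lt; try apply cond_pos; lra).
  assert (Hd1 : d <= d1 /\ d <= d2 /\ d <= d3 /\ d <= 1).
  { unfold d; repeat split.
    - apply Rmin_l.
    - eapply Rle_trans; [apply Rmin_r|apply Rmin_l].
    - eapply Rle_trans; [apply Rmin_r|]; eapply Rle_trans; [apply Rmin_r|apply Rmin_l].
    - eapply Rle_trans; [apply Rmin_r|]; eapply Rle_trans; [apply Rmin_r|apply Rmin_r]. }
  (* Shrinking x towards 0 and advancing t lands in the open domain even from x = 1, x = -1 or t =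
     0. *)
  pose (x' := x * (1 - d / 2)); pose (t' := t + d / 2).
  unfold I11, Icc in Hx; destruct Ht as [Ht0 HtT].
  assert (Hx' : -1 < x' < 1) by (unfold x'; split; nra).
  assert (HI : I11 x') by (unfold I11, Icc; lra).
  assert (HJ : time_dom T t') by (apply H3; unfold t'; lra).
  assert (Dx : Rabs (x' - x) < d) by (unfold x'; apply Rabs_def1; nra).
  assert (Dt : Rabs (t' - t) < d) by (unfold t'; apply Rabs_def1; lra).
  specialize (H1 x' t' HI HJ ltac:(lra) ltac:(lra)); specialize (H2 x' t' HI HJ ltac:(lra) ltac:(lra)).
  rewrite (Hfg x' t') in H1 by (auto; unfold t'; lra).
  simpl in H1, H2.
  assert (Rabs (f (x, t) - g (x, t)) < Rabs (f (x, t) - g (x, t))); [|lra].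
  replace (f (x, t) - g (x, t)) with (- (g (x', t') - f (x, t)) + (g (x', t') - g (x, t))) at 1 by ring.
  eapply Rle_lt_trans; [apply Rabs_triang|]; rewrite Rabs_Ropp; lra.
Qed.

(** * Integrals depending on a parameter *)

Definition clamp (x : R) : R := Rmax (-1) (Rmin x 1).

Lemma clamp_I11 (x : R) : I11 (clamp x).
Proof.
  unfold clamp, I11, Icc; pose proof (Rmin_r x 1); unfold Rmax; destruct (Rle_dec (-1) (Rmin x 1)); lra.
Qed.

Lemma clamp_id (x : R) : I11 x -> clamp x = x.
Proof. intros [H1 H2]; unfold clamp; rewrite Rmin_left, Rmax_right; lra. Qed.

Lemma clamp_lip (x y : R) : Rabs (clamp x - clamp y) <= Rabs (x - y).
Proof.
  unfold clamp, Rmax, Rmin.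
  destruct (Rle_dec x 1), (Rle_dec y 1);
  repeat match goal with |- context [Rle_dec ?a ?b] => destruct (Rle_dec a b) end;
  unfold Rabs; repeat destruct (Rcase_abs _); lra.
Qed.

Lemma Rmax_0_lip (x y : R) : Rabs (Rmax 0 x - Rmax 0 y) <= Rabs (x - y).
Proof.
  unfold Rmax; destruct (Rle_dec 0 x), (Rle_dec 0 y); unfold Rabs; repeat destruct (Rcase_abs _); lra.
Qed.

(** Extension by 1-Lipschitz retractions, which preserves continuity and gives access to theorems
    about functions on the plane. Time is clamped at 0 only, as the end T is excluded from the
    domain. *)
Definition extend2 (f : R * R -> R) (x t : R) : R := f (clamp x, Rmax 0 t).

Lemma extend2_id (T : Rbar) (f : R * R -> R) (x t : R) : I11 x -> time_dom T t -> extend2 f x t = f (x, t).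
Proof. intros Hx [Ht _]; unfold extend2; now rewrite clamp_id, Rmax_right. Qed.

Lemma extend2_continuity (T : Rbar) (f : R * R -> R) (x t : R) :
  cont2 I11 (time_dom T) f -> time_dom T t -> continuity_2d_pt (extend2 f) x t.
Proof.
  intros Hf Ht eps.
  destruct (time_dom_room T t Ht) as [d Hd].
  assert (Ht' : Rmax 0 t = t) by (destruct Ht; now apply Rmax_right).
  destruct (proj1 (continuous_in2_eps _ _ f (clamp x) t) (Hf (clamp x) t (clamp_I11 x) Ht) eps) as [e He].
  assert (Hm : 0 < Rmin d e) by (apply Rmin_glb_lt; apply cond_pos).
  exists (mkposreal _ Hm); intros u v Hu Hv; simpl in Hu, Hv.
  pose proof (Rmin_l d e); pose proof (Rmin_r d e).
  unfold extend2; rewrite Ht'; apply He.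
  - apply clamp_I11.
  - apply Hd; [apply Rmax_l|].
    apply Rmax_lub_lt; [pose proof (cond_pos d); destruct Ht; lra|apply Rabs_lt_between in Hv; lra].
  - pose proof (clamp_lip u x); lra.
  - pose proof (Rmax_0_lip v t) as Hl; rewrite Ht' in Hl; lra.
Qed.

Lemma continuity_2d_pt_1 (f : R -> R -> R) (x t : R) :
  continuity_2d_pt f x t -> continuous (fun y => f y t) x.
Proof.
  intros H; apply filterlim_locally; intros eps; destruct (H eps) as [d Hd].
  exists d; intros y Hy; apply Hd; auto.
  rewrite Rminus_diag, Rabs_R0; apply cond_pos.
Qed.

Lemma continuity_2d_pt_2 (f : R -> R -> R) (x t : R) :
  continuity_2d_pt f x t -> continuous (fun u => f x u) t.
Proof.
  intros H; apply filterlim_locally; intros eps; destruct (H eps) as [d Hd].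
  exists d; intros y Hy; apply Hd; auto.
  rewrite Rminus_diag, Rabs_R0; apply cond_pos.
Qed.

Lemma extend2_ex_RInt (T : Rbar) (f : R * R -> R) (t : R) :
  cont2 I11 (time_dom T) f -> time_dom T t -> ex_RInt (fun x => f (x, t)) (-1) 1.
Proof.
  intros Hf Ht; apply (ex_RInt_ext (fun x => extend2 f x t)).
  - intros x Hx; rewrite Rmin_left, Rmax_right in Hx by lra.
    apply (extend2_id T); auto; unfold I11, Icc; lra.
  - apply (ex_RInt_continuous (V := R_CompleteNormedModule)); intros x _.
    apply continuity_2d_pt_1, (extend2_continuity T); auto.
Qed.

Definition der1 (T : Rbar) (f f' : R * R -> R) : Prop :=
  forall x t, I11 x -> time_dom T t -> is_derive_in I11 (fun y => f (y, t)) x (f' (x, t)).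

Definition der2 (T : Rbar) (f f' : R * R -> R) : Prop :=
  forall x t, I11 x -> time_dom T t -> is_derive_in (time_dom T) (fun r => f (x, r)) t (f' (x, t)).

(** Also valid when an end point is 0, where the derivative is one-sided: the mean value theorem
    asks for derivatives at interior times, which are positive, and for continuity of the extension
    at the ends. *)
Lemma der2_mean_value (T : Rbar) (f f' : R * R -> R) (x t0 t : R) :
  cont2 I11 (time_dom T) f -> der2 T f f' -> I11 x -> time_dom T t0 -> time_dom T t ->
  exists c, Rmin t0 t <= c <= Rmax t0 t /\ f (x, t) - f (x, t0) = f' (x, c) * (t - t0).
Proof.
  intros Hf Hd Hx Ht0 Ht.
  assert (HJ : forall r, Rmin t0 t <= r <= Rmax t0 t -> time_dom T r).
  { intros r Hr; destruct Ht0 as [H1 H2], Ht as [H3 H4].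
    unfold Rmin, Rmax in Hr; destruct (Rle_dec t0 t).
    - split; [lra|apply Rbar_le_lt_trans with t; auto; simpl; lra].
    - split; [lra|apply Rbar_le_lt_trans with t0; auto; simpl; lra]. }
  destruct (MVT_gen (fun r => extend2 f x r) t0 t (fun r => f' (x, r))) as [c [Hc Heq]].
  - intros r Hr; assert (Hr' : time_dom T r) by (apply HJ; lra).
    assert (Hr0 : 0 < r).
    { destruct Ht0 as [H1 _], Ht as [H3 _]; unfold Rmin in Hr; destruct (Rle_dec t0 t); lra. }
    pose proof (locally_time_dom T r Hr' Hr0) as Hl.
    apply (is_derive_of_is_derive_in (time_dom T)); auto.
    apply (is_derive_in_ext _ (fun r => f (x, r))); auto.
    intros y Hy; symmetry; now apply (extend2_id T).
  - intros r Hr; apply continuity_pt_filterlim.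
    apply (continuity_2d_pt_2 (extend2 f)), (extend2_continuity T); auto.
  - exists c; split; auto.
    rewrite !(extend2_id T) in Heq by auto; exact Heq.
Qed.

(** By the mean value theorem each difference quotient is a value of f' at an intermediate time, and
    uniform continuity of f' near [-1,1] x {t0} makes the convergence uniform in x. *)
Lemma is_derive_in_RInt_param (T : Rbar) (f f' : R * R -> R) (t0 : R) :
  cont2 I11 (time_dom T) f -> cont2 I11 (time_dom T) f' -> der2 T f f' -> time_dom T t0 ->
  is_derive_in (time_dom T) (fun t => RInt (fun x => f (x, t)) (-1) 1) t0
    (RInt (fun x => f' (x, t0)) (-1) 1).
Proof.
  intros Hf Hf' Hd Ht0 eps Heps.
  (* The interval has length 2, so a pointwise error eps/4 integrates to at most eps/2. *)
  assert (He : 0 < eps / 4) by lra.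
  destruct (uniform_continuity_2d_1d (extend2 f') (-1) 1 t0
    ltac:(intros; now apply (extend2_continuity T)) (mkposreal _ He)) as [d Hu].
  exists d; split; [apply cond_pos|].
  change (forall t : R, (time_dom T t /\ t0 <> t) /\ Rabs (t - t0) < d ->
    Rabs ((RInt (fun x => f (x, t)) (-1) 1 - RInt (fun x => f (x, t0)) (-1) 1) / (t - t0)
    - RInt (fun x => f' (x, t0)) (-1) 1) < eps).
  intros t [[Ht Hne] Hdist].
  assert (Hx : forall x, I11 x ->
    Rabs ((f (x, t) - f (x, t0)) / (t - t0) - f' (x, t0)) <= eps / 4).
  { intros x Hx.
    destruct (der2_mean_value T f f' x t0 t Hf Hd Hx Ht0 Ht) as [c [Hc Heq]].
    rewrite Heq.
    assert (HJc : time_dom T c).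
    { destruct Ht0 as [H1 H2], Ht as [H3 H4]; unfold Rmin, Rmax in Hc; destruct (Rle_dec t0 t).
      - split; [lra|apply Rbar_le_lt_trans with t; auto; simpl; lra].
      - split; [lra|apply Rbar_le_lt_trans with t0; auto; simpl; lra]. }
    replace (f' (x, c) * (t - t0) / (t - t0)) with (f' (x, c)) by (field; lra).
    rewrite <- (extend2_id T f' x c), <- (extend2_id T f' x t0) by auto.
    left; apply Hu; try exact Hx.
    - pose proof (cond_pos d); lra.
    - apply Rabs_lt_between in Hdist; unfold Rmin, Rmax in Hc; destruct (Rle_dec t0 t); lra.
    - rewrite Rminus_diag, Rabs_R0; apply cond_pos. }
  pose proof (RInt_correct (V := R_CompleteNormedModule) _ _ _ (extend2_ex_RInt T f t Hf Ht)) as I1.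
  pose proof (RInt_correct (V := R_CompleteNormedModule) _ _ _ (extend2_ex_RInt T f t0 Hf Ht0)) as I2.
  pose proof (RInt_correct (V := R_CompleteNormedModule) _ _ _ (extend2_ex_RInt T f' t0 Hf' Ht0)) as I3.
  pose proof (is_RInt_minus (V := R_NormedModule) _ _ _ _ _ _ I1 I2) as I4.
  pose proof (is_RInt_scal (V := R_NormedModule) _ _ _ (/ (t - t0)) _ I4) as I5.
  pose proof (is_RInt_minus (V := R_NormedModule) _ _ _ _ _ _ I5 I3) as I6.
  apply (norm_RInt_le_const (V := R_NormedModule) _ (-1) 1 _ (eps / 4)) in I6; [|lra|].
  - match goal with |- Rabs ?z < _ => assert (Hz : Rabs z <= (1 - -1) * (eps / 4)) end; [|lra].
    eapply Rle_trans; [|exact I6]; right.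
    unfold norm; simpl; unfold abs; simpl; f_equal.
    unfold minus, plus, opp, scal; simpl; unfold mult; simpl; field; lra.
  - intros x Hx'; eapply Rle_trans; [|apply (Hx x); exact Hx']; right.
    unfold norm; simpl; unfold abs; simpl; f_equal.
    unfold minus, plus, opp, scal; simpl; unfold mult; simpl; field; lra.
Qed.

(** * Partial derivatives of smooth families and their symmetry *)

(** Uncurried [partials], as [falg] requires. The head of [w] is the derivative taken last:
    [false :: true :: nil] is the time derivative of the space derivative. *)
Definition pr (T : Rbar) (w : list bool) (f : R -> R -> R) (p : R * R) : R :=
  partials I11 (time_dom T) w f (fst p) (snd p).

Lemma pr_cont2 (T : Rbar) (w : list bool) (f : R -> R -> R) :
  smooth_in2 I11 (time_dom T) f -> cont2 I11 (time_dom T) (pr T w f).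
Proof. intros Hf x t Hx Ht; exact (proj1 (Hf w x t Hx Ht)). Qed.

Lemma pr_der1 (T : Rbar) (w : list bool) (f : R -> R -> R) :
  smooth_in2 I11 (time_dom T) f -> der1 T (pr T w f) (pr T (true :: w) f).
Proof.
  intros Hf x t Hx Ht; apply (derive_in_correct I11 (fun y => pr T w f (y, t)) x); auto.
  - apply perfect_I11.
  - exact (proj1 (proj2 (Hf w x t Hx Ht))).
Qed.

Lemma pr_der2 (T : Rbar) (w : list bool) (f : R -> R -> R) : Rbar_lt 0 T ->
  smooth_in2 I11 (time_dom T) f -> der2 T (pr T w f) (pr T (false :: w) f).
Proof.
  intros HT Hf x t Hx Ht; apply (derive_in_correct (time_dom T) (fun r => pr T w f (x, r)) t); auto.
  - now apply perfect_time_dom.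
  - exact (proj2 (proj2 (Hf w x t Hx Ht))).
Qed.

Lemma continuity_2d_pt_of_cont2 (T : Rbar) (f : R * R -> R) (x t : R) :
  cont2 I11 (time_dom T) f -> -1 < x < 1 -> 0 < t -> time_dom T t ->
  continuity_2d_pt (fun u v => f (u, v)) x t.
Proof.
  intros Hf Hx Ht HJ.
  destruct (locally_I11 x Hx) as [d1 H1]; destruct (locally_time_dom T t HJ Ht) as [d2 H2].
  intros eps; destruct (proj1 (continuous_in2_eps _ _ f x t)
    (Hf x t (H1 x (ball_center x d1)) HJ) eps) as [d3 H3].
  assert (Hm : 0 < Rmin d1 (Rmin d2 d3)) by (repeat apply Rmin_glb_lt; apply cond_pos).
  exists (mkposreal _ Hm); simpl; intros u v Hu Hv.
  pose proof (Rmin_l d1 (Rmin d2 d3)); pose proof (Rmin_r d1 (Rmin d2 d3)).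
  pose proof (Rmin_l d2 d3); pose proof (Rmin_r d2 d3).
  apply H3; try lra.
  - apply H1; change (Rabs (u - x) < d1); lra.
  - apply H2; change (Rabs (v - t) < d2); lra.
Qed.

Lemma der1_interior (T : Rbar) (f f' : R * R -> R) (x t : R) :
  der1 T f f' -> -1 < x < 1 -> time_dom T t -> is_derive (fun y => f (y, t)) x (f' (x, t)).
Proof.
  intros Hd Hx Ht; apply (is_derive_of_is_derive_in I11); [now apply locally_I11|].
  apply Hd; auto; unfold I11, Icc; lra.
Qed.

Lemma der2_interior (T : Rbar) (f f' : R * R -> R) (x t : R) :
  der2 T f f' -> I11 x -> 0 < t -> time_dom T t -> is_derive (fun r => f (x, r)) t (f' (x, t)).
Proof.
  intros Hd Hx H0 Ht; apply (is_derive_of_is_derive_in (time_dom T)); [now apply locally_time_dom|].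
  now apply Hd.
Qed.

Lemma locally_2d_interior (T : Rbar) (P : R -> R -> Prop) (x t : R) :
  -1 < x < 1 -> 0 < t -> time_dom T t ->
  (forall u v, -1 < u < 1 -> 0 < v -> time_dom T v -> P u v) -> locally_2d P x t.
Proof.
  intros Hx Ht HJ HP.
  destruct (time_dom_room T t HJ) as [d Hd].
  assert (Hm : 0 < Rmin d (Rmin t (Rmin (x + 1) (1 - x)))) by (repeat apply Rmin_glb_lt; try apply cond_pos; lra).
  exists (mkposreal _ Hm); simpl; intros u v Hu Hv.
  pose proof (Rmin_l d (Rmin t (Rmin (x + 1) (1 - x)))); pose proof (Rmin_r d (Rmin t (Rmin (x + 1) (1 - x)))).
  pose proof (Rmin_l t (Rmin (x + 1) (1 - x))); pose proof (Rmin_r t (Rmin (x + 1) (1 - x))).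
  pose proof (Rmin_l (x + 1) (1 - x)); pose proof (Rmin_r (x + 1) (1 - x)).
  apply Rabs_lt_between in Hu; apply Rabs_lt_between in Hv.
  apply HP; [lra|lra|apply Hd; lra].
Qed.

(** In the open domain relative derivatives are ordinary ones and Schwarz's theorem applies;
    [cont2_dense] then reaches the end points and t = 0, where the first variation is computed. *)
Lemma pr_swap (T : Rbar) (w : list bool) (f : R -> R -> R) (x t : R) : Rbar_lt 0 T ->
  smooth_in2 I11 (time_dom T) f -> I11 x -> time_dom T t ->
  pr T (false :: true :: w) f (x, t) = pr T (true :: false :: w) f (x, t).
Proof.
  intros HT Hf; apply cont2_dense; try (now apply pr_cont2).
  clear x t; intros x t Hx Ht HJ.
  set (h := fun u v => pr T w f (u, v)).
  pose proof (pr_der1 T w f Hf) as D1; pose proof (pr_der2 T w f HT Hf) as D2.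
  pose proof (pr_der2 T (true :: w) f HT Hf) as D12; pose proof (pr_der1 T (false :: w) f Hf) as D21.
  assert (HI : forall u, -1 < u < 1 -> I11 u) by (intros; unfold I11, Icc; lra).
  assert (E1 : forall u v, -1 < u < 1 -> time_dom T v -> Derive (fun z => h z v) u = pr T (true :: w) f (u, v)).
  { intros; apply is_derive_unique; now apply (der1_interior T (pr T w f)). }
  assert (E2 : forall u v, -1 < u < 1 -> 0 < v -> time_dom T v -> Derive (fun z => h u z) v = pr T (false :: w) f (u, v)).
  { intros; apply is_derive_unique; apply (der2_interior T (pr T w f)); auto. }
  assert (E12 : forall u v, -1 < u < 1 -> 0 < v -> time_dom T v ->
     is_derive (fun z => Derive (fun t => h t z) u) v (pr T (false :: true :: w) f (u, v))).
  { intros u v Hu Hv HJv.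
    apply (is_derive_ext_loc (fun z => pr T (true :: w) f (u, z))).
    - destruct (locally_time_dom T v HJv Hv) as [d Hd]; exists d; intros y Hy; symmetry; apply E1; auto.
    - apply (der2_interior T (pr T (true :: w) f)); auto. }
  assert (E21 : forall u v, -1 < u < 1 -> 0 < v -> time_dom T v ->
     is_derive (fun z => Derive (fun t => h z t) v) u (pr T (true :: false :: w) f (u, v))).
  { intros u v Hu Hv HJv.
    apply (is_derive_ext_loc (fun z => pr T (false :: w) f (z, v))).
    - destruct (locally_interval (fun z => -1 < z < 1) u (-1) 1) as [d Hd]; simpl; try lra; auto.
      exists d; intros y Hy; symmetry; apply E2; auto.
    - now apply (der1_interior T (pr T (false :: w) f)). }
  rewrite <- (is_derive_unique _ _ _ (E12 x t Hx Ht HJ)), <- (is_derive_unique _ _ _ (E21 x t Hx Ht HJ)).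
  symmetry; apply (Schwarz h).
  - apply (locally_2d_interior T); auto; intros u v Hu Hv HJv; repeat split.
    + exists (pr T (true :: w) f (u, v)); exact (der1_interior T (pr T w f) _ u v D1 Hu HJv).
    + exists (pr T (false :: w) f (u, v)); exact (der2_interior T (pr T w f) _ u v D2 (HI u Hu) Hv HJv).
    + eexists; apply (E21 u v Hu Hv HJv).
    + eexists; apply (E12 u v Hu Hv HJv).
  - apply (continuity_2d_pt_ext_loc (fun u v => pr T (true :: false :: w) f (u, v))).
    + apply (locally_2d_interior T); auto; intros u v Hu Hv HJv; symmetry; apply is_derive_unique; auto.
    + apply (continuity_2d_pt_of_cont2 T); auto; now apply pr_cont2.
  - apply (continuity_2d_pt_ext_loc (fun u v => pr T (false :: true :: w) f (u, v))).
    + apply (locally_2d_interior T); auto; intros u v Hu Hv HJv; symmetry; apply is_derive_unique; auto.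
    + apply (continuity_2d_pt_of_cont2 T); auto; now apply pr_cont2.
Qed.

(** * Smooth families of immersed curves and their function algebra *)

(** Smoothness and immersion suffice for the calculus of curvature, length and energy. The flow
    equation enters separately, through [elastic_flow_velocity]. *)
Record regular_family (T : Rbar) (X Y : R -> R -> R) : Prop := {
  rf_T : Rbar_lt 0 T;
  rf_X : smooth_in2 I11 (time_dom T) X;
  rf_Y : smooth_in2 I11 (time_dom T) Y;
  rf_imm : forall x t, I11 x -> time_dom T t ->
    0 < pr T (true :: nil) X (x, t) ^ 2 + pr T (true :: nil) Y (x, t) ^ 2
}.

Definition inv_speed (T : Rbar) (X Y : R -> R -> R) (p : R * R) : R :=
  / sqrt (pr T (true :: nil) X p ^ 2 + pr T (true :: nil) Y p ^ 2).

(** The inverse speed is the one ingredient that is not polynomial in partial derivatives. Its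
    derivatives are polynomial in itself and in partials, so the algebra is closed under both
    derivations. *)
Inductive fam_gen (T : Rbar) (X Y : R -> R -> R) : (R * R -> R) -> Prop :=
| fam_x w : fam_gen T X Y (pr T w X)
| fam_y w : fam_gen T X Y (pr T w Y)
| fam_inv : fam_gen T X Y (inv_speed T X Y).

Definition fam (T : Rbar) (X Y : R -> R -> R) : (R * R -> R) -> Prop := falg (fam_gen T X Y).

Ltac fam_tac := unfold fam; repeat first
  [ assumption | apply falg_const | apply falg_gen; now constructor | apply falg_mult | apply falg_plus ].

Lemma fam_cont2 (T : Rbar) (X Y : R -> R -> R) (f : R * R -> R) :
  regular_family T X Y -> fam T X Y f -> cont2 I11 (time_dom T) f.
Proof.
  intros HR Hf; induction Hf as [f Hf|c|f g Hf IHf Hg IHg|f g Hf IHf Hg IHg].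
  - destruct Hf as [w|w|].
    + apply pr_cont2, (rf_X _ _ _ HR).
    + apply pr_cont2, (rf_Y _ _ _ HR).
    + unfold inv_speed.
      apply (cont2_comp _ _ (fun p => pr T (true :: nil) X p ^ 2 + pr T (true :: nil) Y p ^ 2) (fun z => / sqrt z)).
      * apply cont2_plus; simpl; repeat apply cont2_mult; try apply cont2_const;
          apply pr_cont2; [apply (rf_X _ _ _ HR)|apply (rf_X _ _ _ HR)|apply (rf_Y _ _ _ HR)|apply (rf_Y _ _ _ HR)].
      * intros x t Hx Ht; pose proof (rf_imm _ _ _ HR x t Hx Ht) as Hp.
        apply (ex_derive_continuous (fun z => / sqrt z)); auto_derive; repeat split; auto.
        apply Rgt_not_eq, sqrt_lt_R0, Hp.
  - apply cont2_const.
  - now apply cont2_plus.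
  - now apply cont2_mult.
Qed.

Lemma is_derive_in_inv_speed (D : R -> Prop) (f g : R -> R) (x f' g' : R) :
  is_derive_in D f x f' -> is_derive_in D g x g' -> 0 < f x ^ 2 + g x ^ 2 ->
  is_derive_in D (fun y => / sqrt (f y ^ 2 + g y ^ 2)) x
    (-1 * (f x * f' + g x * g') * (/ sqrt (f x ^ 2 + g x ^ 2) * / sqrt (f x ^ 2 + g x ^ 2) * / sqrt (f x ^ 2 + g x ^ 2))).
Proof.
  intros Hf Hg Hp; pose proof (sqrt_lt_R0 _ Hp) as Hs; eapply is_derive_in_eq.
  - apply (is_derive_in_inv D (fun y => sqrt (f y ^ 2 + g y ^ 2))); [lra|].
    apply (is_derive_in_sqrt D (fun y => f y ^ 2 + g y ^ 2)); auto.
    apply (is_derive_in_plus D (fun y => f y ^ 2) (fun y => g y ^ 2)).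
    + apply (is_derive_in_comp D f (fun z => z ^ 2) x f' (2 * f x)); [exact Hf|auto_derive; auto; ring].
    + apply (is_derive_in_comp D g (fun z => z ^ 2) x g' (2 * g x)); [exact Hg|auto_derive; auto; ring].
  - field; lra.
Qed.

(** [b] selects the variable of differentiation with the convention of [partials]. *)
Definition inv_speed' (T : Rbar) (X Y : R -> R -> R) (b : bool) (p : R * R) : R :=
  -1 * (pr T (true :: nil) X p * pr T (b :: true :: nil) X p + pr T (true :: nil) Y p * pr T (b :: true :: nil) Y p)
  * (inv_speed T X Y p * inv_speed T X Y p * inv_speed T X Y p).

Lemma inv_speed_der1 (T : Rbar) (X Y : R -> R -> R) :
  regular_family T X Y -> der1 T (inv_speed T X Y) (inv_speed' T X Y true).
Proof.
  intros HR x t Hx Ht.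
  apply (is_derive_in_inv_speed I11 (fun y => pr T (true :: nil) X (y, t)) (fun y => pr T (true :: nil) Y (y, t))).
  - apply (pr_der1 T (true :: nil) X (rf_X _ _ _ HR)); auto.
  - apply (pr_der1 T (true :: nil) Y (rf_Y _ _ _ HR)); auto.
  - apply (rf_imm _ _ _ HR); auto.
Qed.

Lemma inv_speed_der2 (T : Rbar) (X Y : R -> R -> R) :
  regular_family T X Y -> der2 T (inv_speed T X Y) (inv_speed' T X Y false).
Proof.
  intros HR x t Hx Ht.
  apply (is_derive_in_inv_speed (time_dom T) (fun r => pr T (true :: nil) X (x, r)) (fun r => pr T (true :: nil) Y (x, r))).
  - apply (pr_der2 T (true :: nil) X (rf_T _ _ _ HR) (rf_X _ _ _ HR)); auto.
  - apply (pr_der2 T (true :: nil) Y (rf_T _ _ _ HR) (rf_Y _ _ _ HR)); auto.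
  - apply (rf_imm _ _ _ HR); auto.
Qed.

Lemma fam_inv_speed' (T : Rbar) (X Y : R -> R -> R) (b : bool) : fam T X Y (inv_speed' T X Y b).
Proof. unfold inv_speed'; fam_tac. Qed.

Lemma fam_der1 (T : Rbar) (X Y : R -> R -> R) (f : R * R -> R) :
  regular_family T X Y -> fam T X Y f -> exists f', fam T X Y f' /\ der1 T f f'.
Proof.
  intros HR; apply falg_derivation.
  - intros c x t _ _; apply is_derive_in_const.
  - intros g g' h h' H1 H2 x t Hx Ht.
    apply (is_derive_in_plus I11 (fun y => g (y, t)) (fun y => h (y, t))); auto.
  - intros g g' h h' H1 H2 x t Hx Ht.
    apply (is_derive_in_mult I11 (fun y => g (y, t)) (fun y => h (y, t))); auto.
  - intros g Hg; destruct Hg as [w|w|].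
    + exists (pr T (true :: w) X); split; [fam_tac|apply pr_der1, (rf_X _ _ _ HR)].
    + exists (pr T (true :: w) Y); split; [fam_tac|apply pr_der1, (rf_Y _ _ _ HR)].
    + exists (inv_speed' T X Y true); split; [apply fam_inv_speed'|now apply inv_speed_der1].
Qed.

Lemma fam_der2 (T : Rbar) (X Y : R -> R -> R) (f : R * R -> R) :
  regular_family T X Y -> fam T X Y f -> exists f', fam T X Y f' /\ der2 T f f'.
Proof.
  intros HR; apply falg_derivation.
  - intros c x t _ _; apply is_derive_in_const.
  - intros g g' h h' H1 H2 x t Hx Ht.
    apply (is_derive_in_plus (time_dom T) (fun r => g (x, r)) (fun r => h (x, r))); auto.
  - intros g g' h h' H1 H2 x t Hx Ht.
    apply (is_derive_in_mult (time_dom T) (fun r => g (x, r)) (fun r => h (x, r))); auto.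
  - intros g Hg; destruct Hg as [w|w|].
    + exists (pr T (false :: w) X); split; [fam_tac|apply pr_der2; [apply (rf_T _ _ _ HR)|apply (rf_X _ _ _ HR)]].
    + exists (pr T (false :: w) Y); split; [fam_tac|apply pr_der2; [apply (rf_T _ _ _ HR)|apply (rf_Y _ _ _ HR)]].
    + exists (inv_speed' T X Y false); split; [apply fam_inv_speed'|now apply inv_speed_der2].
Qed.

(** * Geometry of the slices of a family *)

Definition slice (X Y : R -> R -> R) (t y : R) : R * R := (X y t, Y y t).

Definition fam_cross (T : Rbar) (X Y : R -> R -> R) (p : R * R) : R :=
  pr T (true :: nil) X p * pr T (true :: true :: nil) Y p
  + -1 * (pr T (true :: nil) Y p * pr T (true :: true :: nil) X p).

Definition fam_kappa (T : Rbar) (X Y : R -> R -> R) (p : R * R) : R :=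
  fam_cross T X Y p * (inv_speed T X Y p * inv_speed T X Y p * inv_speed T X Y p).

Lemma fam_fam_cross (T : Rbar) (X Y : R -> R -> R) : fam T X Y (fam_cross T X Y).
Proof. unfold fam_cross; fam_tac. Qed.

Lemma fam_fam_kappa (T : Rbar) (X Y : R -> R -> R) : fam T X Y (fam_kappa T X Y).
Proof. pose proof (fam_fam_cross T X Y); unfold fam_kappa; fam_tac. Qed.

Lemma slice_x1 (T : Rbar) (X Y : R -> R -> R) (t : R) : regular_family T X Y -> time_dom T t ->
  derives_in I11 (fun y => fst (slice X Y t y)) (fun y => pr T (true :: nil) X (y, t)).
Proof. intros HR Ht x Hx; apply (pr_der1 T nil X (rf_X _ _ _ HR)); auto. Qed.

Lemma slice_y1 (T : Rbar) (X Y : R -> R -> R) (t : R) : regular_family T X Y -> time_dom T t ->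
  derives_in I11 (fun y => snd (slice X Y t y)) (fun y => pr T (true :: nil) Y (y, t)).
Proof. intros HR Ht x Hx; apply (pr_der1 T nil Y (rf_Y _ _ _ HR)); auto. Qed.

Lemma slice_speed (T : Rbar) (X Y : R -> R -> R) (x t : R) : regular_family T X Y -> I11 x -> time_dom T t ->
  speed I11 (slice X Y t) x = / inv_speed T X Y (x, t).
Proof.
  intros HR Hx Ht; rewrite (speed_eq I11 (slice X Y t) _ _ x perfect_I11 (slice_x1 T X Y t HR Ht) (slice_y1 T X Y t HR Ht) Hx).
  unfold inv_speed; now rewrite Rinv_inv.
Qed.

Lemma inv_speed_pos (T : Rbar) (X Y : R -> R -> R) (x t : R) : regular_family T X Y -> I11 x -> time_dom T t ->
  0 < inv_speed T X Y (x, t).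
Proof. intros HR Hx Ht; apply Rinv_0_lt_compat, sqrt_lt_R0, (rf_imm _ _ _ HR); auto. Qed.

Lemma inv_speed_sq (T : Rbar) (X Y : R -> R -> R) (x t : R) : regular_family T X Y -> I11 x -> time_dom T t ->
  (pr T (true :: nil) X (x, t) ^ 2 + pr T (true :: nil) Y (x, t) ^ 2) * inv_speed T X Y (x, t) ^ 2 = 1.
Proof.
  intros HR Hx Ht; pose proof (rf_imm _ _ _ HR x t Hx Ht) as Hp; unfold inv_speed.
  rewrite pow_inv, pow2_sqrt by lra; field; lra.
Qed.

Lemma slice_kappa (T : Rbar) (X Y : R -> R -> R) (x t : R) : regular_family T X Y -> I11 x -> time_dom T t ->
  curvature I11 (slice X Y t) x = fam_kappa T X Y (x, t).
Proof.
  intros HR Hx Ht.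
  rewrite (curvature_eq I11 (slice X Y t) _ _ (fun y => pr T (true :: true :: nil) X (y, t)) (fun y => pr T (true :: true :: nil) Y (y, t)) x perfect_I11
    (slice_x1 T X Y t HR Ht) (slice_y1 T X Y t HR Ht)); auto.
  - pose proof (rf_imm _ _ _ HR x t Hx Ht) as Hp; pose proof (sqrt_lt_R0 _ Hp).
    unfold fam_kappa, fam_cross, inv_speed; field; lra.
  - intros y Hy; apply (pr_der1 T (true :: nil) X (rf_X _ _ _ HR)); auto.
  - intros y Hy; apply (pr_der1 T (true :: nil) Y (rf_Y _ _ _ HR)); auto.
  - apply (rf_imm _ _ _ HR); auto.
Qed.

Lemma slice_d_s (T : Rbar) (X Y : R -> R -> R) (h : R -> R -> R) (f : R * R -> R) :
  regular_family T X Y -> fam T X Y f ->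
  (forall x t, I11 x -> time_dom T t -> h t x = f (x, t)) ->
  exists f', fam T X Y f' /\
    forall x t, I11 x -> time_dom T t -> d_s I11 (slice X Y t) (h t) x = f' (x, t).
Proof.
  intros HR Hf Hh; destruct (fam_der1 T X Y f HR Hf) as [f' [Hf' Hd]].
  exists (fun p => f' p * inv_speed T X Y p); split; [fam_tac|].
  intros x t Hx Ht.
  rewrite (d_s_eq I11 _ _ x (f' (x, t)) perfect_I11 Hx).
  - rewrite (slice_speed T) by auto; unfold Rdiv; now rewrite Rinv_inv.
  - apply (is_derive_in_ext I11 (fun y => f (y, t))); auto.
    intros y Hy; symmetry; auto.
Qed.

(** Membership in the algebra already gives continuity up to the boundary and to time 0, so the
    second arclength derivative of the curvature is never expanded. *)
Lemma slice_elastic (T : Rbar) (X Y : R -> R -> R) : regular_family T X Y ->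
  exists F, fam T X Y F /\ forall x t, I11 x -> time_dom T t ->
    curvature_ss I11 (slice X Y t) x + 1 / 2 * curvature I11 (slice X Y t) x ^ 3 = F (x, t).
Proof.
  intros HR; pose proof (fam_fam_kappa T X Y) as Hk.
  destruct (slice_d_s T X Y (fun t => curvature I11 (slice X Y t)) (fam_kappa T X Y) HR Hk) as [k1 [Hk1 E1]].
  { intros; now apply slice_kappa. }
  destruct (slice_d_s T X Y (fun t => curvature_s I11 (slice X Y t)) k1 HR Hk1 E1) as [k2 [Hk2 E2]].
  exists (fun p => k2 p + 1 / 2 * (fam_kappa T X Y p * fam_kappa T X Y p * fam_kappa T X Y p)); split; [fam_tac|].
  intros x t Hx Ht; unfold curvature_ss; rewrite E2, (slice_kappa T) by auto; ring.
Qed.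

Lemma speed_ext (D : R -> Prop) (g h : R -> R * R) (x : R) :
  (forall y, D y -> g y = h y) -> D x -> speed D g x = speed D h x.
Proof.
  intros H Hx; unfold speed.
  rewrite (derive_in_ext D (fun y => fst (g y)) (fun y => fst (h y))),
    (derive_in_ext D (fun y => snd (g y)) (fun y => snd (h y))); auto; intros; now rewrite H.
Qed.

Lemma d_s_ext (D : R -> Prop) (g h : R -> R * R) (f f' : R -> R) (x : R) :
  (forall y, D y -> g y = h y) -> (forall y, D y -> f y = f' y) -> D x ->
  d_s D g f x = d_s D h f' x.
Proof.
  intros H Hf Hx; unfold d_s; now rewrite (derive_in_ext D f f'), (speed_ext D g h).
Qed.

Lemma tangent_ext (D : R -> Prop) (g h : R -> R * R) (x : R) :
  (forall y, D y -> g y = h y) -> D x -> tangent D g x = tangent D h x.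
Proof.
  intros H Hx; unfold tangent; f_equal; apply d_s_ext; auto; intros; now rewrite H.
Qed.

Lemma curvature_ext (D : R -> Prop) (g h : R -> R * R) (x : R) :
  (forall y, D y -> g y = h y) -> D x -> curvature D g x = curvature D h x.
Proof.
  intros H Hx; unfold curvature, normal; rewrite (tangent_ext D g h) by auto.
  f_equal; f_equal; apply d_s_ext; auto; intros; now rewrite (tangent_ext D g h).
Qed.

Lemma curvature_s_ext (D : R -> Prop) (g h : R -> R * R) (x : R) :
  (forall y, D y -> g y = h y) -> D x -> curvature_s D g x = curvature_s D h x.
Proof. intros H Hx; apply d_s_ext; auto; intros; now apply curvature_ext. Qed.

Lemma curvature_ss_ext (D : R -> Prop) (g h : R -> R * R) (x : R) :
  (forall y, D y -> g y = h y) -> D x -> curvature_ss D g x = curvature_ss D h x.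
Proof. intros H Hx; apply d_s_ext; auto; intros; now apply curvature_s_ext. Qed.

Lemma int_ds_ext (g h : R -> R * R) (f f' : R -> R) :
  (forall y, I11 y -> g y = h y) -> (forall y, I11 y -> f y = f' y) -> int_ds g f = int_ds h f'.
Proof.
  intros H Hf; apply (RInt_ext (V := R_CompleteNormedModule)); intros x Hx.
  rewrite Rmin_left, Rmax_right in Hx by lra.
  assert (Hx' : I11 x) by (unfold I11, Icc; lra).
  now rewrite Hf, (speed_ext I11 g h).
Qed.

Lemma turning_number_ext (g h : R -> R * R) :
  (forall y, I11 y -> g y = h y) -> turning_number g = turning_number h.
Proof.
  intros H; unfold turning_number; f_equal; apply int_ds_ext; auto.
  intros; now apply curvature_ext.
Qed.

Lemma energy_hat_ext (g h : R -> R * R) :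
  (forall y, I11 y -> g y = h y) -> energy_hat g = energy_hat h.
Proof.
  intros H; unfold energy_hat, length_of, energy.
  rewrite (int_ds_ext g h (fun _ => 1) (fun _ => 1)) by auto; do 2 f_equal.
  apply int_ds_ext; auto; intros; now rewrite (curvature_ext I11 g h).
Qed.

(** * Elastic flows *)

Definition fst2 (g : R -> R -> R * R) (x t : R) : R := fst (g x t).
Definition snd2 (g : R -> R -> R * R) (x t : R) : R := snd (g x t).

Lemma elastic_flow_regular (T : Rbar) (g : R -> R -> R * R) :
  elastic_flow T g -> regular_family T (fst2 g) (snd2 g).
Proof.
  intros (HT & HX & HY & _ & HC); split; auto.
  intros x t Hx Ht; destruct (HC t Ht) as (_ & Hs & _).
  specialize (Hs x Hx).
  change (sqrt (pr T (true :: nil) (fst2 g) (x, t) ^ 2 + pr T (true :: nil) (snd2 g) (x, t) ^ 2) <> 0) in Hs.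
  pose proof (pow2_ge_0 (pr T (true :: nil) (fst2 g) (x, t))).
  pose proof (pow2_ge_0 (pr T (true :: nil) (snd2 g) (x, t))).
  destruct (Req_dec (pr T (true :: nil) (fst2 g) (x, t) ^ 2 + pr T (true :: nil) (snd2 g) (x, t) ^ 2) 0) as [E|E]; [|lra].
  rewrite E, sqrt_0 in Hs; contradiction.
Qed.

Lemma slice_tangent (T : Rbar) (X Y : R -> R -> R) (x t : R) :
  regular_family T X Y -> I11 x -> time_dom T t ->
  tangent I11 (slice X Y t) x =
   (pr T (true :: nil) X (x, t) * inv_speed T X Y (x, t), pr T (true :: nil) Y (x, t) * inv_speed T X Y (x, t)).
Proof.
  intros HR Hx Ht.
  exact (tangent_eq I11 (slice X Y t) _ _ x perfect_I11 (slice_x1 T X Y t HR Ht) (slice_y1 T X Y t HR Ht) Hx).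
Qed.

(* The flow equation holds in the open domain only; by density it extends to
   the boundary and to the initial time. *)
Lemma elastic_flow_velocity (T : Rbar) (g : R -> R -> R * R) (x t : R) :
  elastic_flow T g -> I11 x -> time_dom T t ->
  let c := fun y => g y t in
  let F := curvature_ss I11 c x + 1 / 2 * curvature I11 c x ^ 3 in
  pr T (false :: nil) (fst2 g) (x, t) = F * snd (tangent I11 c x) /\
  pr T (false :: nil) (snd2 g) (x, t) = - F * fst (tangent I11 c x).
Proof.
  intros HF Hx Ht c F; pose proof (elastic_flow_regular T g HF) as HR.
  destruct HF as (HT & HX & HY & HE & _).
  set (X := fst2 g) in *; set (Y := snd2 g) in *.
  destruct (slice_elastic T X Y HR) as (Ff & HFf & EF).
  assert (EF' : F = Ff (x, t)) by exact (EF x t Hx Ht).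
  change (tangent I11 c x) with (tangent I11 (slice X Y t) x).
  rewrite (slice_tangent T X Y x t HR Hx Ht), EF'; cbn [fst snd].
  assert (HP : forall x t, -1 < x < 1 -> 0 < t -> time_dom T t ->
    pr T (false :: nil) X (x, t) = Ff (x, t) * (pr T (true :: nil) Y (x, t) * inv_speed T X Y (x, t)) /\
    pr T (false :: nil) Y (x, t) = -1 * Ff (x, t) * (pr T (true :: nil) X (x, t) * inv_speed T X Y (x, t))).
  { clear x t Hx Ht c F EF'; intros x t Hx H0 Ht.
    assert (Hx' : I11 x) by (unfold I11, Icc; lra).
    destruct (HE x t Hx H0 (proj2 Ht)) as [E1 E2].
    pose proof (der2_interior T (pr T nil X) _ x t (pr_der2 T nil X HT HX) Hx' H0 Ht) as D1.
    pose proof (der2_interior T (pr T nil Y) _ x t (pr_der2 T nil Y HT HY) Hx' H0 Ht) as D2.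
    change (is_derive (fun r => X x r) t (- (curvature_ss I11 (slice X Y t) x + 1 / 2 * curvature I11 (slice X Y t) x ^ 3)
      * fst (normal I11 (slice X Y t) x))) in E1.
    change (is_derive (fun r => Y x r) t (- (curvature_ss I11 (slice X Y t) x + 1 / 2 * curvature I11 (slice X Y t) x ^ 3)
      * snd (normal I11 (slice X Y t) x))) in E2.
    unfold normal in E1, E2; rewrite (EF x t Hx' Ht), (slice_tangent T X Y x t HR Hx' Ht) in E1, E2; cbn [fst snd] in E1, E2.
    change (is_derive (fun r => X x r) t (pr T (false :: nil) X (x, t))) in D1.
    change (is_derive (fun r => Y x r) t (pr T (false :: nil) Y (x, t))) in D2.
    rewrite <- (is_derive_unique _ _ _ D1), <- (is_derive_unique _ _ _ D2).
    rewrite (is_derive_unique _ _ _ E1), (is_derive_unique _ _ _ E2); split; ring. }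
  split.
  - apply (cont2_dense T (pr T (false :: nil) X) (fun p => Ff p * (pr T (true :: nil) Y p * inv_speed T X Y p))); auto.
    + now apply pr_cont2.
    + apply (fam_cont2 T X Y); auto; fam_tac.
    + intros; now apply HP.
  - replace (- Ff (x, t)) with (-1 * Ff (x, t)) by ring.
    apply (cont2_dense T (pr T (false :: nil) Y) (fun p => -1 * Ff p * (pr T (true :: nil) X p * inv_speed T X Y p))); auto.
    + now apply pr_cont2.
    + apply (fam_cont2 T X Y); auto; fam_tac.
    + intros; now apply HP.
Qed.

(** * The turning number is constant along the flow *)

(** Composition with a 1-Lipschitz retraction turns a function differentiable relative to [D] into a
    continuous function on the line, ready for the mean and intermediate value theorems. *)
Lemma continuity_retract (D : R -> Prop) (r f : R -> R) :
  (forall x, D (r x)) -> (forall x y, Rabs (r x - r y) <= Rabs (x - y)) ->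
  (forall x, D x -> ex_derive_in D f x) -> continuity (fun x => f (r x)).
Proof.
  intros HD Hr Hf x.
  destruct (Hf (r x) (HD x)) as [l Hl]; apply cont_deriv in Hl.
  intros eps He; destruct (Hl eps He) as (al & Hal & Hc); exists al; split; auto.
  intros y [_ Hy].
  destruct (Req_dec (r y) (r x)) as [E|E].
  - change (Rabs (f (r y) - f (r x)) < eps); rewrite E, Rminus_diag, Rabs_R0; exact He.
  - apply Hc; split; [split; auto|].
    change (Rabs (y - x) < al) in Hy; change (Rabs (r y - r x) < al).
    pose proof (Hr y x); lra.
Qed.

Lemma constant_of_derives_0 (f : R -> R) : derives_in I11 f (fun _ => 0) -> f (-1) = f 1.
Proof.
  intros Hf.
  destruct (MVT_gen (fun x => f (clamp x)) (-1) 1 (fun _ => 0)) as [c [_ Hc]].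
  - intros x Hx; rewrite Rmin_left, Rmax_right in Hx by lra.
    apply (is_derive_of_is_derive_in I11); [now apply locally_I11|].
    assert (Hx' : I11 x) by (unfold I11, Icc; lra).
    apply (is_derive_in_ext I11 f); auto.
    intros; now rewrite clamp_id.
  - intros x _; apply (continuity_retract I11 clamp f); auto using clamp_I11, clamp_lip.
    intros y Hy; exists 0; now apply Hf.
  - rewrite !clamp_id in Hc by (unfold I11, Icc; lra); lra.
Qed.

(** Curvature times speed, that is, the density of kappa ds in the parameter x; two powers of the
    inverse speed remain out of three. *)
Definition fam_turn (T : Rbar) (X Y : R -> R -> R) (p : R * R) : R :=
  fam_cross T X Y p * (inv_speed T X Y p * inv_speed T X Y p).

Lemma fam_fam_turn (T : Rbar) (X Y : R -> R -> R) : fam T X Y (fam_turn T X Y).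
Proof. pose proof (fam_fam_cross T X Y); unfold fam_turn; fam_tac. Qed.

Lemma slice_int_kappa (T : Rbar) (X Y : R -> R -> R) (t : R) : regular_family T X Y -> time_dom T t ->
  int_ds (slice X Y t) (curvature I11 (slice X Y t)) = RInt (fun x => fam_turn T X Y (x, t)) (-1) 1.
Proof.
  intros HR Ht; apply (RInt_ext (V := R_CompleteNormedModule)); intros x Hx.
  rewrite Rmin_left, Rmax_right in Hx by lra.
  assert (Hx' : I11 x) by (unfold I11, Icc; lra).
  rewrite (slice_kappa T), (slice_speed T) by auto.
  pose proof (inv_speed_pos T X Y x t HR Hx' Ht).
  change (@eq R (fam_kappa T X Y (x, t) * / inv_speed T X Y (x, t)) (fam_turn T X Y (x, t))).
  unfold fam_kappa, fam_turn; field; lra.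
Qed.

(* The tangent (p, q) rotates with angular velocity kappa |gamma'|; rotating it back
   by the accumulated angle Th gives a constant vector, and q vanishes at both ends. *)
Lemma sin_total_curvature (T : Rbar) (X Y : R -> R -> R) (t : R) : regular_family T X Y -> time_dom T t ->
  pr T (true :: nil) Y (-1, t) = 0 -> pr T (true :: nil) Y (1, t) = 0 ->
  sin (RInt (fun x => fam_turn T X Y (x, t)) (-1) 1) = 0.
Proof.
  intros HR Ht Hm H1.
  set (w := fun x => extend2 (fam_turn T X Y) x t).
  assert (Hw : forall x, continuous w x).
  { intros x; apply continuity_2d_pt_1, (extend2_continuity T); auto.
    apply (fam_cont2 T X Y); auto; apply fam_fam_turn. }
  pose (Th := fun x => RInt w (-1) x).
  assert (HTh : forall x, is_derive Th x (w x)).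
  { intros x; apply (is_derive_RInt (V := R_NormedModule) w Th (-1)); auto.
    exists (mkposreal 1 Rlt_0_1); intros y _.
    apply (RInt_correct (V := R_CompleteNormedModule)), (ex_RInt_continuous (V := R_CompleteNormedModule)); auto. }
  replace (RInt (fun x => fam_turn T X Y (x, t)) (-1) 1) with (Th 1).
  2:{ apply (RInt_ext (V := R_CompleteNormedModule)); intros x Hx; rewrite Rmin_left, Rmax_right in Hx by lra.
      apply (extend2_id T); auto; unfold I11, Icc; lra. }
  set (x1 := fun x => pr T (true :: nil) X (x, t)); set (y1 := fun x => pr T (true :: nil) Y (x, t)).
  set (i := fun x => inv_speed T X Y (x, t)).
  assert (HI1 : I11 1) by (unfold I11, Icc; lra).
  (* Conservation of the second component of the tangent rotated back by [Th]. *)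
  assert (Hc : y1 (-1) * i (-1) * cos (Th (-1)) + - 1 * (x1 (-1) * i (-1) * sin (Th (-1)))
             = y1 1 * i 1 * cos (Th 1) + - 1 * (x1 1 * i 1 * sin (Th 1))).
  { apply (constant_of_derives_0 (fun x => y1 x * i x * cos (Th x) + - 1 * (x1 x * i x * sin (Th x)))).
    intros x Hx.
    pose proof (pr_der1 T (true :: nil) X (rf_X _ _ _ HR) x t Hx Ht) as DX.
    pose proof (pr_der1 T (true :: nil) Y (rf_Y _ _ _ HR) x t Hx Ht) as DY.
    pose proof (inv_speed_der1 T X Y HR x t Hx Ht) as Di.
    eapply is_derive_in_eq.
    - apply (is_derive_in_plus I11 (fun x => y1 x * i x * cos (Th x)) (fun x => - 1 * (x1 x * i x * sin (Th x)))).
      + apply (is_derive_in_mult I11 (fun x => y1 x * i x) (fun x => cos (Th x))).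
        * apply (is_derive_in_mult I11 y1 i); [exact DY|exact Di].
        * apply (is_derive_in_comp I11 Th cos x _ _ (is_derive_in_of_is_derive _ _ _ _ (HTh x)) (is_derive_cos (Th x))).
      + apply (is_derive_in_mult I11 (fun _ => - 1)); [apply is_derive_in_const|].
        apply (is_derive_in_mult I11 (fun x => x1 x * i x) (fun x => sin (Th x))).
        * apply (is_derive_in_mult I11 x1 i); [exact DX|exact Di].
        * apply (is_derive_in_comp I11 Th sin x _ _ (is_derive_in_of_is_derive _ _ _ _ (HTh x)) (is_derive_sin (Th x))).
    - unfold w; rewrite (extend2_id T) by auto; unfold x1, y1, i.
      pose proof (inv_speed_sq T X Y x t HR Hx Ht) as HS.
      unfold fam_turn, fam_cross, inv_speed'.
      set (a1 := pr T (true :: nil) X (x, t)) in *; set (b1 := pr T (true :: nil) Y (x, t)) in *.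
      set (a2 := pr T (true :: true :: nil) X (x, t)); set (b2 := pr T (true :: true :: nil) Y (x, t)).
      set (j := inv_speed T X Y (x, t)) in *.
      set (cc := cos (Th x)); set (ss := sin (Th x)).
      (* The derivative is a multiple of 1 - |gamma'|^2 j^2, which vanishes because j is the inverse
         speed. *)
      transitivity ((1 - (a1 ^ 2 + b1 ^ 2) * j ^ 2) * (j * (b2 * cc - a2 * ss))); [ring|].
      rewrite HS; ring. }
  (* At -1 the conserved quantity is 0; at 1 it is minus the horizontal component of the unit
     tangent, which is nonzero, times [sin (Th 1)]. *)
  unfold y1 in Hc at 1 2; rewrite Hm, H1 in Hc.
  replace (Th (-1)) with 0 in Hc by (symmetry; apply (RInt_point (V := R_CompleteNormedModule))).
  rewrite sin_0 in Hc.
  pose proof (inv_speed_pos T X Y 1 t HR HI1 Ht) as Hi.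
  pose proof (rf_imm _ _ _ HR 1 t HI1 Ht) as Hp; rewrite H1 in Hp; fold (x1 1) in Hp; fold (i 1) in Hi.
  assert (Hx1 : x1 1 <> 0) by (intros E; rewrite E in Hp; lra).
  assert (E : x1 1 * i 1 * sin (Th 1) = 0) by lra.
  apply Rmult_integral in E; destruct E as [E|E]; auto.
  apply Rmult_integral in E; destruct E; [contradiction|lra].
Qed.

(** Inside (-pi, pi) the sine vanishes at 0 alone, and leaving this interval would force the value
    pi/2 or -pi/2, where the sine is not 0. *)
Lemma connected_sin_zero (m : R -> R) (t1 : R) : continuity m -> m 0 = 0 ->
  (forall t, sin (m t) = 0) -> m t1 = 0.
Proof.
  intros Hm H0 Hs; pose proof PI_RGT_0 as Hpi.
  destruct (Rlt_dec (m t1) PI) as [Hlt|Hge].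
  - destruct (Rlt_dec (- PI) (m t1)) as [Hgt|Hle].
    + specialize (Hs t1); destruct (Rtotal_order (m t1) 0) as [H|[H|H]]; auto.
      * pose proof (sin_lt_0_var (m t1)); lra.
      * pose proof (sin_gt_0 (m t1)); lra.
    + destruct (IVT_gen m 0 t1 (- (PI / 2)) Hm) as [t [_ Ht]].
      * rewrite H0; unfold Rmin, Rmax; destruct (Rle_dec 0 (m t1)); lra.
      * specialize (Hs t); rewrite Ht, sin_neg, sin_PI2 in Hs; lra.
  - destruct (IVT_gen m 0 t1 (PI / 2) Hm) as [t [_ Ht]].
    + rewrite H0; unfold Rmin, Rmax; destruct (Rle_dec 0 (m t1)); lra.
    + specialize (Hs t); rewrite Ht, sin_PI2 in Hs; lra.
Qed.

Lemma turning_number_flow (T : Rbar) (g : R -> R -> R * R) (t : R) :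
  elastic_flow T g -> turning_number (fun x => g x 0) = 0 -> time_dom T t ->
  turning_number (fun x => g x t) = 0.
Proof.
  intros HF H0 Ht; pose proof (elastic_flow_regular T g HF) as HR.
  set (X := fst2 g) in *; set (Y := snd2 g) in *.
  pose (m := fun t => RInt (fun x => fam_turn T X Y (x, t)) (-1) 1).
  assert (HT0 : time_dom T 0) by (split; [lra|apply (rf_T _ _ _ HR)]).
  assert (Hm : forall t, time_dom T t -> turning_number (fun x => g x t) = 1 / (2 * PI) * m t).
  { intros r Hr; change (turning_number (slice X Y r) = 1 / (2 * PI) * m r).
    unfold turning_number; now rewrite (slice_int_kappa T). }
  pose proof PI_RGT_0 as Hpi.
  rewrite Hm by auto; rewrite Hm in H0 by auto.
  assert (Hm0 : m 0 = 0).
  { apply Rmult_integral in H0; destruct H0 as [H0|H0]; auto.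
    assert (0 < 1 / (2 * PI)) by (apply Rdiv_lt_0_compat; lra); lra. }
  assert (Hs : forall r, time_dom T r -> sin (m r) = 0).
  { intros r Hr; destruct HF as (_ & _ & _ & _ & HC).
    destruct (HC r Hr) as (_ & _ & _ & _ & Nm & N1 & _).
    assert (B : forall x, I11 x -> dot (normal I11 (fun y => g y r) x) e1 = 0 -> pr T (true :: nil) Y (x, r) = 0).
    { intros x Hx HN; change (dot (normal I11 (slice X Y r) x) e1 = 0) in HN.
      unfold dot, normal, e1 in HN; rewrite (slice_tangent T X Y x r HR Hx Hr) in HN; cbn [fst snd] in HN.
      pose proof (inv_speed_pos T X Y x r HR Hx Hr).
      assert (E : pr T (true :: nil) Y (x, r) * inv_speed T X Y (x, r) = 0) by lra.
      apply Rmult_integral in E; destruct E; [auto|lra]. }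
    apply (sin_total_curvature T X Y r HR Hr); apply B; auto; unfold I11, Icc; lra. }
  (* Retraction of the time line onto [0, t], so that the total curvature becomes a continuous
     function on all of R. *)
  pose (r := fun s => Rmax 0 (Rmin s t)).
  assert (Hr : forall s, time_dom T (r s)).
  { intros s; destruct Ht as [Ht0 HtT]; unfold r; split; [apply Rmax_l|].
    apply Rbar_le_lt_trans with t; auto; simpl; apply Rmax_lub; auto; apply Rmin_r. }
  assert (Hrt : r t = t) by (destruct Ht; unfold r; rewrite Rmin_left, Rmax_right; lra).
  assert (Hr0 : r 0 = 0) by (destruct Ht; unfold r; rewrite Rmin_left, Rmax_left; lra).
  assert (E : m (r t) = 0).
  { apply (connected_sin_zero (fun s => m (r s)) t).
    - apply (continuity_retract (time_dom T)); auto.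
      + intros x y; unfold r; eapply Rle_trans; [apply Rmax_0_lip|].
        unfold Rmin; destruct (Rle_dec x t), (Rle_dec y t); unfold Rabs; repeat destruct (Rcase_abs _); lra.
      + intros s Hs'; destruct (fam_der2 T X Y _ HR (fam_fam_turn T X Y)) as [f' [Hf' Hd]].
        eexists; apply (is_derive_in_RInt_param T (fam_turn T X Y) f'); auto;
          apply (fam_cont2 T X Y); auto; apply fam_fam_turn.
    - now rewrite Hr0.
    - intros s; apply Hs, Hr. }
  rewrite Hrt in E; rewrite E; ring.
Qed.

(** * First variation of the energy at the example *)

Definition elastic_u1 (a s : R) : R :=
  (a * (2 * k0 ^ 2 - 1) + 3 * (a ^ 3 / 2 - 2 * k0 ^ 2 * a) * cn s k0 ^ 2) * (- sn s k0 * dn s k0).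

Definition elastic_u2 (a s : R) : R :=
  6 * (a ^ 3 / 2 - 2 * k0 ^ 2 * a) * cn s k0 * (sn s k0 * dn s k0) ^ 2
  + (a * (2 * k0 ^ 2 - 1) + 3 * (a ^ 3 / 2 - 2 * k0 ^ 2 * a) * cn s k0 ^ 2)
    * (- cn s k0 * dn s k0 ^ 2 + k0 ^ 2 * sn s k0 ^ 2 * cn s k0).

Lemma is_derive_elastic_u (a s : R) : is_derive (elastic_u a) s (elastic_u1 a s).
Proof. unfold elastic_u, u_cn, elastic_u1; jacobi_derive; field. Qed.

Lemma is_derive_elastic_u1 (a s : R) : is_derive (elastic_u1 a) s (elastic_u2 a s).
Proof. unfold elastic_u1, elastic_u2; jacobi_derive; field. Qed.

Definition u_cn1 (a s : R) : R := - a * sn s k0 * dn s k0.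

Definition u_cn2 (a s : R) : R := a * ((2 * k0 ^ 2 - 1) * cn s k0 - 2 * k0 ^ 2 * cn s k0 ^ 3).

(** Integration by parts of u u''; the boundary terms vanish because u' contains sn. Up to scaling
    this is the initial rate of the length. *)
Lemma is_RInt_elastic_u_cn (a : R) :
  is_RInt (fun s => elastic_u a s * u_cn a s) 0 L0 (- (a ^ 2 * D22) + 1 / 2 * (a ^ 4 * C4)).
Proof.
  assert (H : is_RInt (fun s => u_cn1 a s ^ 2 + u_cn a s * u_cn2 a s) 0 L0 0).
  { eapply is_RInt_congr; [| |apply (is_RInt_FTC (fun s => u_cn a s * u_cn1 a s) (fun s => u_cn1 a s ^ 2 + u_cn a s * u_cn2 a s))].
    - reflexivity.
    - unfold u_cn1; rewrite sn_0, sn_L0; ring.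
    - intros t; evar_last.
      + apply (is_derive_mult (u_cn a) (u_cn1 a)); [apply is_derive_u_cn|apply is_derive2_u_cn|intros; apply Rmult_comm].
      + unfold plus, mult; simpl; unfold u_cn1, u_cn2; ring.
    - intros t; unfold u_cn, u_cn1, u_cn2; auto_derive; jacobi_ex. }
  eapply is_RInt_congr; [| |apply (is_RInt_lin _ _ 0 L0 _ _ 1 1 H
    (is_RInt_lin _ _ 0 L0 _ _ (-1) (1 / 2) (is_RInt_du2 a) (is_RInt_u4 a)))].
  - intros t; unfold elastic_u, u_cn1, u_cn2; field.
  - ring.
Qed.

Definition elastic_sq (a : R) : R :=
  a ^ 2 * ((2 * k0 ^ 2 - 1) ^ 2 * C2
      + 2 * (2 * k0 ^ 2 - 1) * (a ^ 2 / 2 - 2 * k0 ^ 2) * C4 + (a ^ 2 / 2 - 2 * k0 ^ 2) ^ 2 * C6).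

(* Two integrations by parts move the derivatives off [elastic_u]; the boundary terms vanish with sn. *)
Lemma is_RInt_energy_rate_density (a : R) :
  is_RInt (fun s => 2 * u_cn a s * elastic_u2 a s + elastic_u a s * u_cn a s ^ 3) 0 L0 (2 * elastic_sq a).
Proof.
  pose (h := fun s => u_cn a s * elastic_u2 a s - u_cn2 a s * elastic_u a s).
  assert (H : is_RInt h 0 L0 0).
  { eapply is_RInt_congr; [| |apply (is_RInt_FTC (fun s => u_cn a s * elastic_u1 a s - u_cn1 a s * elastic_u a s) h)].
    - reflexivity.
    - unfold u_cn1, elastic_u1; rewrite sn_0, sn_L0; ring.
    - intros t; evar_last.
      + apply (is_derive_minus (fun s => u_cn a s * elastic_u1 a s) (fun s => u_cn1 a s * elastic_u a s)).
        * apply (is_derive_mult (u_cn a) (elastic_u1 a)); [apply is_derive_u_cn|apply is_derive_elastic_u1|intros; apply Rmult_comm].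
        * apply (is_derive_mult (u_cn1 a) (elastic_u a)); [apply is_derive2_u_cn|apply is_derive_elastic_u|intros; apply Rmult_comm].
      + unfold minus, plus, opp, mult; simpl; unfold h, u_cn1, u_cn2; ring.
    - intros t; unfold h, u_cn, u_cn2, elastic_u2, elastic_u, u_cn; auto_derive; jacobi_ex. }
  eapply is_RInt_congr; [| |apply (is_RInt_lin _ _ 0 L0 _ _ 2 2 H (is_RInt_elastic2 a))].
  - intros t; unfold h, elastic_u, u_cn2; field.
  - unfold elastic_sq; ring.
Qed.

Lemma continuous_elastic_u_cn (a s : R) : continuous (fun s => elastic_u a s * u_cn a s) s.
Proof.
  apply (ex_derive_continuous (fun s => elastic_u a s * u_cn a s)).
  unfold elastic_u, u_cn; auto_derive; jacobi_ex.
Qed.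

Lemma continuous_energy_rate_density (a s : R) :
  continuous (fun s => 2 * u_cn a s * elastic_u2 a s + elastic_u a s * u_cn a s ^ 3) s.
Proof.
  apply (ex_derive_continuous (fun s => 2 * u_cn a s * elastic_u2 a s + elastic_u a s * u_cn a s ^ 3)).
  unfold elastic_u2, elastic_u, u_cn; auto_derive; jacobi_ex.
Qed.

(** * Space-time derivatives of the flow at time zero *)

Record starts_at (T : Rbar) (a : R) (g : R -> R -> R * R) : Prop := {
  sa_flow : elastic_flow T g;
  sa_init : forall x, I11 x -> g x 0 = gamma_c a x;
  sa_a : 0 <= a <= 2 * k0
}.

Lemma time_dom_0 (T : Rbar) : Rbar_lt 0 T -> time_dom T 0.
Proof. intros HT; split; [lra|exact HT]. Qed.

Lemma starts_at_0 (T : Rbar) (a : R) (g : R -> R -> R * R) : starts_at T a g -> time_dom T 0.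
Proof. intros H; apply time_dom_0, (proj1 (sa_flow _ _ _ H)). Qed.

(** A space derivative at time 0 depends on values at time 0 alone, so a formula known along the
    initial curve may be differentiated in x. *)
Lemma pr_true_eq (T : Rbar) (w : list bool) (f : R -> R -> R) (h h' : R -> R) (x : R) :
  I11 x -> (forall y, I11 y -> pr T w f (y, 0) = h y) -> derives_in I11 h h' ->
  pr T (true :: w) f (x, 0) = h' x.
Proof.
  intros Hx Hh Hd; apply (derive_in_eq I11 (fun y => pr T w f (y, 0)) x _ perfect_I11 Hx).
  apply (is_derive_in_ext I11 h); auto; intros; symmetry; auto.
Qed.

(* The initial velocity of the flow at the parameter r is [vel a] times
   [(w_x a, w_y a)] at [arc r], i.e. minus (kappa_ss + kappa^3/2) times the normal. *)
Definition vel (a : R) : R := / scale a ^ 3.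

Definition w_x (a s : R) : R := elastic_u a s * sin (angle a s).
Definition w_x1 (a s : R) : R := elastic_u1 a s * sin (angle a s) + elastic_u a s * (u_cn a s * cos (angle a s)).
Definition w_x2 (a s : R) : R :=
  elastic_u2 a s * sin (angle a s) + 2 * elastic_u1 a s * (u_cn a s * cos (angle a s))
  + elastic_u a s * (u_cn1 a s * cos (angle a s) - u_cn a s ^ 2 * sin (angle a s)).
Definition w_y (a s : R) : R := - (elastic_u a s * cos (angle a s)).
Definition w_y1 (a s : R) : R := - (elastic_u1 a s * cos (angle a s)) + elastic_u a s * (u_cn a s * sin (angle a s)).
Definition w_y2 (a s : R) : R :=
  - elastic_u2 a s * cos (angle a s) + 2 * elastic_u1 a s * (u_cn a s * sin (angle a s))
  + elastic_u a s * (u_cn1 a s * sin (angle a s) + u_cn a s ^ 2 * cos (angle a s)).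

Lemma is_derive_w_x (a s : R) : is_derive (w_x a) s (w_x1 a s).
Proof.
  evar_last.
  - apply (is_derive_mult (elastic_u a) (fun s => sin (angle a s))); [apply is_derive_elastic_u|apply is_derive_sin_angle|intros; apply Rmult_comm].
  - unfold plus, mult; simpl; unfold w_x1; ring.
Qed.

Lemma is_derive_w_y (a s : R) : is_derive (w_y a) s (w_y1 a s).
Proof.
  evar_last.
  - apply (is_derive_opp (fun s => elastic_u a s * cos (angle a s))).
    apply (is_derive_mult (elastic_u a) (fun s => cos (angle a s))); [apply is_derive_elastic_u|apply is_derive_cos_angle|intros; apply Rmult_comm].
  - unfold opp, plus, mult; simpl; unfold w_y1; ring.
Qed.

Lemma is_derive_u_cos (a s : R) : is_derive (fun s => u_cn a s * cos (angle a s)) s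
  (u_cn1 a s * cos (angle a s) - u_cn a s ^ 2 * sin (angle a s)).
Proof.
  evar_last.
  - apply (is_derive_mult (u_cn a) (fun s => cos (angle a s))); [apply is_derive_u_cn|apply is_derive_cos_angle|intros; apply Rmult_comm].
  - unfold plus, mult; simpl; unfold u_cn1; ring.
Qed.

Lemma is_derive_u_sin (a s : R) : is_derive (fun s => u_cn a s * sin (angle a s)) s
  (u_cn1 a s * sin (angle a s) + u_cn a s ^ 2 * cos (angle a s)).
Proof.
  evar_last.
  - apply (is_derive_mult (u_cn a) (fun s => sin (angle a s))); [apply is_derive_u_cn|apply is_derive_sin_angle|intros; apply Rmult_comm].
  - unfold plus, mult; simpl; unfold u_cn1; ring.
Qed.

Lemma is_derive_w_x1 (a s : R) : is_derive (w_x1 a) s (w_x2 a s).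
Proof.
  evar_last.
  - apply (is_derive_plus (fun s => elastic_u1 a s * sin (angle a s)) (fun s => elastic_u a s * (u_cn a s * cos (angle a s)))).
    + apply (is_derive_mult (elastic_u1 a) (fun s => sin (angle a s))); [apply is_derive_elastic_u1|apply is_derive_sin_angle|intros; apply Rmult_comm].
    + apply (is_derive_mult (elastic_u a) (fun s => u_cn a s * cos (angle a s))); [apply is_derive_elastic_u|apply is_derive_u_cos|intros; apply Rmult_comm].
  - unfold plus, mult; simpl; unfold w_x2; ring.
Qed.

Lemma is_derive_w_y1 (a s : R) : is_derive (w_y1 a) s (w_y2 a s).
Proof.
  evar_last.
  - apply (is_derive_plus (fun s => - (elastic_u1 a s * cos (angle a s))) (fun s => elastic_u a s * (u_cn a s * sin (angle a s)))).
    + apply (is_derive_opp (fun s => elastic_u1 a s * cos (angle a s))).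
      apply (is_derive_mult (elastic_u1 a) (fun s => cos (angle a s))); [apply is_derive_elastic_u1|apply is_derive_cos_angle|intros; apply Rmult_comm].
    + apply (is_derive_mult (elastic_u a) (fun s => u_cn a s * sin (angle a s))); [apply is_derive_elastic_u|apply is_derive_u_sin|intros; apply Rmult_comm].
  - unfold opp, plus, mult; simpl; unfold w_y2; ring.
Qed.

Lemma derives_in_arc (f f' : R -> R) (m : R) : (forall s, is_derive f s (f' s)) ->
  derives_in I11 (fun r => m * f (arc r)) (fun r => m * (L0 / 2) * f' (arc r)).
Proof.
  intros H x _; eapply is_derive_in_eq; [apply is_derive_in_of_is_derive, (is_derive_lin_arc f), H|ring].
Qed.

(** These are all the derivatives entering the first variation. The time derivative of the position
    is known from the flow equation; [pr_swap] moves every other time derivative inside, leaving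
    space derivatives of known functions. *)
Lemma initial_partials (T : Rbar) (a : R) (g : R -> R -> R * R) (x : R) :
  starts_at T a g -> I11 x ->
  let X := fst2 g in let Y := snd2 g in
  (pr T (true :: nil) X (x, 0) = gc_x1 a x /\ pr T (true :: nil) Y (x, 0) = gc_y1 a x) /\
  (pr T (true :: true :: nil) X (x, 0) = gc_x2 a x /\ pr T (true :: true :: nil) Y (x, 0) = gc_y2 a x) /\
  (pr T (false :: true :: nil) X (x, 0) = vel a * (L0 / 2) * w_x1 a (arc x) /\
   pr T (false :: true :: nil) Y (x, 0) = vel a * (L0 / 2) * w_y1 a (arc x)) /\
  (pr T (false :: true :: true :: nil) X (x, 0) = vel a * (L0 / 2) * (L0 / 2) * w_x2 a (arc x) /\
   pr T (false :: true :: true :: nil) Y (x, 0) = vel a * (L0 / 2) * (L0 / 2) * w_y2 a (arc x)).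
Proof.
  intros HS Hx X Y; pose proof (starts_at_0 T a g HS) as H0.
  destruct HS as [HF Hi Ha]; pose proof (elastic_flow_regular T g HF) as HR.
  fold X Y in HR; pose proof (rf_T _ _ _ HR) as HT; pose proof (rf_X _ _ _ HR) as HX; pose proof (rf_Y _ _ _ HR) as HY.
  assert (EX : forall y, I11 y -> pr T nil X (y, 0) = fst (gamma_c a y)) by (intros y Hy; unfold pr; simpl; unfold X, fst2; now rewrite Hi).
  assert (EY : forall y, I11 y -> pr T nil Y (y, 0) = snd (gamma_c a y)) by (intros y Hy; unfold pr; simpl; unfold Y, snd2; now rewrite Hi).
  assert (EX1 : forall y, I11 y -> pr T (true :: nil) X (y, 0) = gc_x1 a y)
    by (intros y Hy; apply (pr_true_eq T nil X _ _ y Hy EX), gamma_c_x1).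
  assert (EY1 : forall y, I11 y -> pr T (true :: nil) Y (y, 0) = gc_y1 a y)
    by (intros y Hy; apply (pr_true_eq T nil Y _ _ y Hy EY), gamma_c_y1).
  assert (EV : forall y, I11 y -> pr T (false :: nil) X (y, 0) = vel a * w_x a (arc y) /\
     pr T (false :: nil) Y (y, 0) = vel a * w_y a (arc y)).
  { intros y Hy; pose proof (scale_pos a Ha) as Hc; pose proof (speed_c_pos a Ha) as Hs.
    destruct (elastic_flow_velocity T g y 0 HF Hy H0) as [E1 E2].
    fold X in E1; fold Y in E2.
    rewrite (curvature_ss_ext I11 _ (gamma_c a) y Hi Hy), (curvature_ext I11 _ (gamma_c a) y Hi Hy),
      (tangent_ext I11 _ (gamma_c a) y Hi Hy) in E1, E2.
    rewrite gamma_c_curvature_ss, gamma_c_curvature in E1, E2 by auto.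
    rewrite (tangent_eq _ _ _ _ y perfect_I11 (gamma_c_x1 a) (gamma_c_y1 a) Hy), gc_speed_sq, sqrt_pow2 in E1, E2 by lra.
    cbn [fst snd] in E1, E2; rewrite E1, E2.
    unfold vel, w_x, w_y, gc_x1, gc_y1, elastic_u; split; field; lra. }
  assert (EV1X : forall y, I11 y -> pr T (false :: true :: nil) X (y, 0) = vel a * (L0 / 2) * w_x1 a (arc y)).
  { intros y Hy; rewrite pr_swap by auto.
    apply (pr_true_eq T (false :: nil) X (fun y => vel a * w_x a (arc y)) (fun y => vel a * (L0 / 2) * w_x1 a (arc y)) y Hy).
    - intros z Hz; now apply EV.
    - apply derives_in_arc, is_derive_w_x. }
  assert (EV1Y : forall y, I11 y -> pr T (false :: true :: nil) Y (y, 0) = vel a * (L0 / 2) * w_y1 a (arc y)).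
  { intros y Hy; rewrite pr_swap by auto.
    apply (pr_true_eq T (false :: nil) Y (fun y => vel a * w_y a (arc y)) (fun y => vel a * (L0 / 2) * w_y1 a (arc y)) y Hy).
    - intros z Hz; now apply EV.
    - apply derives_in_arc, is_derive_w_y. }
  repeat split; auto.
  - apply (pr_true_eq T (true :: nil) X _ _ x Hx EX1), gamma_c_x2.
  - apply (pr_true_eq T (true :: nil) Y _ _ x Hx EY1), gamma_c_y2.
  - rewrite pr_swap by auto.
    apply (pr_true_eq T (false :: true :: nil) X (fun y => vel a * (L0 / 2) * w_x1 a (arc y)) (fun y => vel a * (L0 / 2) * (L0 / 2) * w_x2 a (arc y)) x Hx EV1X).
    apply derives_in_arc, is_derive_w_x1.
  - rewrite pr_swap by auto.
    apply (pr_true_eq T (false :: true :: nil) Y (fun y => vel a * (L0 / 2) * w_y1 a (arc y)) (fun y => vel a * (L0 / 2) * (L0 / 2) * w_y2 a (arc y)) x Hx EV1Y).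
    apply derives_in_arc, is_derive_w_y1.
Qed.

(** * Rates of length and energy at time zero *)

(** The speed written as |gamma'|^2 times the inverse speed, so that it stays in the algebra
    [fam]. *)
Definition fam_speed (T : Rbar) (X Y : R -> R -> R) (p : R * R) : R :=
  (pr T (true :: nil) X p * pr T (true :: nil) X p + pr T (true :: nil) Y p * pr T (true :: nil) Y p)
  * inv_speed T X Y p.

(** Density of kappa^2 ds: the squared cross product over the sixth power of the speed, times the
    speed. *)
Definition fam_energy (T : Rbar) (X Y : R -> R -> R) (p : R * R) : R :=
  fam_cross T X Y p * fam_cross T X Y p
  * (inv_speed T X Y p * inv_speed T X Y p * inv_speed T X Y p * inv_speed T X Y p * inv_speed T X Y p).

Lemma fam_fam_speed (T : Rbar) (X Y : R -> R -> R) : fam T X Y (fam_speed T X Y).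
Proof. unfold fam_speed; fam_tac. Qed.

Lemma fam_fam_energy (T : Rbar) (X Y : R -> R -> R) : fam T X Y (fam_energy T X Y).
Proof. pose proof (fam_fam_cross T X Y); unfold fam_energy; fam_tac. Qed.

Lemma fam_speed_eq (T : Rbar) (X Y : R -> R -> R) (x t : R) : regular_family T X Y -> I11 x -> time_dom T t ->
  fam_speed T X Y (x, t) = / inv_speed T X Y (x, t).
Proof.
  intros HR Hx Ht; pose proof (inv_speed_pos T X Y x t HR Hx Ht); pose proof (inv_speed_sq T X Y x t HR Hx Ht) as E.
  unfold fam_speed; apply (Rmult_eq_reg_r (inv_speed T X Y (x, t))); [|lra].
  rewrite Rinv_l by lra; rewrite <- E; ring.
Qed.

Lemma slice_length (T : Rbar) (X Y : R -> R -> R) (t : R) : regular_family T X Y -> time_dom T t ->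
  length_of (slice X Y t) = RInt (fun x => fam_speed T X Y (x, t)) (-1) 1.
Proof.
  intros HR Ht; apply (RInt_ext (V := R_CompleteNormedModule)); intros x Hx.
  rewrite Rmin_left, Rmax_right in Hx by lra.
  assert (Hx' : I11 x) by (unfold I11, Icc; lra).
  change (@eq R (1 * speed I11 (slice X Y t) x) (fam_speed T X Y (x, t))).
  rewrite (slice_speed T), (fam_speed_eq T) by auto; ring.
Qed.

Lemma slice_energy (T : Rbar) (X Y : R -> R -> R) (t : R) : regular_family T X Y -> time_dom T t ->
  energy (slice X Y t) = 1 / 2 * RInt (fun x => fam_energy T X Y (x, t)) (-1) 1.
Proof.
  intros HR Ht; unfold energy; f_equal; apply (RInt_ext (V := R_CompleteNormedModule)); intros x Hx.
  rewrite Rmin_left, Rmax_right in Hx by lra.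
  assert (Hx' : I11 x) by (unfold I11, Icc; lra).
  change (@eq R (curvature I11 (slice X Y t) x ^ 2 * speed I11 (slice X Y t) x) (fam_energy T X Y (x, t))).
  rewrite (slice_kappa T), (slice_speed T) by auto.
  pose proof (inv_speed_pos T X Y x t HR Hx' Ht).
  unfold fam_kappa, fam_energy; field; lra.
Qed.

Lemma initial_inv_speed (T : Rbar) (a : R) (g : R -> R -> R * R) (x : R) :
  starts_at T a g -> I11 x -> inv_speed T (fst2 g) (snd2 g) (x, 0) = / speed_c a.
Proof.
  intros HS Hx; destruct (initial_partials T a g x HS Hx) as [[E1 E2] _].
  unfold inv_speed; rewrite E1, E2, gc_speed_sq; f_equal; apply sqrt_pow2.
  pose proof (speed_c_pos a (sa_a _ _ _ HS)); lra.
Qed.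

(** With velocity -F nu, where F = kappa_ss + kappa^3/2, the arclength element changes at the rate
    kappa F ds. *)
Lemma initial_speed_rate (T : Rbar) (a : R) (g : R -> R -> R * R) (x : R) :
  starts_at T a g -> I11 x ->
  is_derive_in (time_dom T) (fun r => fam_speed T (fst2 g) (snd2 g) (x, r)) 0
    (vel a * (L0 / 2) * (elastic_u a (arc x) * u_cn a (arc x))).
Proof.
  intros HS Hx; pose proof (starts_at_0 T a g HS) as H0.
  pose proof (elastic_flow_regular T g (sa_flow _ _ _ HS)) as HR.
  destruct (initial_partials T a g x HS Hx) as ([X1 Y1] & _ & [VX1 VY1] & _).
  pose proof (initial_inv_speed T a g x HS Hx) as Ei.
  pose proof (speed_c_pos a (sa_a _ _ _ HS)) as Hs.
  set (X := fst2 g) in *; set (Y := snd2 g) in *.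
  pose proof (pr_der2 T (true :: nil) X (rf_T _ _ _ HR) (rf_X _ _ _ HR) x 0 Hx H0) as DX.
  pose proof (pr_der2 T (true :: nil) Y (rf_T _ _ _ HR) (rf_Y _ _ _ HR) x 0 Hx H0) as DY.
  pose proof (inv_speed_der2 T X Y HR x 0 Hx H0) as Di.
  eapply is_derive_in_eq.
  - apply (is_derive_in_mult (time_dom T)
      (fun r => pr T (true :: nil) X (x, r) * pr T (true :: nil) X (x, r) + pr T (true :: nil) Y (x, r) * pr T (true :: nil) Y (x, r))
      (fun r => inv_speed T X Y (x, r))); [|exact Di].
    apply (is_derive_in_plus (time_dom T) (fun r => pr T (true :: nil) X (x, r) * pr T (true :: nil) X (x, r))
      (fun r => pr T (true :: nil) Y (x, r) * pr T (true :: nil) Y (x, r))).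
    + apply (is_derive_in_mult (time_dom T) (fun r => pr T (true :: nil) X (x, r)) (fun r => pr T (true :: nil) X (x, r)) 0 _ _ DX DX).
    + apply (is_derive_in_mult (time_dom T) (fun r => pr T (true :: nil) Y (x, r)) (fun r => pr T (true :: nil) Y (x, r)) 0 _ _ DY DY).
  - unfold inv_speed'; rewrite X1, Y1, VX1, VY1, Ei.
    pose proof (sin2_cos2 (angle a (arc x))) as Hsc; unfold Rsqr in Hsc.
    unfold gc_x1, gc_y1, w_x1, w_y1.
    set (ss := sin (angle a (arc x))) in *; set (cc := cos (angle a (arc x))) in *.
    set (F := elastic_u a (arc x)); set (F1 := elastic_u1 a (arc x)); set (u := u_cn a (arc x)).
    set (q := speed_c a) in *.
    (* The last factor is 1; it is the shape left by the product rule before sin^2 + cos^2 is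
       simplified. *)
    transitivity (vel a * (L0 / 2) * (F * u) * ((ss * ss + cc * cc) * (2 - (ss * ss + cc * cc)))).
    + field; lra.
    + rewrite Hsc; ring.
Qed.

(** Here kappa_t = -(F_ss + kappa^2 F) and ds grows at the rate kappa F ds, so kappa^2 ds changes at
    the rate -(2 kappa F_ss + kappa^3 F) ds. *)
Lemma initial_energy_rate (T : Rbar) (a : R) (g : R -> R -> R * R) (x : R) :
  starts_at T a g -> I11 x ->
  is_derive_in (time_dom T) (fun r => fam_energy T (fst2 g) (snd2 g) (x, r)) 0
    (- vel a * (L0 / 2) / scale a ^ 2 *
      (2 * u_cn a (arc x) * elastic_u2 a (arc x) + elastic_u a (arc x) * u_cn a (arc x) ^ 3)).
Proof.
  intros HS Hx; pose proof (starts_at_0 T a g HS) as H0.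
  pose proof (elastic_flow_regular T g (sa_flow _ _ _ HS)) as HR.
  destruct (initial_partials T a g x HS Hx) as ([X1 Y1] & [X2 Y2] & [VX1 VY1] & [VX2 VY2]).
  pose proof (initial_inv_speed T a g x HS Hx) as Ei.
  pose proof (scale_pos a (sa_a _ _ _ HS)) as Hc; pose proof L0_pos as HL.
  set (X := fst2 g) in *; set (Y := snd2 g) in *.
  pose proof (pr_der2 T (true :: nil) X (rf_T _ _ _ HR) (rf_X _ _ _ HR) x 0 Hx H0) as DX.
  pose proof (pr_der2 T (true :: nil) Y (rf_T _ _ _ HR) (rf_Y _ _ _ HR) x 0 Hx H0) as DY.
  pose proof (pr_der2 T (true :: true :: nil) X (rf_T _ _ _ HR) (rf_X _ _ _ HR) x 0 Hx H0) as DX2.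
  pose proof (pr_der2 T (true :: true :: nil) Y (rf_T _ _ _ HR) (rf_Y _ _ _ HR) x 0 Hx H0) as DY2.
  pose proof (inv_speed_der2 T X Y HR x 0 Hx H0) as Di.
  rewrite VX1 in DX; rewrite VY1 in DY; rewrite VX2 in DX2; rewrite VY2 in DY2.
  pose proof (sin2_cos2 (angle a (arc x))) as Hsc; unfold Rsqr in Hsc.
  assert (Di' : is_derive_in (time_dom T) (fun r => inv_speed T X Y (x, r)) 0
    (- (vel a * (L0 / 2) * (elastic_u a (arc x) * u_cn a (arc x))) / speed_c a ^ 2)).
  { eapply is_derive_in_eq; [exact Di|].
    unfold inv_speed'; rewrite X1, Y1, VX1, VY1, Ei.
    unfold gc_x1, gc_y1, w_x1, w_y1.
    pose proof (speed_c_pos a (sa_a _ _ _ HS)) as Hs.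
    set (ss := sin (angle a (arc x))) in *; set (cc := cos (angle a (arc x))) in *.
    transitivity (- (vel a * (L0 / 2) * (elastic_u a (arc x) * u_cn a (arc x))) / speed_c a ^ 2 * (ss * ss + cc * cc)).
    - field; lra.
    - rewrite Hsc; ring. }
  assert (Dc : is_derive_in (time_dom T) (fun r => fam_cross T X Y (x, r)) 0
    (speed_c a * vel a * (L0 / 2) ^ 2 * (- elastic_u2 a (arc x) + 2 * elastic_u a (arc x) * u_cn a (arc x) ^ 2))).
  { eapply is_derive_in_eq.
    - apply (is_derive_in_plus (time_dom T) (fun r => pr T (true :: nil) X (x, r) * pr T (true :: true :: nil) Y (x, r))
        (fun r => -1 * (pr T (true :: nil) Y (x, r) * pr T (true :: true :: nil) X (x, r)))).
      + apply (is_derive_in_mult (time_dom T) (fun r => pr T (true :: nil) X (x, r)) (fun r => pr T (true :: true :: nil) Y (x, r)) 0 _ _ DX DY2).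
      + apply (is_derive_in_mult (time_dom T) (fun _ => -1)); [apply is_derive_in_const|].
        apply (is_derive_in_mult (time_dom T) (fun r => pr T (true :: nil) Y (x, r)) (fun r => pr T (true :: true :: nil) X (x, r)) 0 _ _ DY DX2).
    - rewrite X1, Y1, X2, Y2; unfold gc_x1, gc_y1, gc_x2, gc_y2, w_x1, w_y1, w_x2, w_y2.
      set (ss := sin (angle a (arc x))) in *; set (cc := cos (angle a (arc x))) in *.
      transitivity (speed_c a * vel a * (L0 / 2) ^ 2 * (- elastic_u2 a (arc x) + 2 * elastic_u a (arc x) * u_cn a (arc x) ^ 2) * (ss * ss + cc * cc)).
      + field.
      + rewrite Hsc; ring. }
  assert (Ec : fam_cross T X Y (x, 0) = speed_c a ^ 2 * (L0 / 2) * u_cn a (arc x)).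
  { unfold fam_cross; rewrite X1, Y1, X2, Y2; unfold gc_x1, gc_y1, gc_x2, gc_y2.
    set (ss := sin (angle a (arc x))) in *; set (cc := cos (angle a (arc x))) in *.
    transitivity (speed_c a ^ 2 * (L0 / 2) * u_cn a (arc x) * (ss * ss + cc * cc)); [field|rewrite Hsc; ring]. }
  eapply is_derive_in_eq.
  - apply (is_derive_in_mult (time_dom T)
      (fun r => fam_cross T X Y (x, r) * fam_cross T X Y (x, r))
      (fun r => inv_speed T X Y (x, r) * inv_speed T X Y (x, r) * inv_speed T X Y (x, r) * inv_speed T X Y (x, r) * inv_speed T X Y (x, r))).
    + apply (is_derive_in_mult (time_dom T) (fun r => fam_cross T X Y (x, r)) (fun r => fam_cross T X Y (x, r)) 0 _ _ Dc Dc).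
    + apply (is_derive_in_ext (time_dom T) (fun r => inv_speed T X Y (x, r) ^ 5)); auto; [intros; ring|].
      apply (is_derive_in_comp (time_dom T) (fun r => inv_speed T X Y (x, r)) (fun z => z ^ 5) 0 _ (5 * inv_speed T X Y (x, 0) ^ 4) Di').
      auto_derive; auto; ring.
  - rewrite Ei, Ec; unfold vel, speed_c; field; lra.
Qed.

(** Product rule for length times energy. With F = u'' + u^3/2, the length rate is a multiple of the
    integral of u F and the energy rate a negative multiple of that of F^2; these are the two terms
    of [LHS]. *)
Lemma energy_hat_initial_rate (T : Rbar) (a : R) (g : R -> R -> R * R) : starts_at T a g ->
  is_derive_in (time_dom T) (fun t => energy_hat (fun x => g x t)) 0
    (/ 2 * / scale a ^ 4 * LHS L0 (u_cn a)).
Proof.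
  intros HS; pose proof (starts_at_0 T a g HS) as H0.
  pose proof (elastic_flow_regular T g (sa_flow _ _ _ HS)) as HR.
  pose proof (scale_pos a (sa_a _ _ _ HS)) as Hc; pose proof L0_pos as HL.
  pose proof (energy_gamma_c a (sa_a _ _ _ HS)) as EE; pose proof (length_gamma_c a (sa_a _ _ _ HS)) as EL.
  set (X := fst2 g) in *; set (Y := snd2 g) in *.
  assert (HX0 : forall y, I11 y -> slice X Y 0 y = gamma_c a y)
    by (intros; rewrite <- (sa_init _ _ _ HS) by auto; symmetry; apply surjective_pairing).
  assert (EL0 : RInt (fun x => fam_speed T X Y (x, 0)) (-1) 1 = length_of (gamma_c a)).
  { transitivity (length_of (slice X Y 0)); [symmetry; exact (slice_length T X Y 0 HR H0)|].
    unfold length_of; apply int_ds_ext; [exact HX0|reflexivity]. }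
  assert (EE0 : 1 / 2 * RInt (fun x => fam_energy T X Y (x, 0)) (-1) 1 = energy (gamma_c a)).
  { transitivity (energy (slice X Y 0)); [symmetry; exact (slice_energy T X Y 0 HR H0)|].
    unfold energy; f_equal; apply int_ds_ext; [exact HX0|].
    intros y Hy; now rewrite (curvature_ext I11 (slice X Y 0) (gamma_c a)). }
  apply (is_derive_in_ext (time_dom T) (fun t => RInt (fun x => fam_speed T X Y (x, t)) (-1) 1 *
     (1 / 2 * RInt (fun x => fam_energy T X Y (x, t)) (-1) 1))); auto.
  { intros t Ht; change (energy_hat (fun x => g x t)) with (length_of (slice X Y t) * energy (slice X Y t)).
    f_equal; symmetry; [exact (slice_length T X Y t HR Ht)|exact (slice_energy T X Y t HR Ht)]. }
  (* The algebra supplies continuous time derivatives without formulas; uniqueness of relative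
     derivatives identifies them at time 0 with the explicit rates. *)
  destruct (fam_der2 T X Y _ HR (fam_fam_speed T X Y)) as [s' [Hs' Ds]].
  destruct (fam_der2 T X Y _ HR (fam_fam_energy T X Y)) as [e' [He' De]].
  pose proof (is_derive_in_RInt_param T _ s' 0 (fam_cont2 T X Y _ HR (fam_fam_speed T X Y)) (fam_cont2 T X Y _ HR Hs') Ds H0) as DL.
  pose proof (is_derive_in_RInt_param T _ e' 0 (fam_cont2 T X Y _ HR (fam_fam_energy T X Y)) (fam_cont2 T X Y _ HR He') De H0) as DE.
  pose proof (perfect_time_dom T (rf_T _ _ _ HR)) as HP.
  assert (EL' : RInt (fun x => s' (x, 0)) (-1) 1 = vel a * (- (a ^ 2 * D22) + 1 / 2 * (a ^ 4 * C4))).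
  { apply (is_RInt_unique (V := R_CompleteNormedModule)).
    apply (is_RInt_ext (V := R_NormedModule) (fun x => (vel a * (L0 / 2)) * (elastic_u a (arc x) * u_cn a (arc x)))).
    - intros x Hx; rewrite Rmin_left, Rmax_right in Hx by lra.
      assert (Hx' : I11 x) by (unfold I11, Icc; lra).
      exact (is_derive_in_unique _ _ 0 _ _ (HP 0 H0) (initial_speed_rate T a g x HS Hx') (Ds x 0 Hx' H0)).
    - eapply is_RInt_congr; [| |apply (is_RInt_scal (V := R_NormedModule) _ _ _ (vel a * (L0 / 2)) _
        (is_RInt_arc (fun s => elastic_u a s * u_cn a s) _ (continuous_elastic_u_cn a) (is_RInt_elastic_u_cn a)))].
      + reflexivity.
      + unfold scal; simpl; unfold mult; simpl; field; lra. }
  assert (EE' : RInt (fun x => e' (x, 0)) (-1) 1 = - vel a / scale a ^ 2 * (2 * elastic_sq a)).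
  { apply (is_RInt_unique (V := R_CompleteNormedModule)).
    apply (is_RInt_ext (V := R_NormedModule) (fun x => (- vel a * (L0 / 2) / scale a ^ 2) *
      (2 * u_cn a (arc x) * elastic_u2 a (arc x) + elastic_u a (arc x) * u_cn a (arc x) ^ 3))).
    - intros x Hx; rewrite Rmin_left, Rmax_right in Hx by lra.
      assert (Hx' : I11 x) by (unfold I11, Icc; lra).
      exact (is_derive_in_unique _ _ 0 _ _ (HP 0 H0) (initial_energy_rate T a g x HS Hx') (De x 0 Hx' H0)).
    - eapply is_RInt_congr; [| |apply (is_RInt_scal (V := R_NormedModule) _ _ _ (- vel a * (L0 / 2) / scale a ^ 2) _
        (is_RInt_arc (fun s => 2 * u_cn a s * elastic_u2 a s + elastic_u a s * u_cn a s ^ 3) _ (continuous_energy_rate_density a) (is_RInt_energy_rate_density a)))].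
      + reflexivity.
      + unfold scal; simpl; unfold mult; simpl; field; lra. }
  eapply is_derive_in_eq.
  - apply (is_derive_in_mult (time_dom T) (fun t => RInt (fun x => fam_speed T X Y (x, t)) (-1) 1)); [exact DL|].
    apply (is_derive_in_mult (time_dom T) (fun _ => 1 / 2)); [apply is_derive_in_const|exact DE].
  - cbv beta; rewrite EE0, EL0, EL', EE', EE, EL, LHS_u_cn; unfold lhs_over, elastic_sq, vel, L0.
    unfold L0 in HL; field; lra.
Qed.

(** * Truncation error and conclusion *)

(** Truncation loses less than 10^(-n); four decimals give the margin 10^(-4) on which
    [lhs_trunc_pos] keeps the sign. *)
Lemma trunc_dec_near (n : nat) (x : R) : (4 <= n)%nat -> x - 1 / 10 ^ 4 <= trunc_dec n x.
Proof.
  intros Hn; unfold trunc_dec.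
  pose proof (proj2 (base_Int_part (x * 10 ^ n))) as H.
  assert (Hp : 10 ^ 4 <= 10 ^ n) by (apply Rle_pow; [lra|auto]).
  apply Rcomplements.Rle_div_r; [lra|].
  assert (E : 1 / 10 ^ 4 * 10 ^ n >= 1).
  { replace (1 / 10 ^ 4 * 10 ^ n) with (10 ^ n / 10 ^ 4) by (unfold Rdiv; ring).
    apply Rle_ge, Rcomplements.Rle_div_r; lra. }
  rewrite Rmult_minus_distr_r; lra.
Qed.

Theorem mainTheorem4 :
  (* (1) *)
  ((141233776 / 10 ^ 8 < a_star < 141233777 / 10 ^ 8) /\
   RInt (u_cn a_star) 0 L0 = 0 /\
   L0 * RInt (fun s => u_cn a_star s ^ 2) 0 L0 = 4 * PI /\
   (307904 / 10 ^ 8 <= LHS L0 (u_cn a_star) < 307905 / 10 ^ 8) /\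
   ~ (forall (L : R) (u : R -> R),
        0 < L -> smooth_in (Icc 0 L) u ->
        RInt u 0 L = 0 ->
        L * RInt (fun s => u s ^ 2) 0 L <= 4 * PI ->
        LHS L u <= 0)) /\
  (* (2) *)
  (forall n : nat, (4 <= n)%nat ->
   forall a : R, a = trunc_dec n a_star -> a < a_star ->
     0 < LHS L0 (u_cn a) /\
     (forall s, Icc 0 L0 s ->
        speed (Icc 0 L0) (gamma_tilde a) s = 1 /\
        curvature (Icc 0 L0) (gamma_tilde a) s = u_cn a s) /\
     class_X (gamma_c a) /\
     turning_number (gamma_c a) = 0 /\
     energy_hat (gamma_c a) < 2 * PI /\
     0 < energy_hat_rate (gamma_c a) /\
     (forall (T : Rbar) (g : R -> R -> R * R),
        elastic_flow T g ->
        (forall x, I11 x -> g x 0 = gamma_c a x) ->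
        (forall t, time_dom T t -> turning_number (fun x => g x t) = 0) /\
        energy_hat (fun x => g x 0) < 2 * PI /\
        (exists d, is_derive_in (time_dom T)
                     (fun t => energy_hat (fun x => g x t)) 0 d /\
                   0 < d))).
Proof.
  assert (H4 : L0 * RInt (fun s => u_cn a_star s ^ 2) 0 L0 = 4 * PI).
  { rewrite (is_RInt_unique (V := R_CompleteNormedModule) _ _ _ _ (is_RInt_u2 a_star)), a_star_sq.
    pose proof ellK_ellE_bounds as [HK _]; pose proof moment_bounds as [HC _].
    unfold L0; field; split; lra. }
  assert (H5 : 307904 / 10 ^ 8 <= LHS L0 (u_cn a_star) < 307905 / 10 ^ 8)
    by (rewrite LHS_u_cn; apply lhs_star_bounds).
  split.
  - split; [apply a_star_bounds|]; split; [apply RInt_u_cn|]; split; [exact H4|]; split; [exact H5|].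
    intros H; specialize (H L0 (u_cn a_star) L0_pos (smooth_u_cn a_star) (RInt_u_cn a_star)); lra.
  - intros n Hn a Ha Hlt.
    pose proof (trunc_dec_near n a_star Hn) as Hnear; rewrite <- Ha in Hnear.
    pose proof a_star_bounds as Hb.
    (* Here 2 k0 = 1.42 exceeds [a_star], about 1.4123, so all results on the scaled curve apply. *)
    assert (Hr : 0 <= a <= 2 * k0) by (unfold k0; lra).
    assert (HL : 0 < LHS L0 (u_cn a)) by (rewrite LHS_u_cn; apply lhs_trunc_pos; lra).
    assert (HE : energy_hat (gamma_c a) < 2 * PI) by (apply energy_hat_gamma_c; lra).
    assert (HD : 0 < / 2 * / scale a ^ 4 * LHS L0 (u_cn a)).
    { pose proof (scale_pos a Hr) as Hc.
      repeat apply Rmult_lt_0_compat; try apply Rinv_0_lt_compat; try apply pow_lt; lra. }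
    split; [exact HL|]; split; [intros s Hs; now apply gamma_tilde_unit_curvature|].
    split; [now apply gamma_c_class_X|]; split; [now apply turning_gamma_c|].
    split; [exact HE|]; split; [now rewrite energy_hat_rate_gamma_c|].
    intros T g HF Hi; split; [|split].
    + intros t Ht; apply (turning_number_flow T g t HF); [|exact Ht].
      rewrite (turning_number_ext _ (gamma_c a)) by exact Hi; now apply turning_gamma_c.
    + rewrite (energy_hat_ext _ (gamma_c a)) by exact Hi; exact HE.
    + eexists; split; [apply energy_hat_initial_rate; split; [exact HF|exact Hi|exact Hr]|exact HD].
Qed.
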